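(* Consider the classical Hammersley model. For $\lambda>0$ and $x,t\ge0$, $$\operatorname{Cov}\big(\nu_\lambda(x),L_\lambda(x,t)\big)=\lambda\,\mathbb{E}\big(Z^+_\lambda(x,t)\big),$$ and consequently $$\operatorname{Var}L_\lambda(x,t)=\frac{t}{\lambda}-\lambda x+2\lambda\,\mathbb{E}\big(Z^+_\lambda(x,t)\big).$$
   Context: Let $\mathbf P$ be a homogeneous Poisson process of intensity one in $\mathbb R\times(0,\infty)$, all weights equal to $1$; $L(\mathbf p,\mathbf q)$ is the maximal number of points of $\mathbf P$ in a coordinatewise increasing chain inside $\{\mathbf x:p_1<x_1\le q_1,\ p_2<x_2\le q_2\}$. Let $\nu_\lambda$ be a homogeneous Poisson process of intensity $\lambda$ on $\mathbb R$, independent of $\mathbf P$, with counting function $\nu_\lambda(x)=\nu_\lambda((0,x])$ for $x\ge0$, $\nu_\lambda(x)=-\nu_\lambda((x,0])$ for $x<0$. Define $L_\lambda(x,t)=\sup_{z\le x}\{\nu_\lambda(z)+L((z,0),(x,t))\}$, the exit point $Z_\lambda(x,t)=\sup\{z\le x:\ L_\lambda(x,t)=\nu_\lambda(z)+L((z,0),(x,t))\}$, and $Z^+_\lambda=\max(Z_\lambda,0)$. *)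

(* Defs.v *)
From HB Require Import structures.
From mathcomp Require Import all_boot all_order all_algebra.
From mathcomp Require Import all_classical all_reals all_analysis.
Set Implicit Arguments. Unset Strict Implicit. Unset Printing Implicit Defensive.
Import Order.TTheory GRing.Theory Num.Theory.
Import numFieldNormedType.Exports.
Local Open Scope classical_set_scope.
Local Open Scope ring_scope.

Section Hammersley.
Variable R : realType.

Definition pcount (S : choiceType) (X A : set S) : \bar R :=
  (\esum_(i in X `&` A) (1 : \bar R))%E.

Definition poisson_pmf (m : R) (k : nat) : R :=
  expR (- m) * m ^+ k / (k`!)%:R.

Definition leb2 : set (R * R) -> \bar R :=
  (@lebesgue_measure R \x @lebesgue_measure R)%E.

Definition upper_half : set (R * R) := [set u | 0 < u.2].

(* [pts] is a Poisson process of intensity one on R x (0,oo), [nu] a Poisson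
   process of intensity [lam] on R, and the two are independent: the joint
   law of the counts over finitely many pairwise disjoint bounded-measure
   Borel sets is the product of the corresponding Poisson laws. *)
Definition hammersley_model d (T : measurableType d) (P : probability T R)
    (pts : T -> set (R * R)) (nu : T -> set R) (lam : R) : Prop :=
  (forall w, pts w `<=` upper_half) /\
  forall (n m : nat) (A : 'I_n -> set (R * R)) (B : 'I_m -> set R)
         (k : 'I_n -> nat) (j : 'I_m -> nat),
    (forall i, measurable (A i) /\ A i `<=` upper_half /\ (leb2 (A i) < +oo)%E) ->
    (forall i, measurable (B i) /\ (lebesgue_measure (B i) < +oo)%E) ->
    (forall i i', i != i' -> A i `&` A i' = set0) ->
    (forall i i', i != i' -> B i `&` B i' = set0) ->
    let E := [set w | (forall i, pcount (pts w) (A i) = ((k i)%:R)%:E) /\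
                      (forall i, pcount (nu w) (B i) = ((j i)%:R)%:E)] in
    measurable E /\
    P E = ((\prod_(i < n) poisson_pmf (fine (leb2 (A i))) (k i)) *
           (\prod_(i < m) poisson_pmf (lam * fine (lebesgue_measure (B i))) (j i)))%:E.

Definition rect (p q : R * R) : set (R * R) :=
  [set u | p.1 < u.1 <= q.1 /\ p.2 < u.2 <= q.2].

Definition chain_in (X : set (R * R)) (p q : R * R) (C : set (R * R)) : Prop :=
  finite_set C /\ C `<=` X `&` rect p q /\
  forall u v, C u -> C v -> u <> v ->
    (u.1 < v.1 /\ u.2 < v.2) \/ (v.1 < u.1 /\ v.2 < u.2).

Definition Lpp (X : set (R * R)) (p q : R * R) : \bar R :=
  ereal_sup [set (\esum_(u in C) (1 : \bar R))%E | C in chain_in X p q].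

Definition nu_count (Y : set R) (x : R) : \bar R :=
  if 0 <= x then pcount Y [set z : R | (0 < z <= x)%R]
  else (- pcount Y [set z : R | (x < z <= 0)%R])%E.

Definition Llam (X : set (R * R)) (Y : set R) (x t : R) : \bar R :=
  ereal_sup [set (nu_count Y z + Lpp X (z, 0%R) (x, t))%E | z in [set z | z <= x]].

Definition Zlam (X : set (R * R)) (Y : set R) (x t : R) : R :=
  sup [set z | z <= x /\ Llam X Y x t = (nu_count Y z + Lpp X (z, 0%R) (x, t))%E].

Definition Zplus (X : set (R * R)) (Y : set R) (x t : R) : R :=
  Num.max (Zlam X Y x t) 0.

End Hammersley.

(* Main.v *)
(* Write L_lam(x,t) = nu(x) + F, where F = max over z <= x of
   L((z,0),(x,t)) - nu(z,x] is the flux of Hammersley lines through {x} x [0,t].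
   Then Cov(nu(x), L_lam) = lam x + Cov(nu(x), F) and
   Var L_lam = lam x + Var F + 2 Cov(nu(x), F), so two facts suffice:
   F has the first two moments of a Poisson variable of mean t/lam, and
   Cov(nu(x), F) = - lam E(x - Z^+).

   Both come from an exactly solvable discretisation.  Restrict exit points to
   [x-a,x], cut the window into N columns and N rows, and record only which
   cells and which bottom edges are occupied: these bits are independent, and
   for N large the flux is computed by the last-passage recursion on them.

   - If sinks of probability v are added on the left side, with
     p (1-u) (1-v) = u v (u, p the probabilities of a source and of a cell
     being occupied), then each column maps independent Bernoulli(v) vertical
     increments to independent Bernoulli(v) increments (Burke), so the flux
     with sinks is Binomial(N,v), close to Poisson(t/lam).  By max-plus
     linearity the sinks change the flux only if
     #sinks + (bulk height) >= #sources, and this is exponentially unlikely in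
     a since the bulk height is dominated by a stationary model of small rate.
   - For a bit b of probability u, E((b - u) f) = u E((1-b) (f(b:=1) - f)).
     Adding a source at y leaves F unchanged if y < Z and lowers it by one if
     y > Z, hence summing over the columns in [0,x] yields - lam E(x - Z^+).

   Then N -> oo by dominated convergence, and a -> oo by monotone convergence,
   which also shows that F is almost surely finite. *)

(* Burke's theorem is exact only with sinks on the left side, which the model does not have.
   Stationarity therefore holds up to an error, and this error must be uniform in the mesh, because
   N tends to infinity before the width a does. Hence the defect is estimated through exponential
   moments, which Burke's theorem bounds uniformly in N.

   The hypothesis on the model speaks only of counts over Borel sets. It gives directly neither the
   measurability of last-passage values and exit points nor the absence of ties between coordinates.
   Both issues are bypassed: for every locally finite configuration, ties included, a fine enough
   grid computes the flux exactly. Flux and exit point are thus pointwise limits, on an event of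
   probability one, of functions of finitely many bits, and the joint law of these bits follows from
   void probabilities alone.

   Second moments accompany first moments throughout: the variance needs them, and squares also
   serve as dominating functions. *)
Require Import Defs.
From HB Require Import structures.
From mathcomp Require Import all_boot all_order all_algebra.
From mathcomp Require Import all_classical all_reals all_analysis.
From mathcomp Require Import finmap measurable_realfun zify ring lra.
Set Implicit Arguments. Unset Strict Implicit. Unset Printing Implicit Defensive.
Import Order.TTheory GRing.Theory Num.Theory.
Import numFieldNormedType.Exports.
Local Open Scope classical_set_scope.
Local Open Scope ring_scope.

(** * The last-passage recursion on a grid *)

Section grid_recursion.
Local Open Scope nat_scope.

(** The terms of the maximum are the possible last steps of a path: rightwards, upwards, or
    diagonally through an occupied cell. Sources act on the bottom edge only. *)
Fixpoint next_column (h : nat -> nat) (a : bool) (w : nat -> bool) (j : nat) :=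
  if j is j'.+1 then
    maxn (maxn (h j) (next_column h a w j')) (h j' + w j')
  else h 0 + a.

Fixpoint height (h : nat -> nat) (A : nat -> bool) (W : nat -> nat -> bool)
    (i : nat) : nat -> nat :=
  if i is i'.+1 then next_column (height h A W i') (A i') (W i') else h.

Lemma height0 h A W i : height h A W i 0 = h 0 + \sum_(k < i) A k.
Proof.
elim: i => [|i IH] /=; first by rewrite big_ord0 addn0.
by rewrite IH big_ord_recr /= addnA.
Qed.

(** [height] recurses on the last column, whereas [run] consumes its bits from the left; here the
    first column is absorbed into the initial heights. *)
Lemma height_front h A W k :
  height h A W k.+1 = height (next_column h (A 0) (W 0)) (A \o S) (W \o S) k.
Proof. by elim: k => [//|k IH] /=; rewrite -IH. Qed.

Lemma leq_next_column c h h' (a a' : bool) w : (forall j, h j <= h' j + c) ->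
  h 0 + a <= h' 0 + a' + c ->
  forall j, next_column h a w j <= next_column h' a' w j + c.
Proof.
move=> hh ha; elim=> [//|j IH] /=.
by have := hh j.+1; have := hh j; lia.
Qed.

(** Sources matter only through their partial sums; the cases [c] = 0 and [c] = 1 control the effect
    of one extra source. *)
Lemma leq_height c h (A A' : nat -> bool) W :
  (forall i, \sum_(k < i) A k <= \sum_(k < i) A' k + c) ->
  forall i j, height h A W i j <= height h A' W i j + c.
Proof.
move=> AA'; elim=> [j|i IH j] /=; first exact: leq_addr.
apply: leq_next_column => //.
by have := AA' i.+1; rewrite !height0 !big_ord_recr /=; lia.
Qed.

Lemma height_incr_up h A W i : {homo h : m n / m <= n} ->
  {homo height h A W i : m n / m <= n}.
Proof.
move=> hm; suff H j : height h A W i j <= height h A W i j.+1.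
  by apply: homo_leq => //; exact: leq_trans.
case: i => [|i] /=; first by apply: hm.
by lia.
Qed.

(** The bit list has one block of length [n.+1] per column: the source bit, then the cell bits from
    bottom to top. With [b] false the source bits are masked, which leaves the height due to the
    bulk. *)
Fixpoint run (n : nat) (b : bool) (k : nat) (h : nat -> nat) (c : seq bool) :=
  if k is k'.+1 then
    run n b k' (next_column h (b && head false c) (nth false (behead c)))
      (drop n.+1 c)
  else h.

Lemma run_height n k h c : run n true k h c =
  height h (fun i => nth false c (i * n.+1))
    (fun i j => nth false c (i * n.+1 + j.+1)) k.
Proof.
elim: k h c => [//|k IH] h c.
rewrite height_front /= IH nth0; congr height.
- congr next_column; apply/funext => j.
  by rewrite nth_behead mul0n add0n.
- by apply/funext => i /=; rewrite nth_drop mulSn.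
- apply/funext => i; apply/funext => j /=.
  by rewrite nth_drop mulSn addnA.
Qed.

Definition sources (n k : nat) (c : seq bool) : nat :=
  \sum_(i < k) nth false c (i * n.+1).

Lemma run_sources n k h c : run n true k h c 0 = h 0 + sources n k c.
Proof. by rewrite run_height height0. Qed.

Lemma sourcesS n k c : sources n k.+1 c = head false c + sources n k (drop n.+1 c).
Proof.
rewrite /sources big_ord_recl /= mul0n nth0; congr addn.
by apply: eq_bigr => i _; rewrite nth_drop /bump /= add1n mulSn.
Qed.

Lemma run_mono n b k h h' c : (forall j, h j <= h' j) ->
  forall j, run n b k h c j <= run n b k h' c j.
Proof.
elim: k h h' c => [//|k IH] h h' c hh j /=; apply: IH => {}j.
rewrite -[leqRHS]addn0; apply: leq_next_column => [i|]; rewrite addn0 //.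
by rewrite leq_add2r; exact: hh.
Qed.

Lemma run_mask_mono n k h c j : run n false k h c j <= run n true k h c j.
Proof.
elim: k h c j => [//|k IH] h c j /=.
apply: leq_trans (IH _ _ _) _; apply: run_mono => i.
by rewrite -[leqRHS]addn0; apply: leq_next_column => *; lia.
Qed.

(* The recursion is max-plus linear: sinks, at most [T] of them, contribute at
   most [T] plus the height produced by the bulk points alone. *)
Lemma run_max n k T h h1 h0 c :
  (forall j, h j <= maxn (h1 j) (T + h0 j)) -> h 0 <= h1 0 ->
  forall j, run n true k h c j <=
    maxn (run n true k h1 c j) (T + run n false k h0 c j).
Proof.
elim: k h h1 h0 c => [//|k IH] h h1 h0 c hh h01 j /=; apply: IH => /=.
- move=> {}j; elim: j => [|j IHj] /=; first by lia.
  by have := hh j.+1; have := hh j; lia.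
- by lia.
Qed.

Definition corner (n k : nat) (c : seq bool) : nat := run n true k (fun=> 0) c n.

(* The number of Hammersley lines leaving the box through its right side. *)
Definition flux (n k : nat) (c : seq bool) : nat := corner n k c - sources n k c.

Lemma sources_le_run n k h c j : {homo h : m n / m <= n} ->
  sources n k c <= run n true k h c j.
Proof.
move=> hm; apply: leq_trans (leq_addl (h 0) _) _.
rewrite -(run_sources n k h c) run_height.
exact: height_incr_up.
Qed.

Lemma corner_sum n k c : corner n k c = flux n k c + sources n k c.
Proof. by rewrite /flux subnK// sources_le_run. Qed.

End grid_recursion.

(** * Independent bits and Burke's theorem *)

Section bernoulli_expectation.
Variable R : realFieldType.
Implicit Types (ps qs : seq R) (p u v : R).

(* Expectation of a functional of independent bits, the i-th of which is true
   with probability [nth 0 ps i]. *)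
Fixpoint expect ps (f : seq bool -> R) : R :=
  if ps is p :: ps' then
    p * expect ps' (f \o cons true) + (1 - p) * expect ps' (f \o cons false)
  else f [::].

Definition prob_seq ps := all (fun p => 0 <= p <= 1) ps.

Lemma prob_nseq n p : 0 <= p <= 1 -> prob_seq (nseq n p).
Proof. by move=> p01; rewrite /prob_seq all_nseq p01 orbT. Qed.

Lemma eq_expect ps f g :
  (forall s, size s = size ps -> f s = g s) -> expect ps f = expect ps g.
Proof.
elim: ps f g => [|p ps IH] f g fg /=; first exact: fg.
by congr (_ * _ + _ * _); apply: IH => s sps; apply: fg; rewrite /= sps.
Qed.

Lemma expectD ps f g :
  expect ps (fun s => f s + g s) = expect ps f + expect ps g.
Proof.
elim: ps f g => [//|p ps IH] f g /=.
have /= := IH (f \o cons true) (g \o cons true).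
have /= := IH (f \o cons false) (g \o cons false).
by rewrite /comp /= => -> ->; ring.
Qed.

Lemma expectZ ps a f : expect ps (fun s => a * f s) = a * expect ps f.
Proof.
elim: ps f => [//|p ps IH] f /=.
have /= := IH (f \o cons true); have /= := IH (f \o cons false).
by rewrite /comp /= => -> ->; ring.
Qed.

Lemma expectZr ps a f : expect ps (fun s => f s * a) = expect ps f * a.
Proof. by rewrite mulrC -expectZ; apply: eq_expect => s _; rewrite mulrC. Qed.

Lemma expect_cst ps a : expect ps (fun=> a) = a.
Proof. by elim: ps => [//|p ps IH] /=; rewrite /comp IH; ring. Qed.

Lemma le_expect ps f g : prob_seq ps ->
  (forall s, size s = size ps -> f s <= g s) -> expect ps f <= expect ps g.
Proof.
elim: ps f g => [|p ps IH] f g /=; first by move=> _ fg; exact: fg.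
move=> /andP[/andP[p0 p1] pps] fg; apply: lerD; apply: ler_wpM2l => //;
  rewrite ?subr_ge0 //; apply: IH => // s sps; apply: fg; by rewrite /= sps.
Qed.

Lemma expect_cat ps qs f :
  expect (ps ++ qs) f = expect ps (fun s => expect qs (fun r => f (s ++ r))).
Proof. by elim: ps f => [//|p ps IH] f /=; rewrite !IH. Qed.

Lemma expect_sum ps m (f : 'I_m -> seq bool -> R) :
  expect ps (fun s => \sum_(i < m) f i s) = \sum_(i < m) expect ps (f i).
Proof.
elim: m f => [|m IH] f.
  by rewrite big_ord0 -[RHS](expect_cst ps); apply: eq_expect => s _; rewrite big_ord0.
rewrite big_ord_recr /= -IH -expectD.
by apply: eq_expect => s _; rewrite big_ord_recr.
Qed.

(* Resampling one bit; this is the Bernoulli form of the Mecke formula. *)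
Lemma expect_flip ps k f : (k < size ps)%N ->
  expect ps (fun s => (nth false s k)%:R * f s) =
  nth 0 ps k * expect ps f +
  nth 0 ps k * expect ps
    (fun s => (~~ nth false s k)%:R * (f (set_nth false s k true) - f s)).
Proof.
elim: ps k f => [//|p ps IH] [|k] f /= kps; rewrite /comp /=.
  rewrite (@eq_expect ps (fun s => 1%:R * f (true :: s)) (f \o cons true));
    last by move=> s _; rewrite mul1r.
  rewrite (@eq_expect ps (fun s => 0%:R * f (false :: s)) (fun=> 0));
    last by move=> s _; rewrite mul0r.
  rewrite (@eq_expect ps (fun s => 0%:R * _) (fun=> 0));
    last by move=> s _; rewrite mul0r.
  rewrite (@eq_expect ps (fun s => 1%:R * _)
    (fun s => f (true :: s) + (-1) * f (false :: s)));
    last by move=> s _; ring.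
  by rewrite expectD expectZ !expect_cst; ring.
by rewrite !(IH k (fun s => f (_ :: s))) //; ring.
Qed.

Lemma expect_count_exp n p a :
  expect (nseq n p) (fun s => a ^+ count id s) = (1 - p + p * a) ^+ n.
Proof.
elim: n => [|n IH] /=; first by rewrite !expr0.
rewrite /comp /= (@eq_expect _ _ (fun s => a * a ^+ count id s)); last first.
  by move=> s _; rewrite add1n exprS.
by rewrite expectZ IH exprS; ring.
Qed.

Lemma expect_count n p :
  expect (nseq n p) (fun s => (count id s)%:R) = n%:R * p.
Proof.
elim: n => [|n IH] /=; first by rewrite mul0r.
rewrite /comp /= (@eq_expect _ _ (fun s => 1 + (count id s)%:R)); last first.
  by move=> s _; rewrite natrD.
by rewrite expectD expect_cst IH -natr1; ring.
Qed.

Lemma expect_count2 n p :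
  expect (nseq n p) (fun s => (count id s)%:R ^+ 2) =
  n%:R * p * (1 - p) + (n%:R * p) ^+ 2.
Proof.
elim: n => [|n IH] /=; first by rewrite !mul0r expr0n /= addr0.
rewrite /comp /= (@eq_expect _ _
  (fun s => 1 + (2 * (count id s)%:R + (count id s)%:R ^+ 2))); last first.
  by move=> s _; rewrite natrD; ring.
by rewrite !expectD expectZ expect_cst expect_count IH -natr1; ring.
Qed.

End bernoulli_expectation.

Section burke.
Variable R : realFieldType.
Implicit Types (u v p : R) (n k : nat).

(* One column in increment coordinates: from the source bit, the vertical
   increments on its left side and the cell bits to the horizontal increment on
   its top side and the vertical increments on its right side. *)
Fixpoint col_map (a : bool) (bs ws : seq bool) : bool * seq bool :=
  match bs, ws with
  | b :: bs', w :: ws' =>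
    let r := col_map (~~ b && (a || w)) bs' ws' in
    (r.1, (~~ a && (b || w)) :: r.2)
  | _, _ => (a, [::])
  end.

Lemma size_col_map a bs ws : size ws = size bs ->
  size (col_map a bs ws).2 = size bs.
Proof. by elim: bs a ws => [|b bs IH] a [|w ws] //= [sz]; rewrite IH. Qed.

(** At one cell the incoming pair of increments changes in two cases only: (1,1) becomes (0,0), and
    (0,0) becomes (1,1) if the cell is occupied. The hypothesis says that these two transitions have
    the same probability, so the product law is preserved. *)
Lemma burke_column u v p n (f : bool -> seq bool -> R) :
  p * (1 - u) * (1 - v) = u * v ->
  expect (u :: nseq n v) (fun s => expect (nseq n p) (fun ws =>
    let r := col_map (head false s) (behead s) ws in f r.1 r.2)) =
  expect (u :: nseq n v) (fun s => f (head false s) (behead s)).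
Proof.
move=> puv; elim: n f => [//|n IH] f.
(* Expectation over the rows above the first one, when [a] enters them from below and [b] is the
   increment that leaves the first row to the right. *)
pose Phi (a b : bool) := expect (nseq n v) (fun bs => expect (nseq n p) (fun ws =>
  let r := col_map a bs ws in f r.1 (b :: r.2))).
have PhiE b : u * Phi true b + (1 - u) * Phi false b =
    expect (u :: nseq n v) (fun s => f (head false s) (b :: behead s)).
  by rewrite -(IH (fun a s => f a (b :: s))) /=.
transitivity (u * (v * (p * Phi false false + (1 - p) * Phi false false) +
    (1 - v) * (p * Phi true false + (1 - p) * Phi true false)) +
  (1 - u) * (v * (p * Phi false true + (1 - p) * Phi false true) +
    (1 - v) * (p * Phi true true + (1 - p) * Phi false false))).
  rewrite /= /comp /=.
  by congr (_ * (_ * _ + _ * _) + _ * (_ * _ + _ * _));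
    rewrite expectD !expectZ.
transitivity (v * (u * Phi true true + (1 - u) * Phi false true) +
   (1 - v) * (u * Phi true false + (1 - u) * Phi false false)).
  apply/eqP; rewrite -subr_eq0; apply/eqP.
  transitivity ((u * v - p * (1 - u) * (1 - v)) *
    (Phi false false - Phi true true)); first by ring.
  by rewrite puv subrr mul0r.
by rewrite !PhiE /= /comp /=; ring.
Qed.

Definition box_probs (n k : nat) u p : seq R := flatten (nseq k (u :: nseq n p)).

Lemma size_box_probs n k u p : size (box_probs n k u p) = (k * n.+1)%N.
Proof.
by rewrite /box_probs size_flatten /shape map_nseq /= size_nseq sumn_nseq mulnC.
Qed.

Lemma prob_box n k u p : 0 <= u <= 1 -> 0 <= p <= 1 ->
  prob_seq (box_probs n k u p).
Proof.
move=> u01 p01; elim: k => [//|k IH]; rewrite /box_probs /=.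
move: (prob_nseq n p01) IH; rewrite /box_probs /prob_seq /= all_cat u01.
by move=> -> ->.
Qed.

Lemma expect_box n k u p f : expect (box_probs n k.+1 u p) f =
  expect (u :: nseq n p) (fun s => expect (box_probs n k u p) (fun c => f (s ++ c))).
Proof. exact: (expect_cat (u :: nseq n p)). Qed.

Fixpoint box_map n k (bs c : seq bool) : seq bool :=
  if k is k'.+1 then
    box_map n k' (col_map (head false c) bs (take n (behead c))).2 (drop n.+1 c)
  else bs.

Lemma burke n k u v p (f : seq bool -> R) : p * (1 - u) * (1 - v) = u * v ->
  expect (nseq n v) (fun bs => expect (box_probs n k u p)
    (fun c => f (box_map n k bs c))) = expect (nseq n v) f.
Proof.
move=> puv; elim: k => [|k IH]; first by [].
transitivity (expect (nseq n v) (fun bs => expect (u :: nseq n p) (fun s =>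
  expect (box_probs n k u p) (fun c =>
    f (box_map n k (col_map (head false s) bs (behead s)).2 c))))).
  apply: eq_expect => bs _; rewrite expect_box; apply: eq_expect => -[//|a s] /=.
  rewrite size_nseq => -[sn]; apply: eq_expect => c _.
  by rewrite take_size_cat ?drop_size_cat.
pose g bs := expect (box_probs n k u p) (fun c => f (box_map n k bs c)).
have := @burke_column u v p n (fun=> g) puv.
rewrite /= /comp /= -mulrDl (addrC u) subrK mul1r IH => <-.
by rewrite expectD !expectZ.
Qed.

End burke.

(** * Fluxes with and without sinks, in terms of increments *)

Section increments.
Local Open Scope nat_scope.

Definition heights_of (s : nat) (bs : seq bool) (j : nat) : nat :=
  s + count id (take j bs).

(** Cutting off the bottom row: the horizontal increment [a'] on its top side acts as the source bit
    of the rows above. *)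
Lemma next_column_shift h (a a' : bool) w j :
  next_column h a w 1 = h 1 + a' ->
  next_column h a w j.+1 = next_column (h \o S) a' (w \o S) j.
Proof. by move=> h1; elim: j => [//|j IH]; rewrite /= -IH. Qed.

Lemma next_column_col_map s bs a ws j : size ws = size bs -> j <= size bs ->
  next_column (heights_of s bs) a (nth false ws) j =
  heights_of (s + a) (col_map a bs ws).2 j.
Proof.
elim: bs s a ws j => [|b bs IH] s a [|w ws] // [|j].
- by rewrite /heights_of /= !addn0.
- by [].
- by rewrite /heights_of /= !addn0.
case=> sz jn.
have hS : heights_of s (b :: bs) \o S = heights_of (s + b) bs.
  by apply/funext => i; rewrite /heights_of /= addnA.
have wS : nth false (w :: ws) \o S = nth false ws by [].
have := @next_column_shift (heights_of s (b :: bs)) a (~~ b && (a || w))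
  (nth false (w :: ws)) j.
rewrite hS wS IH // => /= ->.
  by rewrite /heights_of /=; case: (a); case: (b); case: (w) => /=; lia.
by rewrite /heights_of /= !take0 /=; case: (a); case: (b); case: (w) => /=; lia.
Qed.

Lemma next_column_eq h h' a w w' n :
  (forall j, j <= n -> h j = h' j) -> (forall j, j < n -> w j = w' j) ->
  forall j, j <= n -> next_column h a w j = next_column h' a w' j.
Proof.
move=> hh ww; elim=> [|j IH] jn /=; first by rewrite hh.
by rewrite !hh ?ww ?IH // ltnW.
Qed.

Lemma run_eq n b k h h' c : (forall j, j <= n -> h j = h' j) ->
  forall j, j <= n -> run n b k h c j = run n b k h' c j.
Proof.
elim: k h h' c => [//|k IH] h h' c hh j jn /=; apply: IH => // {jn}j.
exact: (@next_column_eq _ _ _ _ _ n).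
Qed.

Lemma run_box_map n k s bs c : size bs = n -> size c = k * n.+1 ->
  forall j, j <= n -> run n true k (heights_of s bs) c j =
    heights_of (s + sources n k c) (box_map n k bs c) j.
Proof.
elim: k s bs c => [|k IH] s bs c sbs sc j jn.
  by rewrite /= /sources big_ord0 addn0.
have st : size (take n (behead c)) = n.
  by rewrite size_takel // size_behead sc mulSn; lia.
rewrite /= sourcesS addnA -IH //; last 2 first.
- by rewrite size_col_map // st.
- by rewrite size_drop sc mulSn addKn.
apply: run_eq => // i i_n.
rewrite -next_column_col_map ?st ?sbs //.
apply: (@next_column_eq _ _ _ _ _ n) => // l ln.
by rewrite nth_take.
Qed.

Lemma size_box_map n k bs c : size bs = n -> size c = k * n.+1 ->
  size (box_map n k bs c) = n.
Proof.
elim: k bs c => [//|k IH] bs c sbs sc /=.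
have st : size (take n (behead c)) = n.
  by rewrite size_takel // size_behead sc mulSn; lia.
apply: IH; first by rewrite size_col_map // st.
by rewrite size_drop sc mulSn addKn.
Qed.

Lemma corner_sinks n k bs c : size bs = n -> size c = k * n.+1 ->
  run n true k (heights_of 0 bs) c n =
  sources n k c + count id (box_map n k bs c).
Proof.
move=> sbs sc; rewrite run_box_map // /heights_of add0n.
by rewrite take_oversize // size_box_map.
Qed.

Definition bulk_height n k c := run n false k (fun=> 0) c n.

(** Sinks can only raise heights, and with sinks the corner height is the number of sources plus the
    number of outgoing increments. *)
Lemma flux_le_sinks n k bs c : size bs = n -> size c = k * n.+1 ->
  flux n k c <= count id (box_map n k bs c).
Proof.
move=> sbs sc.
rewrite -(leq_add2l (sources n k c)) -corner_sinks // addnC -corner_sum.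
exact: run_mono.
Qed.

(** This is [run_max] with [T] the number of sinks. When the first term of the maximum wins, the
    sinks do not change the flux. *)
Lemma sinks_le n k bs c : size bs = n -> size c = k * n.+1 ->
  sources n k c + count id (box_map n k bs c) <=
  maxn (sources n k c + flux n k c) (count id bs + bulk_height n k c).
Proof.
move=> sbs sc; rewrite -corner_sinks // (addnC _ (flux _ _ _)) -corner_sum.
apply: run_max => [j|]; last by rewrite /heights_of take0.
rewrite max0n addn0 /heights_of add0n.
by rewrite -{2}(cat_take_drop j bs) count_cat leq_addr.
Qed.

(** The inequality holds for arbitrary sources and sinks, so the right side may be averaged in a
    stationary model of any rate. *)
Lemma bulk_height_le n k bs c : size bs = n -> size c = k * n.+1 ->
  bulk_height n k c <= sources n k c + count id (box_map n k bs c).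
Proof.
move=> sbs sc; rewrite -corner_sinks //.
apply: leq_trans (@run_mask_mono _ _ _ _ _) _; exact: run_mono.
Qed.

Lemma height_eq n h A W W' i :
  (forall i j, j < n -> W i j = W' i j) ->
  forall j, j <= n -> height h A W i j = height h A W' i j.
Proof.
move=> WW; elim: i => [//|i IH] j jn /=.
by apply: (@next_column_eq _ _ _ _ _ n) => // l ln; exact: WW.
Qed.

(** A new source adds one to the number of sources and zero or one to the corner height, so the flux
    drops by one or stays. *)
Lemma flux_set_source n k c i : i < k ->
  flux n k c <= (flux n k (set_nth false c (i * n.+1) true)).+1 /\
  (nth false c (i * n.+1) = false ->
     flux n k (set_nth false c (i * n.+1) true) <= flux n k c).
Proof.
move=> ik; set c' := set_nth _ _ _ _.
pose A l := nth false c (l * n.+1); pose A' l := nth false c' (l * n.+1).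
have A'E l : A' l = (l == i) || A l.
  by rewrite /A' nth_set_nth /= eqn_mul2r /=; case: eqP.
have W i' j : j < n ->
    nth false c' (i' * n.+1 + j.+1) = nth false c (i' * n.+1 + j.+1).
  move=> jn; rewrite nth_set_nth /=; case: eqP => // /eqP e.
  have : (i' * n.+1 + j.+1) %% n.+1 = (i * n.+1) %% n.+1 by rewrite (eqP e).
  by rewrite modnMl modnMDl modn_small // ltnS.
have sumA m : \sum_(l < m) A l <= \sum_(l < m) A' l.
  by apply: leq_sum => l _; rewrite A'E; case: (A l); rewrite ?orbT.
have sumA' m : \sum_(l < m) A' l <= \sum_(l < m) A l + 1.
  apply: (@leq_trans (\sum_(l < m) (A l + (l == i :> nat)))).
    by apply: leq_sum => l _; rewrite A'E; case: (A l); case: eqP.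
  rewrite big_split leq_add2l /=.
  suff -> : \sum_(l < m) (l == i :> nat) = (i < m) by exact: leq_b1.
  by elim: m => [|m IH]; rewrite ?big_ord0 // big_ord_recr /= IH; lia.
have S'E : A i = false -> sources n k c' = sources n k c + 1.
  move=> Ai; rewrite /sources (bigD1 (Ordinal ik)) //= [in RHS](bigD1 (Ordinal ik)) //=.
  rewrite -/(A' _) -/(A _) A'E eqxx Ai add0n addnC; congr addn.
  apply: eq_bigr => l li; rewrite -/(A' _) -/(A _) A'E.
  by rewrite (negbTE (li : l != i :> nat)).
have H1 : corner n k c <= corner n k c'.
  rewrite /corner !run_height (height_eq _ _ _ W) // -[leqRHS]addn0.
  by apply: leq_height => m; rewrite addn0; exact: sumA.
have H2 : corner n k c' <= corner n k c + 1.
  by rewrite /corner !run_height (height_eq _ _ _ W) //; exact: leq_height.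
have S1 : sources n k c <= sources n k c' by exact: sumA.
have S2 : sources n k c' <= sources n k c + 1 by exact: sumA'.
have := corner_sum n k c; have := corner_sum n k c'.
by split => [|/S'E]; lia.
Qed.

(* Without sinks every line is born at a point of the bulk. *)
Lemma flux_le_cells n k c :
  flux n k c <= \sum_(i < k) \sum_(j < n) nth false c (i * n.+1 + j.+1).
Proof.
rewrite /flux leq_subLR -[sources n k c]add0n /corner.
have -> : 0 + sources n k c = run n true k (fun=> 0) c 0.
  by rewrite run_sources.
rewrite run_height.
pose A i := nth false c (i * n.+1); pose W i j := nth false c (i * n.+1 + j.+1).
pose B i j := \sum_(i' < i) \sum_(j' < j) W i' j'.
suff H i j : height (fun=> 0) A W i j <= height (fun=> 0) A W i 0 + B i j by exact: H.
have BS i' j' : B i'.+1 j' = B i' j' + \sum_(l < j') W i' l by rewrite /B big_ord_recr.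
have BW i' j' : B i' j' <= B i' j'.+1.
  by apply: leq_sum => l _; rewrite big_ord_recr /= leq_addr.
elim: i j => [//|i IHi]; elim=> [|j IHj]; first exact: leq_addr.
rewrite BS big_ord_recr /=; move: IHj; rewrite BS /=.
by have := IHi j.+1; have := IHi j; have := BW i j; lia.
Qed.

End increments.

(** * Distance between the flux and its stationary version *)

Section flux_estimate.
Variable R : realFieldType.

Lemma pow4_le_exp16 (g : nat) : (g%:R ^+ 4 : R) <= 16 ^+ g.
Proof.
have -> : (16 : R) = (2 ^ 4)%:R by [].
by rewrite -!natrX ler_nat -expnM mulnC expnM leq_exp2r // ltnW // ltn_expl.
Qed.

(** If the two fluxes differ, [sinks_le] forces sources <= sinks + bulk height, and the product of
    powers of two bounds the indicator of this event. The inequality y^2 <= eta y^4 + 1/(4 eta)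
    separates the size of the defect from this rare event, since their joint law is not at hand. *)
Lemma flux_defect (phi : nat -> R) (eta : R) n k bs c :
  size bs = n -> size c = (k * n.+1)%N -> 0 < eta ->
  {homo phi : i j / (i <= j)%N >-> i <= j} -> 0 <= phi 0%N ->
  (forall i, phi i <= i%:R ^+ 2) ->
  phi (count id (box_map n k bs c)) - phi (flux n k c) <=
  eta * 16 ^+ count id (box_map n k bs c) +
  (4 * eta)^-1 * (2 ^+ count id bs *
    (2^-1 ^+ sources n k c * 2 ^+ bulk_height n k c)).
Proof.
move=> sbs sc eta0 phim phi0 phi2.
have := flux_le_sinks sbs sc; have := sinks_le sbs sc.
set g := count id (box_map _ _ _ _); set s := sources n k c.
set f := flux n k c; set l := bulk_height n k c; set t := count id bs.
move=> gs fg.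
have e0 : 0 <= eta * 16 ^+ g by rewrite mulr_ge0 ?exprn_ge0 ?ltW.
have x0 : 0 <= (4 * eta)^-1 * (2 ^+ t * (2^-1 ^+ s * 2 ^+ l)).
  by rewrite !mulr_ge0 ?invr_ge0 ?exprn_ge0 ?mulr_ge0 ?invr_ge0 // ltW.
have [gf|gf] := leqP g f.
  have -> : g = f by apply/eqP; rewrite eqn_leq gf.
  by rewrite subrr addr_ge0 // -/f; have -> : f = g by apply/eqP; rewrite eqn_leq gf fg.
have st : (s <= t + l)%N by lia.
have ge1 : 1 <= 2 ^+ t * (2^-1 ^+ s * 2 ^+ l) :> R.
  rewrite mulrCA -exprD exprVn mulrC ler_pdivlMr ?exprn_gt0 // mul1r.
  by rewrite ler_eXn2l // ltr1n.
have phiF : 0 <= phi f by exact: le_trans phi0 (phim _ _ _).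
have P4 := pow4_le_exp16 g.
have amgm (y : R) : y ^+ 2 <= eta * y ^+ 4 + (4 * eta)^-1.
  have : 0 <= (4 * eta)^-1 * (2 * eta * y ^+ 2 - 1) ^+ 2.
    by rewrite mulr_ge0 ?sqr_ge0 // invr_ge0 mulr_ge0 // ltW.
  suff -> : (4 * eta)^-1 * (2 * eta * y ^+ 2 - 1) ^+ 2 =
      eta * y ^+ 4 + (4 * eta)^-1 - y ^+ 2 by rewrite subr_ge0.
  by clear -eta0; field; rewrite gt_eqF.
have : phi g - phi f <= g%:R ^+ 2 by have := phi2 g; lra.
move=> /le_trans; apply; apply: le_trans (amgm _) _; apply: lerD.
  by rewrite ler_wpM2l // ltW.
by rewrite ler_peMr // invr_ge0 mulr_ge0 // ltW.
Qed.

Variables (n : nat) (p : R).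
Implicit Types (u v : R) (k : nat).

(** The masked run does not read the source bits, so the two factors are independent; for the same
    reason the source probability in the second factor may be changed to [u']. *)
Lemma expect_sources_bulk u u' a k h (phi : nat -> R) :
  expect (box_probs n k u p)
    (fun c => a ^+ sources n k c * phi (run n false k h c n)) =
  (1 - u + u * a) ^+ k *
  expect (box_probs n k u' p) (fun c => phi (run n false k h c n)).
Proof.
elim: k h => [|k IH] h; first by rewrite /= /sources big_ord0 !expr0 mul1r.
pose Psi w ws := expect (box_probs n k w p) (fun c =>
  phi (run n false k (next_column h false (nth false ws)) c n)).
have runE a' ws c : size ws = n -> run n false k.+1 h (a' :: ws ++ c) n =
    run n false k (next_column h false (nth false ws)) c n.
  move=> sws; rewrite /= drop_size_cat //; apply: run_eq => //.
  by apply: next_column_eq => // j jn; rewrite nth_cat sws jn.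
rewrite !expect_box.
transitivity (expect (u :: nseq n p) (fun s =>
    a ^+ head false s * ((1 - u + u * a) ^+ k * Psi u' (behead s)))).
  apply: eq_expect => -[//|a' ws] sz.
  have sws : size ws = n by case: sz; rewrite size_nseq.
  rewrite -IH -expectZ; apply: eq_expect => c _.
  by rewrite sourcesS runE //= drop_size_cat // exprD mulrA.
transitivity ((1 - u + u * a) ^+ k.+1 *
    expect (u' :: nseq n p) (fun s => Psi u' (behead s))); last first.
  congr (_ * _); apply: eq_expect => -[//|a' ws] sz.
  have sws : size ws = n by case: sz; rewrite size_nseq.
  by apply: eq_expect => c _; rewrite runE.
rewrite /= /comp /= !expectZ expr0 expr1 exprS; ring.
Qed.

(** Burke's theorem gives the law of the outgoing increments, but not jointly with the sources.
    Hence 2^(A+B) is first bounded by (4^A + 4^B)/2, which needs the two marginal laws only. *)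
Lemma expect_bulk_le u' v' k : 0 <= u' <= 1 -> 0 <= v' <= 1 -> 0 <= p <= 1 ->
  p * (1 - u') * (1 - v') = u' * v' ->
  expect (box_probs n k u' p) (fun c => 2 ^+ bulk_height n k c) <=
  2^-1 * ((1 + 3 * u') ^+ k + (1 + 3 * v') ^+ n).
Proof.
move=> u01 v01 p01 puv.
(* The bulk height does not involve sinks; averaging over sinks of probability [v'] makes the
   comparison model stationary. *)
rewrite -[leLHS](expect_cst (nseq n v')).
apply: (@le_trans _ _ (expect (nseq n v') (fun bs =>
  expect (box_probs n k u' p) (fun c => 2^-1 * (4 ^+ sources n k c +
    4 ^+ count id (box_map n k bs c)))))).
  apply: le_expect => [|bs sbs]; first exact: prob_nseq.
  apply: le_expect => [|c sc]; first exact: prob_box.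
  rewrite size_nseq in sbs; rewrite size_box_probs in sc.
  apply: (@le_trans _ _ (2 ^+ (sources n k c + count id (box_map n k bs c)))).
    by rewrite ler_eXn2l ?ltr1n //; exact: bulk_height_le.
  rewrite exprD; have -> : (4 : R) = 2 ^+ 2 by rewrite -natrX.
  rewrite -!exprM !(mulnC 2) !exprM.
  set x : R := 2 ^+ _; set y : R := 2 ^+ _.
  by have := sqr_ge0 (x - y); rewrite sqrrB; lra.
have -> : expect (nseq n v') (fun bs =>
  expect (box_probs n k u' p) (fun c => 2^-1 * (4 ^+ sources n k c +
    4 ^+ count id (box_map n k bs c)))) = 2^-1 *
   (expect (nseq n v') (fun bs =>
      expect (box_probs n k u' p) (fun c => 4 ^+ sources n k c * 1)) +
    expect (nseq n v') (fun bs => expect (box_probs n k u' p)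
      (fun c => 4 ^+ count id (box_map n k bs c)))).
  rewrite -expectD -expectZ; apply: eq_expect => bs _.
  by rewrite -expectD -expectZ; apply: eq_expect => c _; rewrite mulr1.
rewrite (burke n k (fun s => 4 ^+ count id s) puv) expect_count_exp.
rewrite expect_cst (expect_sources_bulk u' u' 4 k (fun=> 0%N) (fun=> 1)).
rewrite expect_cst mulr1.
rewrite (_ : 1 - u' + u' * 4 = 1 + 3 * u'); last by ring.
by rewrite (_ : 1 - v' + v' * 4 = 1 + 3 * v'); last by ring.
Qed.

(** [u] and [v] belong to the model itself, [u'] and [v'] to an auxiliary stationary model with the
    same bulk that controls the bulk height. [eta] stays free and is later fixed by the desired
    accuracy. *)
Lemma expect_flux u v u' v' k (eta : R) (phi : nat -> R) :
  0 <= u <= 1 -> 0 <= v <= 1 -> 0 <= u' <= 1 -> 0 <= v' <= 1 ->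
  0 <= p <= 1 -> p * (1 - u) * (1 - v) = u * v ->
  p * (1 - u') * (1 - v') = u' * v' -> 0 < eta ->
  {homo phi : i j / (i <= j)%N >-> i <= j} -> 0 <= phi 0%N ->
  (forall i, phi i <= i%:R ^+ 2) ->
  expect (box_probs n k u p) (fun c => phi (flux n k c)) <=
    expect (nseq n v) (fun s => phi (count id s)) <=
  expect (box_probs n k u p) (fun c => phi (flux n k c)) +
    eta * (1 + 15 * v) ^+ n + (4 * eta)^-1 * ((1 + v) ^+ n * ((1 - u / 2) ^+ k *
      (2^-1 * ((1 + 3 * u') ^+ k + (1 + 3 * v') ^+ n)))).
Proof.
move=> u01 v01 u01' v01' p01 puv puv' eta0 phim phi0 phi2.
set M := expect (nseq n v) _; set F := expect (box_probs n k u p) _.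
have ME : M = expect (nseq n v) (fun bs => expect (box_probs n k u p)
    (fun c => phi (count id (box_map n k bs c)))).
  by rewrite (burke n k (fun s => phi (count id s)) puv).
apply/andP; split.
  rewrite ME -[F](expect_cst (nseq n v)).
  apply: le_expect => [|bs]; first exact: prob_nseq.
  rewrite size_nseq => sbs; apply: le_expect => [|c]; first exact: prob_box.
  by rewrite size_box_probs => sc; apply: phim; exact: flux_le_sinks.
have E16 : expect (nseq n v) (fun bs => expect (box_probs n k u p)
    (fun c => 16 ^+ count id (box_map n k bs c))) = (1 + 15 * v) ^+ n.
  rewrite (burke n k (fun s => 16 ^+ count id s) puv) expect_count_exp.
  by congr (_ ^+ _); ring.
have E2 : expect (nseq n v) (fun bs => 2 ^+ count id bs) = (1 + v) ^+ n.
  by rewrite expect_count_exp; congr (_ ^+ _); ring.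
have Eb : expect (box_probs n k u p)
    (fun c => 2^-1 ^+ sources n k c * 2 ^+ bulk_height n k c) <=
    (1 - u / 2) ^+ k * (2^-1 * ((1 + 3 * u') ^+ k + (1 + 3 * v') ^+ n)).
  rewrite (expect_sources_bulk u u' 2^-1 k (fun=> 0%N) (fun h => 2 ^+ h)).
  rewrite (_ : 1 - u + u / 2 = 1 - u / 2); last by field.
  apply: ler_wpM2l; last exact: expect_bulk_le.
  by apply: exprn_ge0; lra.
rewrite -addrA -lerBlDl.
have -> : M - F = expect (nseq n v) (fun bs => expect (box_probs n k u p)
    (fun c => phi (count id (box_map n k bs c)) + (-1) * phi (flux n k c))).
  rewrite ME -[- F]mulN1r -(expect_cst (nseq n v) (-1 * F)) -expectD.
  by apply: eq_expect => bs _; rewrite expectD expectZ.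
apply: (@le_trans _ _ (expect (nseq n v) (fun bs => expect (box_probs n k u p)
    (fun c => eta * 16 ^+ count id (box_map n k bs c) +
      (4 * eta)^-1 * (2 ^+ count id bs *
        (2^-1 ^+ sources n k c * 2 ^+ bulk_height n k c)))))).
  apply: le_expect => [|bs]; first exact: prob_nseq.
  rewrite size_nseq => sbs; apply: le_expect => [|c]; first exact: prob_box.
  by rewrite size_box_probs => sc; rewrite mulN1r; exact: flux_defect.
rewrite (eq_expect (g := fun bs =>
  eta * expect (box_probs n k u p) (fun c => 16 ^+ count id (box_map n k bs c)) +
  (4 * eta)^-1 * (2 ^+ count id bs * expect (box_probs n k u p)
     (fun c => 2^-1 ^+ sources n k c * 2 ^+ bulk_height n k c)))); last first.
  by move=> bs _; rewrite expectD !expectZ.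
rewrite expectD !expectZ E16 expectZr E2 lerD2l.
apply: ler_wpM2l; first by rewrite invr_ge0 mulr_ge0 // ltW.
by apply: ler_wpM2l => //; apply: exprn_ge0; lra.
Qed.

End flux_estimate.

(** * Exit points and fine grids *)

Section point_counts.
Variable R : realType.
Implicit Types (Y : set R) (z a b c : R).

Definition ioc z b : set R := [set y | z < y <= b].

Definition ncount Y z b : nat := #|` fset_set (Y `&` ioc z b)|.

Lemma ncount_add Y a b c : finite_set (Y `&` ioc a c) -> a <= b <= c ->
  ncount Y a c = (ncount Y a b + ncount Y b c)%N.
Proof.
move=> fY /andP[ab bc].
have E : Y `&` ioc a c = (Y `&` ioc a b) `|` (Y `&` ioc b c).
  apply/seteqP; split => y /=; rewrite /ioc /=.
    move=> [Yy /andP[ay yc]]; have [yb|yb'] := leP y b; [left|right]; split => //.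
      by rewrite ay.
  move=> [[Yy /andP[ay yb]]|[Yy /andP[yb' yc]]]; split => //.
    by rewrite ay (le_trans yb).
  by rewrite yc (le_lt_trans ab).
have f1 : finite_set (Y `&` ioc a b) by apply: sub_finite_set fY; rewrite E => y; left.
have f2 : finite_set (Y `&` ioc b c) by apply: sub_finite_set fY; rewrite E => y; right.
rewrite /ncount E fset_setU // cardfsU -fset_setI //.
suff -> : (Y `&` ioc a b) `&` (Y `&` ioc b c) = set0.
  by rewrite fset_set0 cardfs0 subn0.
apply/seteqP; split => // y [[_ /andP[_ yb]] [_ /andP[yb' _]]].
by have := le_lt_trans yb yb'; rewrite ltxx.
Qed.

Lemma ncount_eq0 Y a b : (forall y, Y y -> a < y <= b -> False) ->
  ncount Y a b = 0%N.
Proof.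
move=> H; rewrite /ncount (_ : _ `&` _ = set0) ?fset_set0 ?cardfs0 //.
by apply/seteqP; split => // y [Yy yab]; exact: H yab.
Qed.

Lemma ncount_eq1 Y a b y : Y y -> a < y <= b ->
  (forall y', Y y' -> a < y' <= b -> y' = y) -> ncount Y a b = 1%N.
Proof.
move=> Yy yab H; rewrite /ncount (_ : _ `&` _ = [set y]) ?fset_set1 ?cardfs1 //.
by apply/seteqP; split => [y' [Yy' y'ab]|_ ->//] /=; exact: H.
Qed.

Lemma ncount_setU1 Y a b y : finite_set (Y `&` ioc a b) -> ~ Y y ->
  ncount (y |` Y) a b = ((a < y <= b)%R + ncount Y a b)%N.
Proof.
move=> fY Yy; rewrite /ncount; case: (boolP (a < y <= b)) => yab /=.
  rewrite (_ : _ `&` _ = y |` (Y `&` ioc a b)); last first.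
    apply/seteqP; split => z /=; first by move=> [[->|Yz] zab]; [left|right].
    by move=> [->|[Yz zab]]; split => //; [left|right].
  by rewrite fset_setU1 // cardfsU1 in_fset_set // memNset // => -[].
rewrite add0n (_ : (y |` Y) `&` _ = Y `&` ioc a b) //.
apply/seteqP; split => z /=; last by move=> [Yz zab]; split => //; right.
by move=> [[->|Yz] zab] //; move: yab; move: zab; rewrite /ioc /= => ->.
Qed.

End point_counts.

Section exit_flux.
Variable R : realType.
Implicit Types (X : set (R * R)) (Y : set R).

(* With exit points restricted to [l,x], [m] is L_lam(x,t) - nu_lam(x). *)
Definition is_flux X Y (l x t : R) (m : nat) : Prop :=
  (exists z (C : {fset R * R}), [/\ l <= z <= x, chain_in X (z, 0) (x, t) [set` C] &
     #|` C| = (m + ncount Y z x)%N]) /\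
  (forall z (C : {fset R * R}), l <= z <= x -> chain_in X (z, 0) (x, t) [set` C] ->
     (#|` C| <= m + ncount Y z x)%N).

Lemma is_flux_inj X Y l x t m m' :
  is_flux X Y l x t m -> is_flux X Y l x t m' -> m = m'.
Proof.
move=> [[z [C [zx chC cC]]] ub] [[z' [C' [zx' chC' cC']]] ub'].
apply/eqP; rewrite eqn_leq; apply/andP; split.
  by have := ub' _ _ zx chC; rewrite cC leq_add2r.
by have := ub _ _ zx' chC'; rewrite cC' leq_add2r.
Qed.

Definition column_bit Y (xs : nat -> R) i : bool :=
  `[< exists y, Y y /\ xs i < y <= xs i.+1 >].

Definition cell_bit X (xs ts : nat -> R) i j : bool :=
  `[< exists u, [/\ X u, xs i < u.1 <= xs i.+1 & ts j < u.2 <= ts j.+1] >].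

(** Sources and bulk points are pooled: the order of a source and a bulk point inside one column
    would matter for the exit point, and the bits do not record it. *)
Definition coordinate X Y (t q : R) : Prop :=
  Y q \/ exists u, [/\ X u, u.1 = q & 0 < u.2 <= t].

Section fine_grid.
Variables (X : set (R * R)) (Y : set R) (xs ts : nat -> R) (n k : nat).
Hypothesis xsm : {homo xs : i j / (i <= j)%N >-> i <= j}.
Hypothesis tsm : {homo ts : i j / (i <= j)%N >-> i <= j}.
Hypothesis ts0 : ts 0%N = 0.
Let l := xs 0%N.
Let x := xs k.
Let t := ts n.
Hypothesis finY : finite_set (Y `&` ioc l x).
(** Points in a common column must share their abscissa and points in a common row their height, but
    ties are permitted. A strictly increasing chain then uses at most one point of each column and
    each row, so one bit per cell suffices. *)
Hypothesis sepx : forall i q q', (i < k)%N -> coordinate X Y t q ->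
  coordinate X Y t q' -> xs i < q <= xs i.+1 -> xs i < q' <= xs i.+1 -> q = q'.
Hypothesis sepy : forall j u v, (j < n)%N -> X u -> X v ->
  l < u.1 <= x -> l < v.1 <= x ->
  ts j < u.2 <= ts j.+1 -> ts j < v.2 <= ts j.+1 -> u.2 = v.2.

Let A := column_bit Y xs.
Let W := cell_bit X xs ts.
Let H := height (fun=> 0%N) A W.

Lemma sub_finY a b : l <= a -> b <= x -> finite_set (Y `&` ioc a b).
Proof.
move=> la bx; apply: sub_finite_set finY => y [Yy /andP[ay yb]]; split => //.
by apply/andP; split; [exact: le_lt_trans ay|exact: le_trans bx].
Qed.

Lemma ncount_columns i : (i <= k)%N -> ncount Y l (xs i) = (\sum_(c < i) A c)%N.
Proof.
elim: i => [_|i IH ik].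
  rewrite big_ord0; apply: ncount_eq0 => y _ /andP[ly yl].
  by have := lt_le_trans ly yl; rewrite ltxx.
rewrite big_ord_recr /= -IH ?(ltnW ik) // (@ncount_add _ Y l (xs i)); first last.
- by rewrite /l !xsm.
- by apply: sub_finY; rewrite // /x xsm.
congr addn; rewrite /A /column_bit; case: asboolP => [[y [Yy yi]]|nY].
  apply: (ncount_eq1 Yy yi) => y' Yy' y'i.
  by apply: (@sepx i) => //; left.
by apply: ncount_eq0 => y Yy yi; apply: nY; exists y.
Qed.

Lemma chain_in_shrink p q q' C : chain_in X p q C ->
  (forall u, C u -> u.1 <= q'.1 /\ u.2 <= q'.2) -> chain_in X p q' C.
Proof.
move=> [fC [sC ch]] H'; split => //; split => // u Cu.
have [Xu [/andP[a b] /andP[c d]]] := sC _ Cu.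
have [e f] := H' _ Cu.
by split => //; split; [rewrite a e|rewrite c f].
Qed.

Lemma height_ge_chain i j z (C : {fset R * R}) : (i <= k)%N -> (j <= n)%N ->
  l <= z <= xs i -> chain_in X (z, 0) (xs i, ts j) [set` C] ->
  (ncount Y l z + #|` C| <= H i j)%N.
Proof.
have empty q z' (C' : {fset R * R}) : q.1 <= z' \/ q.2 <= 0 ->
    chain_in X (z', 0) q [set` C'] -> #|` C'| = 0%N.
  move=> hq [_ [sC _]]; apply/eqP; rewrite cardfs_eq0; apply/eqP/fsetP => u.
  rewrite in_fset0; apply/negbTE/negP => uC.
  have [_ [/andP[/= a b] /andP[/= c d]]] := sC _ uC.
  case: hq => hq; first by have := lt_le_trans a (le_trans b hq); rewrite ltxx.
  by have := lt_le_trans c (le_trans d hq); rewrite ltxx.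
have mono z' i' : (i' <= k)%N -> l <= z' <= xs i' ->
    (ncount Y l z' <= ncount Y l (xs i'))%N.
  move=> i'k /andP[lz zi]; rewrite (@ncount_add _ Y l z' (xs i')) ?leq_addr //.
    by apply: sub_finY => //; rewrite /x xsm.
  by rewrite lz zi.
elim: i j z C => [|i IHi] j z C.
  move=> _ _ lz ch; rewrite (empty _ _ _ _ ch) /=; last first.
    by left; case/andP: lz.
  by rewrite addn0 (leq_trans (mono _ 0%N _ lz)) // ncount_columns // big_ord0.
elim: j z C => [|j IHj] z C ik jn lz ch.
  rewrite (empty _ _ _ _ ch) /=; last by right; rewrite ts0.
  rewrite addn0 (leq_trans (mono _ i.+1 _ lz)) // ncount_columns // /H.
  by rewrite -[height _ _ _ _ _]/(height (fun=> 0%N) A W i.+1 0) height0.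
have [fC [sC cC]] := ch.
have [low|] := pselect (forall u, u \in C -> u.2 <= ts j).
  apply: leq_trans (IHj z C ik (ltnW jn) lz _) _.
    apply: (chain_in_shrink ch) => u uC /=; split; last exact: low.
    by have [_ [/andP[]]] := sC _ uC.
  by rewrite /H /=; lia.
move=> /existsNP[u /not_implyP[uC /negP]]; rewrite -ltNge => uj.
have [Xu [/andP[/= zu ui] /andP[/= u0 uj1]]] := sC _ uC.
have /andP[lz1 lz2] := lz.
have inx v : v \in C -> l < v.1 <= x.
  move=> vC; have [_ [/andP[/= a b] _]] := sC _ vC.
  by rewrite (le_lt_trans lz1 a) (le_trans b) // /x xsm.
have below v : v \in C -> v <> u -> v.1 < u.1 /\ v.2 < u.2.
  move=> vC vu; have [//|[a b]] := cC _ _ vC uC vu.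
  have [Xv [_ /andP[/= v0 vj]]] := sC _ vC.
  have := @sepy j u v jn Xu Xv (inx _ uC) (inx _ vC).
  rewrite uj uj1 vj (lt_trans uj b) => /(_ isT isT) e.
  by move: b; rewrite e ltxx.
have [ui'|iu] := leP u.1 (xs i).
  apply: leq_trans (IHi j.+1 z C (ltnW ik) jn _ _) _.
  - by rewrite lz1 (le_trans (ltW zu)).
  - apply: (chain_in_shrink ch) => v vC /=; split; last first.
      by have [_ [_ /andP[]]] := sC _ vC.
    have [->//|/eqP vu] := eqVneq v u.
    by have [/ltW/le_trans->] := below _ vC vu.
  by rewrite /H /=; lia.
have Wij : W i j.
  by apply/asboolP; exists u; split; rewrite // ?iu ?ui ?uj.
have tj : ts j.+1 <= t by exact: tsm.
have colu : xs i < u.1 <= xs i.+1 by rewrite iu.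
have coordu : coordinate X Y t u.1.
  by right; exists u; split=> //; rewrite u0 (le_trans uj1).
pose C' := (C `\ u)%fset.
have C'C v : v \in C' -> v \in C /\ v <> u.
  by rewrite in_fsetD1 => /andP[/eqP].
have C'i v : v \in C' -> v.1 <= xs i /\ v.2 <= ts j.
  move=> /C'C[vC vu]; have [v1 v2] := below _ vC vu.
  have [Xv [/andP[/= v3 v4] /andP[/= v5 v6]]] := sC _ vC.
  split; rewrite leNgt; apply/negP => h.
    suff e : v.1 = u.1 by move: v1; rewrite e ltxx.
    apply: (@sepx i) => //; last by rewrite h.
    by right; exists v; split => //; rewrite v5 (le_trans v6).
  suff e : v.2 = u.2 by move: v2; rewrite e ltxx.
  apply: (@sepy j) => //; rewrite ?inx ?uj ?h //.
(* An exit point inside the last column is moved to its left side. No source is lost: one in between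
   would share the column of [u], hence its abscissa, although it lies at or left of [z], and [z] is
   less than [u.1]. *)
pose z' := Num.min z (xs i).
have lz' : l <= z' <= xs i by rewrite le_min lz1 /l xsm //= ge_min lexx orbT.
have nz : ncount Y l z = ncount Y l z'.
  rewrite /z'; have [//|iz] := leP z (xs i).
  rewrite (@ncount_add _ Y l (xs i) z); first last.
  - by rewrite /l xsm //= ltW.
  - by apply: sub_finY => //; rewrite (le_trans lz2) // /x xsm.
  rewrite (@ncount_eq0 _ Y (xs i)) ?addn0 // => y Yy /andP[iy yz].
  suff e : y = u.1 by move: (le_lt_trans yz zu); rewrite e ltxx.
  by apply: (@sepx i) => //; [left|rewrite iy (le_trans yz)].
have chC' : chain_in X (z', 0) (xs i, ts j) [set` C'].
  split=> //; split; last by move=> v w /C'C[vC _] /C'C[wC _]; exact: cC.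
  move=> v vC'; have [vC _] := C'C _ vC'; have [a b] := C'i _ vC'.
  have [Xv [/andP[/= v3 v4] /andP[/= v5 v6]]] := sC _ vC.
  split=> //; split; rewrite /= ?a ?b ?v5 // andbT.
  by rewrite /z' gt_min v3.
have := IHi j z' C' (ltnW ik) (ltnW jn) lz' chC'.
rewrite nz (cardfsD1 u C) uC -/C' => le_ij; apply: leq_trans (leq_maxr _ _).
by rewrite Wij addnCA add1n addn1 ltnS.
Qed.

Lemma height_attained i j : (i <= k)%N -> (j <= n)%N ->
  exists z (C : {fset R * R}), [/\ l <= z <= xs i,
    chain_in X (z, 0) (xs i, ts j) [set` C] &
    (ncount Y l z + #|` C|)%N = H i j].
Proof.
have chain0 p q : chain_in X p q [set` (fset0 : {fset R * R})].
  by split => //; split=> [v|v w] /=; rewrite in_fset0.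
have widen z i' j' i'' j'' (C : {fset R * R}) : (i' <= i'')%N -> (j' <= j'')%N ->
    chain_in X (z, 0) (xs i', ts j') [set` C] ->
    chain_in X (z, 0) (xs i'', ts j'') [set` C].
  move=> ii jj [fC [sC cC]]; split => //; split => // v vC.
  have [Xv [/andP[/= v3 v4] /andP[/= v5 v6]]] := sC _ vC.
  split=> //; split; rewrite /= ?v3 ?v5 //=.
    exact: le_trans v4 (xsm ii).
  exact: le_trans v6 (tsm jj).
elim: i j => [|i IHi] j.
  move=> _ _; exists l, fset0; split; [by rewrite /l !lexx|exact: chain0|].
  rewrite cardfs0 addn0; apply: ncount_eq0 => y _ /andP[ly yl].
  by have := lt_le_trans ly yl; rewrite ltxx.
elim: j => [|j IHj] ik jn.
  exists (xs i.+1), fset0; split => //; first by rewrite lexx andbT /l xsm.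
  by rewrite cardfs0 addn0 ncount_columns // /H height0.
have [z1 [C1 [lz1 ch1 e1]]] := IHi j.+1 (ltnW ik) jn.
have [z2 [C2 [lz2 ch2 e2]]] := IHj ik (ltnW jn).
have [z3 [C3 [lz3 ch3 e3]]] := IHi j (ltnW ik) (ltnW jn).
have lzS z : l <= z <= xs i -> l <= z <= xs i.+1.
  by move=> /andP[-> zi] /=; rewrite (le_trans zi) // xsm.
have HE : H i.+1 j.+1 = maxn (maxn (H i j.+1) (H i.+1 j)) (H i j + W i j) by [].
have up : (H i j <= H i j.+1)%N by apply: height_incr_up.
have [le12|] := leqP (H i j + W i j) (maxn (H i j.+1) (H i.+1 j)).
  rewrite HE (maxn_idPl le12); have [le1|le2] := leqP (H i j.+1) (H i.+1 j).
    by exists z2, C2; split => //; apply: widen ch2.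
  by exists z1, C1; split => //; [exact: lzS|apply: widen ch1].
move=> gt3; have := gt3; rewrite HE => /ltnW/maxn_idPr ->.
(* A diagonal step that wins strictly passes through an occupied cell, since otherwise the step from
   the left does at least as well. *)
have : W i j.
  move: gt3; case: (W i j) => //; rewrite addn0 ltnNge; case/negP.
  by apply: leq_trans up (leq_maxl _ _).
move=> /[dup] Wij /asboolP[u [Xu /andP[iu ui] /andP[ju uj]]].
have uC3 v : v \in C3 -> v.1 < u.1 /\ v.2 < u.2.
  move=> vC; have [C3f [sC _]] := ch3.
  have [Xv [/andP[/= v3 v4] /andP[/= v5 v6]]] := sC _ vC.
  by split; [exact: le_lt_trans v4 iu|exact: le_lt_trans v6 ju].
have uC : u \notin C3 by apply/negP => /uC3[]; rewrite ltxx.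
have /andP[lz3' z3i] := lz3.
exists z3, (u |` C3)%fset; split.
- exact: lzS.
- have ch3' := widen _ _ _ i.+1 j.+1 _ (leqnSn i) (leqnSn j) ch3.
  have [C3f [sC cC]] := ch3'; split => //; split => [v|v w] /=.
    rewrite in_fset1U => /orP[/eqP ->|/sC//]; split=> //; split => /=.
      by rewrite ui (le_lt_trans z3i).
    by rewrite uj andbT (le_lt_trans _ ju) // -ts0 tsm.
  rewrite !in_fset1U => /orP[/eqP ->|vC] /orP[/eqP ->|wC] vw //.
  + by right; exact: uC3.
  + by left; exact: uC3.
  + exact: cC.
- by rewrite cardfsU1 uC /= -e3 Wij addnCA [LHS]addnC.
Qed.

Lemma fine_grid_flux : is_flux X Y l x t (H k n - ncount Y l x).
Proof.
have split_ncount z : l <= z <= x ->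
    ncount Y l x = (ncount Y l z + ncount Y z x)%N.
  by move=> lzx; exact: ncount_add.
have Hge : (ncount Y l x <= H k n)%N.
  rewrite /x ncount_columns // -[leqLHS]add0n -(height0 (fun=> 0%N) A W).
  exact: height_incr_up.
split.
  have [z [C [lz ch e]]] := height_attained (leqnn k) (leqnn n).
  exists z, C; split => //.
  by move: Hge; rewrite -e (split_ncount z) // => *; lia.
move=> z C lz ch; have := height_ge_chain (leqnn k) (leqnn n) lz ch.
move: Hge; rewrite (split_ncount z) //; set a := ncount _ _ _.
by set b := ncount _ _ _; set c := #|` C|; set h := H k n; clearbody a b c h; lia.
Qed.

End fine_grid.
End exit_flux.

(** * Effect of one extra source on the flux *)

Section added_source.
Variable R : realType.
Variables (X : set (R * R)) (Y : set R) (l x t : R).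

Definition exits (m : nat) : set R :=
  [set z | l <= z <= x /\ exists C : {fset R * R},
    chain_in X (z, 0) (x, t) [set` C] /\ #|` C| = (m + ncount Y z x)%N].

Lemma exits_sup m : is_flux X Y l x t m -> has_sup (exits m).
Proof.
move=> [[z [C [lz ch cC]]] _]; split; first by exists z; split => //; exists C.
by exists x => z' [/andP[]].
Qed.

Hypothesis finY : finite_set (Y `&` ioc l x).

Lemma finY_right z : l <= z -> finite_set (Y `&` ioc z x).
Proof.
move=> lz; apply: sub_finite_set finY => y [Yy /andP[zy yx]]; split => //.
by apply/andP; split; [exact: le_lt_trans zy|].
Qed.

(** The new source costs one unit to every exit point left of [y] and nothing to the others. The
    flux therefore survives if some optimal exit point is at or right of [y], and drops by one if
    there is none. *)
Lemma flux_added_source y m m' : ~ Y y -> l < y <= x ->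
  is_flux X Y l x t m -> is_flux X (y |` Y) l x t m' ->
  ((exists2 z, exits m z & y <= z) -> m' = m) /\
  (~ (exists2 z, exits m z & y <= z) -> m = m'.+1).
Proof.
move=> Yy /andP[ly yx] [[z [C [lz ch cC]]] ub] [[z' [C' [lz' ch' cC']]] ub'].
have cnt w : l <= w <= x -> ncount (y |` Y) w x = ((w < y)%R + ncount Y w x)%N.
  by move=> /andP[lw wx]; rewrite ncount_setU1 ?yx ?andbT //; exact: finY_right.
have m'm : (m' <= m)%N.
  by have := ub _ _ lz' ch'; rewrite cC' cnt //; lia.
split.
  move=> [z1 [lz1 [C1 [ch1 c1]]] yz1].
  have := ub' _ _ lz1 ch1; rewrite c1 cnt // ltNge yz1 /=; lia.
move=> nz; have mm' : (m <= m'.+1)%N.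
  have := ub' _ _ lz ch; rewrite cC cnt //.
  by case: (z < y) => /=; lia.
suff : m' != m by lia.
apply/eqP => e; rewrite e in cC'.
have := ub _ _ lz' ch'; rewrite cC' cnt //.
have [zy|yz] := ltP z' y; first by rewrite /=; lia.
move=> _; apply: nz; exists z' => //; split => //; exists C'; split => //.
by rewrite cC' cnt // ltNge yz.
Qed.

(** The case where [y] equals the supremum is left open, so that it need not be known whether the
    supremum is attained. *)
Lemma flux_added_source_sup y m m' : ~ Y y -> l < y <= x ->
  is_flux X Y l x t m -> is_flux X (y |` Y) l x t m' ->
  (y < sup (exits m) -> m' = m) /\ (sup (exits m) < y -> m = m'.+1).
Proof.
move=> Yy lyx fm fm'; have [H1 H2] := flux_added_source Yy lyx fm fm'.
have hs := exits_sup fm; split.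
  by move=> /(sup_gt hs.1) [z ez yz]; apply: H1; exists z => //; exact: ltW.
move=> ys; apply: H2 => -[z ez yz].
have := le_lt_trans yz (le_lt_trans (ub_le_sup hs.2 ez) ys).
by rewrite ltxx.
Qed.

End added_source.

(** * Encoding a point configuration as a list of bits *)

Section regular_grid.
Variable R : realType.
Implicit Types (X : set (R * R)) (Y : set R).

Definition config_bit X Y (xs ts : nat -> R) n m : bool :=
  if (m %% n.+1)%N is j.+1 then cell_bit X xs ts (m %/ n.+1) j
  else column_bit Y xs (m %/ n.+1).

Definition config_bits X Y xs ts n k : seq bool :=
  mkseq (config_bit X Y xs ts n) (k * n.+1).

Lemma config_bit_source X Y xs ts n i :
  config_bit X Y xs ts n (i * n.+1) = column_bit Y xs i.
Proof. by rewrite /config_bit modnMl mulnK. Qed.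

Lemma config_bit_cell X Y xs ts n i j : (j < n)%N ->
  config_bit X Y xs ts n (i * n.+1 + j.+1) = cell_bit X xs ts i j.
Proof.
move=> jn; rewrite /config_bit modnMDl modn_small ?ltnS //.
by rewrite divnMDl // divn_small ?ltnS // addn0.
Qed.

Lemma nth_config_source X Y xs ts n k i : (i < k)%N ->
  nth false (config_bits X Y xs ts n k) (i * n.+1) = column_bit Y xs i.
Proof. by move=> ik; rewrite nth_mkseq ?ltn_mul2r // config_bit_source. Qed.

Lemma nth_config_cell X Y xs ts n k i j : (i < k)%N -> (j < n)%N ->
  nth false (config_bits X Y xs ts n k) (i * n.+1 + j.+1) = cell_bit X xs ts i j.
Proof.
move=> ik jn; rewrite nth_mkseq ?config_bit_cell //.
by rewrite (@leq_trans (i.+1 * n.+1)) ?leq_mul2r // mulSnr ltn_add2l ltnS.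
Qed.

Lemma height_eq_box n k h (A A' : nat -> bool) W W' :
  (forall i, (i < k)%N -> A i = A' i) ->
  (forall i j, (i < k)%N -> (j < n)%N -> W i j = W' i j) ->
  forall i j, (i <= k)%N -> (j <= n)%N -> height h A W i j = height h A' W' i j.
Proof.
move=> AA WW; elim=> [//|i IH] j ik jn /=; rewrite AA //.
apply: (@next_column_eq _ _ _ _ _ n) => // [j' j'n|j' j'n]; last exact: WW.
by apply: IH => //; exact: ltnW.
Qed.

Lemma config_flux X Y (xs ts : nat -> R) n k :
  {homo xs : i j / (i <= j)%N >-> i <= j} ->
  {homo ts : i j / (i <= j)%N >-> i <= j} -> ts 0%N = 0 ->
  finite_set (Y `&` ioc (xs 0%N) (xs k)) ->
  (forall i q q', (i < k)%N -> coordinate X Y (ts n) q ->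
    coordinate X Y (ts n) q' ->
    xs i < q <= xs i.+1 -> xs i < q' <= xs i.+1 -> q = q') ->
  (forall j u v, (j < n)%N -> X u -> X v ->
    xs 0%N < u.1 <= xs k -> xs 0%N < v.1 <= xs k ->
    ts j < u.2 <= ts j.+1 -> ts j < v.2 <= ts j.+1 -> u.2 = v.2) ->
  is_flux X Y (xs 0%N) (xs k) (ts n) (flux n k (config_bits X Y xs ts n k)) /\
  ncount Y (xs 0%N) (xs k) = (\sum_(i < k) column_bit Y xs i)%N.
Proof.
move=> xsm tsm ts0 fY sepx sepy; split; last by apply: ncount_columns sepx _ _.
have := fine_grid_flux xsm tsm ts0 fY sepx sepy.
congr is_flux; rewrite /flux /corner run_height; congr subn.
  apply/esym/(@height_eq_box n k) => // [i ik|i j ik jn].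
    by rewrite nth_config_source.
  by rewrite nth_config_cell.
rewrite (ncount_columns xsm fY sepx) // /sources.
by apply: eq_bigr => i _; rewrite nth_config_source.
Qed.

Lemma config_bits_add X Y xs ts n k i y : (i < k)%N ->
  {homo xs : i j / (i <= j)%N >-> i <= j} -> xs i < y <= xs i.+1 ->
  config_bits X (y |` Y) xs ts n k =
  set_nth false (config_bits X Y xs ts n k) (i * n.+1) true.
Proof.
move=> ik xsm yi; apply: (@eq_from_nth _ false).
  rewrite size_set_nth !size_mkseq; apply/esym/maxn_idPr.
  by rewrite ltn_mul2r.
move=> m; rewrite size_mkseq => mk; rewrite nth_set_nth /= !nth_mkseq //.
case: eqP => [->|mi].
  rewrite config_bit_source; apply/asboolP; exists y; split => //; exact: or_introl.
rewrite /config_bit; case E: (m %% n.+1)%N => [|//].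
apply/asboolP/asboolP => -[z [Yz zm]]; exists z; split => //; last by right.
case: Yz => // zy; exfalso; apply: mi.
rewrite {1}(divn_eq m n.+1) E addn0; congr (_ * _)%N; rewrite zy in zm.
move: yi zm => /andP[iy yi] /andP[my ym].
apply/eqP; rewrite eqn_leq; apply/andP; split; rewrite leqNgt; apply/negP => lt.
  by have := lt_le_trans (lt_le_trans my yi) (xsm _ _ lt); rewrite ltxx.
by have := lt_le_trans (lt_le_trans iy ym) (xsm _ _ lt); rewrite ltxx.
Qed.

End regular_grid.

Section separation.
Variable R : realType.

Lemma finite_separated (Q : set R) : finite_set Q ->
  exists2 d : R, 0 < d & forall q q', Q q -> Q q' -> `|q - q'| < d -> q = q'.
Proof.
move=> /finite_seqP[s ->] {Q}; elim: s => [|a s [d d0 Hd]].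
  by exists 1 => // q q'.
suff [e e0 He] : exists2 e : R, 0 < e & forall q, q \in s -> `|q - a| < e -> q = a.
  exists (Num.min d e); first by rewrite lt_min d0.
  move=> q q' /=; rewrite !inE => /orP[/eqP->|qs] /orP[/eqP->|qs'] //;
    rewrite lt_min => /andP[h1 h2].
  - by apply/esym/He => //; rewrite distrC.
  - exact: He.
  - exact: Hd.
elim: s {Hd} => [|b s [e e0 He]]; first by exists 1.
have [ba|ba] := eqVneq b a.
  by exists e => // q; rewrite inE => /orP[/eqP->//|]; exact: He.
exists (Num.min e `|b - a|); first by rewrite lt_min e0 normr_gt0 subr_eq0.
move=> q; rewrite inE lt_min => /orP[/eqP->|qs] /andP[h1 h2]; last exact: He.
by rewrite ltxx in h2.
Qed.

End separation.

Section uniform_grid.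
Variable R : realType.
Implicit Types (X : set (R * R)) (Y : set R).

Definition gridx (x a : R) (N i : nat) : R := x - a + i%:R * (a / N%:R).
Definition gridt (t : R) (N j : nat) : R := j%:R * (t / N%:R).

Lemma gridx0 x a N : gridx x a N 0 = x - a.
Proof. by rewrite /gridx mul0r addr0. Qed.

Lemma gridxN x a N : (0 < N)%N -> gridx x a N N = x.
Proof.
by move=> N0; rewrite /gridx mulrCA divff ?mulr1 ?subrK // pnatr_eq0 -lt0n.
Qed.

Lemma gridxS x a N i : gridx x a N i.+1 = gridx x a N i + a / N%:R.
Proof. by rewrite /gridx -natr1 mulrDl mul1r addrA. Qed.

Lemma gridx_homo x a N : 0 <= a ->
  {homo gridx x a N : i j / (i <= j)%N >-> i <= j}.
Proof.
move=> a0 i j ij; rewrite /gridx lerD2l ler_wpM2r ?ler_nat //.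
by rewrite divr_ge0 // ler0n.
Qed.

Lemma gridtN t N : (0 < N)%N -> gridt t N N = t.
Proof.
by move=> N0; rewrite /gridt mulrCA divff ?mulr1 // pnatr_eq0 -lt0n.
Qed.

Lemma gridtS t N i : gridt t N i.+1 = gridt t N i + t / N%:R.
Proof. by rewrite /gridt -natr1 mulrDl mul1r. Qed.

Lemma gridt_homo t N : 0 <= t -> {homo gridt t N : i j / (i <= j)%N >-> i <= j}.
Proof.
move=> t0 i j ij; rewrite /gridt ler_wpM2r ?ler_nat //.
by rewrite divr_ge0 // ler0n.
Qed.

Definition window (x a t : R) : set (R * R) :=
  [set u | x - a < u.1 <= x /\ 0 < u.2 <= t].

Definition locally_finite X Y (x a t : R) : Prop :=
  finite_set (X `&` window x a t) /\ finite_set (Y `&` ioc (x - a) x).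

Definition generic X Y (x a t : R) N : Prop :=
  (forall i q q', (i < N)%N -> coordinate X Y t q -> coordinate X Y t q' ->
    gridx x a N i < q <= gridx x a N i.+1 ->
    gridx x a N i < q' <= gridx x a N i.+1 -> q = q') /\
  (forall j u v, (j < N)%N -> X u -> X v ->
    x - a < u.1 <= x -> x - a < v.1 <= x ->
    gridt t N j < u.2 <= gridt t N j.+1 -> gridt t N j < v.2 <= gridt t N j.+1 ->
    u.2 = v.2).

Lemma near_mesh_lt (b d : R) : 0 < d -> \forall N \near \oo, b / N%:R < d.
Proof.
move=> d0; near=> N.
have N0 : (0 : R) < N%:R by rewrite ltr0n; near: N; exact: nbhs_infty_gt.
rewrite ltr_pdivrMr // mulrC -ltr_pdivrMr //.
by near: N; exact: nbhs_infty_gtr.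
Unshelve. all: by end_near. Qed.

(** The finitely many coordinates have a least positive gap, and any smaller mesh separates them. As
    ties are permitted, nothing probabilistic is involved. *)
Lemma near_generic X Y (x a t : R) : 0 <= a -> 0 <= t -> locally_finite X Y x a t ->
  \forall N \near \oo, generic X Y x a t N.
Proof.
move=> a0 t0 [fX fY].
pose Q := (Y `&` ioc (x - a) x) `|` (fst @` (X `&` window x a t)).
have fQ : finite_set Q by rewrite finite_setU; split => //; exact: finite_image.
have fT : finite_set (snd @` (X `&` window x a t)) by exact: finite_image.
have [d d0 Hd] := finite_separated fQ.
have [e e0 He] := finite_separated fT.
near=> N.
have N0 : (0 < N)%N by near: N; exact: nbhs_infty_gt.
have Nd : a / N%:R < d by near: N; exact: near_mesh_lt.
have Ne : t / N%:R < e by near: N; exact: near_mesh_lt.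
split.
  move=> i q q' iN cq cq' iq iq'.
  have inQ r : coordinate X Y t r -> gridx x a N i < r <= gridx x a N i.+1 -> Q r.
    move=> cr /andP[ir ri].
    have rx : x - a < r <= x.
      rewrite (le_lt_trans _ ir) /=; last by rewrite -(gridx0 x a N) gridx_homo.
      by rewrite (le_trans ri) // -[leRHS](gridxN x a N0) gridx_homo.
    case: cr => [Yr|[u [Xu ur u2]]]; [by left|right].
    by exists u => //; split => //; split => //; rewrite ur.
  apply: Hd; [exact: inQ|exact: inQ|].
  move: iq iq'; rewrite gridxS => /andP[h1 h2] /andP[h3 h4].
  by apply: le_lt_trans Nd; rewrite ler_norml; apply/andP; split; lra.
move=> j u v jN Xu Xv ux vx ju jv.
have inT w : X w -> x - a < w.1 <= x -> gridt t N j < w.2 <= gridt t N j.+1 ->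
    (snd @` (X `&` window x a t)) w.2.
  move=> Xw wx /andP[jw wj]; exists w => //; split => //; split => //.
  rewrite (le_lt_trans _ jw) /=.
    by rewrite (le_trans wj) // -[leRHS](gridtN t N0) gridt_homo.
  by rewrite /gridt mulr_ge0 // ?divr_ge0 // ler0n.
apply: He; [exact: inT|exact: inT|].
move: ju jv; rewrite gridtS => /andP[h1 h2] /andP[h3 h4].
by apply: le_lt_trans Ne; rewrite ler_norml; apply/andP; split; lra.
Unshelve. all: by end_near. Qed.

Definition box_bits X Y (x a t : R) N :=
  config_bits X Y (gridx x a N) (gridt t N) N N.

Lemma box_flux X Y (x a t : R) N : 0 <= a -> 0 <= t -> (0 < N)%N ->
  finite_set (Y `&` ioc (x - a) x) -> generic X Y x a t N ->
  is_flux X Y (x - a) x t (flux N N (box_bits X Y x a t N)) /\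
  ncount Y (x - a) x = (\sum_(i < N) column_bit Y (gridx x a N) i)%N.
Proof.
move=> a0 t0 N0 fY [g1 g2].
have := @config_flux R X Y (gridx x a N) (gridt t N) N N
  (gridx_homo _ _ a0) (gridt_homo _ t0).
rewrite gridx0 gridxN // gridtN //; apply => //.
by rewrite /gridt mul0r.
Qed.

End uniform_grid.

(** * The exit point as a limit of sums over columns *)

Section exit_limit.
Variable R : realType.
Implicit Types (X : set (R * R)) (Y : set R).

(* The innermost difference is 1 when an extra source in column [i] lowers the
   flux, that is to the right of the exit point, and 0 to the left of it. *)
Definition gain (x a : R) N (c : seq bool) : R :=
  \sum_(i < N) (a / N%:R) * ((0 <= gridx x a N i)%R%:R *
    ((~~ nth false c (i * N.+1))%:R *
     ((flux N N c)%:R - (flux N N (set_nth false c (i * N.+1) true))%:R))).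

Lemma gain_term N (i : 'I_N) c :
  0 <= (~~ nth false c (i * N.+1))%:R *
    ((flux N N c)%:R - (flux N N (set_nth false c (i * N.+1) true))%:R : R) <= 1.
Proof.
have [H1 H2] := @flux_set_source N N c i (ltn_ord i).
case E : (nth _ _ _) => /=; first by rewrite mul0r lexx ler01.
by rewrite mul1r subr_ge0 ler_nat (H2 E) lerBlDr nat1r ler_nat.
Qed.

Lemma gain_bound (x a : R) N c : 0 <= a -> 0 <= gain x a N c <= a.
Proof.
move=> a0; have [->|N0] := posnP N; first by rewrite /gain big_ord0 lexx.
have e0 : 0 <= a / N%:R by rewrite divr_ge0.
apply/andP; split.
  apply: sumr_ge0 => i _; do 2 apply: mulr_ge0 => //.
  by have /andP[] := gain_term i c.
apply: (@le_trans _ _ (\sum_(i < N) a / N%:R)).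
  apply: ler_sum => i _; rewrite ler_piMr //.
  have /andP[h1 h2] := gain_term i c.
  by case: (0 <= gridx _ _ _ _); rewrite /= ?mul1r ?mul0r ?ler01.
by rewrite sumr_const card_ord -[leLHS]mulr_natr mulfVK // pnatr_eq0 -lt0n.
Qed.

(** The new source must not spoil the separation: if the column contains a bulk point, the source
    takes the abscissa of that point, and otherwise the right end of the column. *)
Lemma exists_generic_source X Y (x a t : R) N i : 0 < a -> 0 <= t -> (i < N)%N ->
  generic X Y x a t N -> column_bit Y (gridx x a N) i = false ->
  exists y, [/\ gridx x a N i < y <= gridx x a N i.+1, ~ Y y &
    generic X (y |` Y) x a t N].
Proof.
move=> a0 t0 iN [g1 g2] /asboolPn nY.
have xsm := @gridx_homo R x a N (ltW a0).
have e0 : 0 < a / N%:R by rewrite divr_gt0 // ltr0n (leq_ltn_trans _ iN).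
suff [y [yi ally]] : exists y, gridx x a N i < y <= gridx x a N i.+1 /\
    forall q, coordinate X Y t q -> gridx x a N i < q <= gridx x a N i.+1 -> q = y.
  exists y; split => // [Yy|]; first by apply: nY; exists y.
  split => // i' q q' i'N cq cq' iq iq'.
  have cY r : coordinate X (y |` Y) t r -> r = y \/ coordinate X Y t r.
    by move=> [[->|Yr]|Xr]; [left|right; left|right; right].
  have same r : gridx x a N i' < y <= gridx x a N i'.+1 -> 
      coordinate X Y t r -> gridx x a N i' < r <= gridx x a N i'.+1 -> r = y.
    move=> i'y; suff -> : i' = i by exact: ally.
    move: yi i'y => /andP[iy yi] /andP[i'y yi'].
    apply/eqP; rewrite eqn_leq; apply/andP; split; rewrite leqNgt; apply/negP => lt.
      by have := lt_le_trans (lt_le_trans i'y yi) (xsm _ _ lt); rewrite ltxx.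
    by have := lt_le_trans (lt_le_trans iy yi') (xsm _ _ lt); rewrite ltxx.
  have [qy|cq1] := cY _ cq; have [qy'|cq1'] := cY _ cq'.
  - by rewrite qy.
  - by rewrite qy; apply/esym/same => //; rewrite -qy.
  - by rewrite qy'; apply/same => //; rewrite -qy'.
  - exact: (g1 i').
have [[u [Xu ui u2]]|nX] := pselect (exists u, [/\ X u,
    gridx x a N i < u.1 <= gridx x a N i.+1 & 0 < u.2 <= t]).
  exists u.1; split => // q cq iq; apply: (g1 i) => //.
  by right; exists u.
exists (gridx x a N i.+1); split; first by rewrite lexx andbT gridxS ltrDl.
move=> q [Yq|[u [Xu uq u2]]] iq; exfalso; first by apply: nY; exists q.
by apply: nX; exists u; split; rewrite // uq.
Qed.

(** [gain] is a Riemann sum for the indicator of [c,x], where c is the positive part of the exit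
    point. Its terms may be wrong only next to c and in the columns that already hold a source; each
    such column costs at most one mesh width. *)
Lemma gain_cvg X Y (x a t : R) m : 0 < a -> 0 <= x <= a -> 0 <= t ->
  locally_finite X Y x a t -> is_flux X Y (x - a) x t m ->
  gain x a N (box_bits X Y x a t N) @[N --> \oo] -->
    x - Num.max (sup (exits X Y (x - a) x t m)) 0.
Proof.
move=> a0 /andP[x0 xa] t0 [fX fY] fm.
set Z := sup _; set c := Num.max Z 0.
have hs := exits_sup fm.
have cx : c <= x.
  by rewrite ge_max x0 andbT; apply: sup_le_ub => [|z [/andP[]]]; first exact: hs.1.
have c0 : 0 <= c by rewrite le_max lexx orbT.
set K := ncount Y (x - a) x.
have key N : (0 < N)%N -> generic X Y x a t N ->
    `|x - c - gain x a N (box_bits X Y x a t N)| <= a * (1 + K%:R) / N%:R.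
  move=> N0 gN.
  have [fN KE] := box_flux (ltW a0) t0 N0 fY gN.
  have mE := is_flux_inj fm fN.
  set e := a / N%:R; have e0 : 0 < e by rewrite divr_gt0 // ltr0n.
  pose xs := gridx x a N; pose b i : bool := column_bit Y xs i.
  have xsS i : xs i.+1 = xs i + e by exact: gridxS.
  pose D (i : 'I_N) : R := (0 <= xs i)%R%:R * ((~~ b i)%:R * (m%:R -
    (flux N N (set_nth false (box_bits X Y x a t N) (i * N.+1) true))%:R)).
  have gE : gain x a N (box_bits X Y x a t N) = \sum_(i < N) e * D i.
    apply: eq_bigr => i _; rewrite /D -mE.
    by rewrite /box_bits nth_config_source.
  have D01 i : 0 <= D i <= 1.
    have := gain_term i (box_bits X Y x a t N); rewrite -mE nth_config_source //.
    rewrite /D -/(b i); case: (0 <= xs i); rewrite /= ?mul1r // mul0r => _.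
    by rewrite lexx ler01.
  have Dy (i : 'I_N) : b i = false -> exists y, [/\ xs i < y <= xs i.+1,
      y < Z -> D i = 0 & Z < y -> 0 <= xs i -> D i = 1].
    move=> bi; have [y [yi nYy gy]] := exists_generic_source a0 t0 (ltn_ord i) gN bi.
    have fy : finite_set ((y |` Y) `&` ioc (x - a) x).
      rewrite setIUl finite_setU; split => //.
      by apply: sub_finite_set (finite_set1 y) => z [].
    have [fN' _] := box_flux (ltW a0) t0 N0 fy gy.
    rewrite /box_bits (@config_bits_add R X Y _ (gridt t N) N N i y (ltn_ord i)
      (gridx_homo _ _ (ltW a0)) yi)
      -/(box_bits X Y x a t N) in fN'.
    have yx : x - a < y <= x.
      case/andP: yi => iy yi; rewrite (le_lt_trans _ iy) /=; last first.
        by rewrite -(gridx0 x a N) gridx_homo // ltW.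
      by rewrite (le_trans yi) // -[leRHS](gridxN x a N0) gridx_homo // ltW.
    have [h1 h2] := flux_added_source_sup fY nYy yx fm fN'.
    exists y; split => //; first by move=> /h1 yZ; rewrite /D yZ subrr !mulr0.
    move=> /h2 mE' xi; rewrite /D xi bi /= !mul1r mE' -natr1 addrAC subrr.
    by rewrite add0r.
  (* In a column that already has a source [D] vanishes by definition, whence the correction by
     [b i]. *)
  have Dlo (i : 'I_N) : (c <= xs i)%R%:R - (b i)%:R <= D i.
    have /andP[D0 _] := D01 i.
    case bi : (b i); first by case: (c <= _); rewrite ?subrr ?sub0r //= (le_trans _ D0) // oppr_le0.
    rewrite subr0; have [ci|//] := leP c (xs i).
    have [y [/andP[iy _] _ ->]] := Dy i bi; rewrite ?lexx //.
      by apply: le_lt_trans iy; apply: le_trans ci; rewrite le_max lexx.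
    exact: le_trans ci.
  have Dup (i : 'I_N) : D i <= (c <= xs i.+1)%R%:R.
    have /andP[D0 D1] := D01 i.
    have [//|ic] := leP c (xs i.+1).
    case bi : (b i); first by rewrite /D bi mul0r mulr0.
    have [xi|xi] := leP 0 (xs i); last by rewrite /D (lt_geF xi) mul0r.
    have [y [/andP[iy yi] -> //]] := Dy i bi.
    have ic' : y < c by exact: le_lt_trans yi ic.
    move: ic'; rewrite lt_max => /orP[//|y0].
    by have := lt_trans (le_lt_trans xi iy) y0; rewrite ltxx.
  (* Sums of indicators are compared with telescoping sums over the grid clamped at [c]. The index
     shift here, and the shift by [e] in [h] below, absorb the column containing [c]. *)
  pose g i := Num.max (xs i) c.
  have tele (G : nat -> R) : \sum_(i < N) (G i.+1 - G i) = G N - G 0%N.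
    by rewrite -(big_mkord xpredT (fun i => G i.+1 - G i)) telescope_sumr.
  have xsN : xs N = x by exact: gridxN.
  have up : gain x a N (box_bits X Y x a t N) <= x - c + e.
    rewrite gE; apply: (@le_trans _ _ (\sum_(i < N) (g i.+2 - g i.+1))).
      apply: ler_sum => i _; apply: (@le_trans _ _ (e * (c <= xs i.+1)%R%:R)).
        by rewrite ler_wpM2l // ltW.
      rewrite /g (xsS i.+1); have [h|h] := leP c (xs i.+1).
        by rewrite mulr1 lerBrDr le_max addrC lexx.
      by rewrite mulr0 subr_ge0 le_max lexx orbT.
    rewrite (tele (fun i => g i.+1)); have : c <= g 1%N by rewrite le_max lexx orbT.
    have -> : g N.+1 = x + e.
      by rewrite /g xsS xsN (max_idPl _) // (le_trans cx) // lerDl ltW.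
    by lra.
  have lo : x - c - e - e * K%:R <= gain x a N (box_bits X Y x a t N).
    have -> : e * K%:R = \sum_(i < N) e * (b i)%:R.
      by rewrite /K KE natr_sum mulr_sumr.
    apply: (@le_trans _ _ (\sum_(i < N) e * (c <= xs i)%R%:R -
        \sum_(i < N) e * (b i)%:R)); last first.
      rewrite gE -sumrB; apply: ler_sum => i _.
      by rewrite -mulrBr ler_wpM2l // ltW.
    rewrite lerD2r.
    pose h i := Num.max (xs i - e) c.
    apply: (@le_trans _ _ (\sum_(i < N) (h i.+1 - h i))).
      have h0 : h 0%N = c.
        apply/max_idPr; rewrite /xs gridx0; apply: le_trans c0.
        by move: e0 xa => *; lra.
      rewrite (tele h) h0 /h xsN.
      by rewrite addrAC lerD2r le_max lexx.
    apply: ler_sum => i _; rewrite /h xsS addrK.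
    have [ci|ci] := leP c (xs i).
      have : xs i - e <= Num.max (xs i - e) c by rewrite le_max lexx.
      by rewrite mulr1; lra.
    by rewrite mulr0 subr_le0 le_max lexx orbT.
  rewrite ler_norml (_ : a * (1 + K%:R) / N%:R = e + e * K%:R); last first.
    by rewrite mulrDr mulr1 mulrDl mulrAC.
  have eK : 0 <= e * K%:R by rewrite mulr_ge0 // ltW.
  by move: up lo; set G := gain _ _ _ _; move=> up lo; apply/andP; split; lra.
apply/cvgrPdist_le => d d0; near=> N.
apply: le_trans (key N _ _) _.
- by near: N; exact: nbhs_infty_gt.
- by near: N; apply: near_generic => //; exact: ltW.
- by apply: ltW; near: N; exact: near_mesh_lt.
Unshelve. all: by end_near. Qed.

End exit_limit.

(** * Sources in [0,x] and bounds uniform in the mesh *)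

Section box_counts.
Variable R : realType.
Implicit Types (X : set (R * R)) (Y : set R).

Definition right_sources (x a : R) N (c : seq bool) : nat :=
  \sum_(i < N) ((0 <= gridx x a N i)%R && nth false c (i * N.+1)).

Lemma column_bit_le_ncount Y (xs : nat -> R) i :
  finite_set (Y `&` ioc (xs i) (xs i.+1)) ->
  (column_bit Y xs i <= ncount Y (xs i) (xs i.+1))%N.
Proof.
move=> fY; rewrite /column_bit; case: asboolP => [[y [Yy yi]]|//] /=.
rewrite /ncount cardfs_gt0; apply/eqP => /fsetP /(_ y).
by rewrite in_fset0 in_fset_set // mem_set.
Qed.

Lemma right_ncount_split Y (x a : R) N : 0 <= x <= a -> (0 < N)%N ->
  finite_set (Y `&` ioc (x - a) x) ->
  ncount Y 0 x = (\sum_(i < N) ncount Y (Num.max (gridx x a N i) 0%R)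
    (Num.max (gridx x a N i.+1) 0%R))%N.
Proof.
move=> /andP[x0 xa] N0 fY.
have a0 : 0 <= a by exact: le_trans x0 xa.
pose g i := Num.max (gridx x a N i) 0.
have gm i j : (i <= j)%N -> g i <= g j.
  move=> ij; rewrite /g ge_max !le_max lexx orbT andbT.
  by rewrite gridx_homo.
have g0 : g 0%N = 0 by apply/max_idPr; rewrite gridx0 subr_le0.
have gN : g N = x by rewrite /g gridxN //; apply/max_idPl.
suff H i : (i <= N)%N ->
    ncount Y 0 (g i) = (\sum_(j < i) ncount Y (g j) (g j.+1))%N.
  by rewrite -{1}gN; exact: H.
elim: i => [_|i IH iN].
  rewrite big_ord0; apply: ncount_eq0 => y _; rewrite g0 => /andP[h1 h2].
  by have := lt_le_trans h1 h2; rewrite ltxx.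
rewrite big_ord_recr /= -IH ?(ltnW iN) //; apply: ncount_add.
  apply: sub_finite_set fY => y [Yy /andP[y0 yg]]; split => //; apply/andP; split.
    by apply: le_lt_trans y0; rewrite subr_le0.
  by rewrite (le_trans yg) // -gN gm.
by rewrite gm // andbT /g le_max lexx orbT.
Qed.

Lemma right_sources_le Y X (x a t : R) N : 0 <= x <= a -> (0 < N)%N ->
  finite_set (Y `&` ioc (x - a) x) ->
  (right_sources x a N (box_bits X Y x a t N) <= ncount Y 0 x)%N.
Proof.
move=> /[dup] xa' /andP[x0 xa] N0 fY; rewrite (right_ncount_split xa' N0 fY).
have a0 : 0 <= a by exact: le_trans x0 xa.
apply: leq_sum => i _; rewrite nth_config_source //.
have [xi|//] := leP 0 (gridx x a N i).
have xS : gridx x a N i <= gridx x a N i.+1 by exact: gridx_homo.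
rewrite [X in ncount _ _ X](max_idPl _) ?(le_trans xi) //=.
apply: column_bit_le_ncount; apply: sub_finite_set fY => y [Yy /andP[h1 h2]].
split => //; apply/andP; split.
  by apply: le_lt_trans h1; rewrite -(gridx0 x a N) gridx_homo.
by rewrite (le_trans h2) // -[leRHS](gridxN x a N0) gridx_homo.
Qed.

Lemma near_right_sources X Y (x a t : R) : 0 <= x <= a -> 0 <= t ->
  locally_finite X Y x a t ->
  \forall N \near \oo, right_sources x a N (box_bits X Y x a t N) = ncount Y 0 x.
Proof.
move=> /[dup] xa' /andP[x0 xa] t0 fXY; have [fX fY] := fXY.
have a0 : 0 <= a by exact: le_trans x0 xa.
(* Adding 0 to the separated set ensures that, on a fine grid, the column straddling 0 has no source
   in its positive part; [right_sources] leaves this column out. *)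
have f0 : finite_set (0 |` (Y `&` ioc (x - a) x)) by rewrite finite_setU.
have [d d0 Hd] := finite_separated f0.
near=> N.
have N0 : (0 < N)%N by near: N; exact: nbhs_infty_gt.
have [g1 _] : generic X Y x a t N by near: N; exact: near_generic.
have Nd : a / N%:R < d by near: N; exact: near_mesh_lt.
rewrite (right_ncount_split xa' N0 fY); apply: eq_bigr => i _.
rewrite nth_config_source //.
have xS : gridx x a N i <= gridx x a N i.+1 by exact: gridx_homo.
have inx y : gridx x a N i < y <= gridx x a N i.+1 -> x - a < y <= x.
  move=> /andP[h1 h2]; apply/andP; split.
    by apply: le_lt_trans h1; rewrite -(gridx0 x a N) gridx_homo.
  by rewrite (le_trans h2) // -[leRHS](gridxN x a N0) gridx_homo.
have [xi|xi] /= := leP 0 (gridx x a N i).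
  rewrite (max_idPl _) ?(le_trans xi) //= /column_bit.
  case: asboolP => [[y [Yy yi]]|nY]; apply/esym.
    by apply: (ncount_eq1 Yy yi) => y' Yy' y'i; apply: (g1 i) => //; left.
  by apply: ncount_eq0 => y Yy yi; apply: nY; exists y.
apply/esym; apply: ncount_eq0 => y Yy /andP[y0 yi].
have yx : gridx x a N i.+1 >= y.
  by move: yi; rewrite le_max => /orP[//|]; rewrite leNgt y0.
have : y = 0.
  apply: Hd; [right; split => //|by left|].
    by apply: inx; rewrite yx (lt_trans xi).
  rewrite subr0 gtr0_norm // (le_lt_trans _ Nd) // (le_trans yx) //.
  by rewrite gridxS gerDr ltW.
by move=> y00; rewrite y00 ltxx in y0.
Unshelve. all: by end_near. Qed.

Definition npoints X (x a t : R) : nat := #|` fset_set (X `&` window x a t)|.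

(** The bound does not depend on the mesh and supplies the dominating function for the limit in [N].
    A point is chosen in each occupied cell, and no point lies in two cells. *)
Lemma box_flux_le X Y (x a t : R) N : 0 <= a -> 0 <= t -> (0 < N)%N ->
  finite_set (X `&` window x a t) ->
  (flux N N (box_bits X Y x a t N) <= npoints X x a t)%N.
Proof.
move=> a0 t0 N0 fX; apply: leq_trans (flux_le_cells _ _ _) _.
rewrite /npoints; set S := fset_set _.
pose inc (u : R * R) i j : bool := (gridx x a N i < u.1 <= gridx x a N i.+1) &&
  (gridt t N j < u.2 <= gridt t N j.+1).
apply: (@leq_trans (\sum_(i < N) \sum_(j < N) \sum_(u <- S) inc u i j)).
  apply: leq_sum => i _; apply: leq_sum => j _.
  rewrite nth_config_cell // /cell_bit; case: asboolP => [[u [Xu u1 u2]]|//] /=.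
  have uS : u \in S.
    rewrite in_fset_set //; apply/mem_set; split => //; split.
      case/andP: u1 => h1 h2; apply/andP; split.
        by apply: le_lt_trans h1; rewrite -(gridx0 x a N) gridx_homo.
      by rewrite (le_trans h2) // -[leRHS](gridxN x a N0) gridx_homo.
    case/andP: u2 => h1 h2; apply/andP; split.
      by apply: le_lt_trans h1; rewrite /gridt mulr_ge0 // ?divr_ge0.
    by rewrite (le_trans h2) // -[leRHS](gridtN t N0) gridt_homo.
  rewrite (big_rem u) //=; apply: leq_trans (leq_addr _ _).
  by rewrite /inc u1 u2.
under eq_bigr do rewrite exchange_big /=.
rewrite exchange_big /= -sum1_size leq_sum // => u _.
have interval (G : nat -> R) (y : R) : {homo G : i j / (i <= j)%N >-> i <= j} ->
    (\sum_(i < N) (G i < y <= G i.+1)%R <= 1)%N.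
  move=> Gm; have [[i [iN iy]]|nex] := pselect (exists i, (i < N)%N /\ G i < y <= G i.+1).
    rewrite (bigD1 (Ordinal iN)) //= iy big1 // => j ji.
    case: (boolP (_ < _ <= _)) => // jy; exfalso; move: ji; apply/negP; rewrite negbK.
    move: iy jy => /andP[h1 h2] /andP[h3 h4].
    apply/eqP/val_inj/eqP => /=; rewrite eqn_leq; apply/andP.
    split; rewrite leqNgt; apply/negP => lt.
      by have := lt_le_trans (lt_le_trans h3 h2) (Gm _ _ lt); rewrite ltxx.
    by have := lt_le_trans (lt_le_trans h1 h4) (Gm _ _ lt); rewrite ltxx.
  rewrite big1 // => i _; case: (boolP (_ < _ <= _)) => // iy.
  by exfalso; apply: nex; exists i.
apply: leq_trans (interval _ u.1 (gridx_homo x N a0)).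
apply: leq_sum => i _; rewrite /inc.
case: (gridx _ _ _ _ < _ <= _) => /=; last by rewrite big1.
exact: interval (gridt_homo N t0).
Qed.

End box_counts.

(** * From finite windows to exit points on the whole half-line *)

Section last_passage.
Variable R : realType.
Implicit Types (X : set (R * R)) (Y : set R).

Lemma esum1_finite (S : choiceType) (A : set S) : finite_set A ->
  (\esum_(i in A) (1 : \bar R) = (#|` fset_set A|%:R)%:E)%E.
Proof.
move=> fA; rewrite esum_fset // fsbig_finite //= sumEFin.
by rewrite -(sum1_size (fset_set A)) natr_sum.
Qed.

Lemma pcount_ncount Y z b : finite_set (Y `&` ioc z b) ->
  pcount R Y [set y : R | (z < y <= b)%R] = (ncount Y z b)%:R%:E.
Proof. exact: esum1_finite. Qed.

Section finite_configuration.
Variables (X : set (R * R)) (Y : set R) (x t : R).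
Hypothesis x0 : 0 <= x.
Hypothesis locfin : forall n : nat, locally_finite X Y x n%:R t.

Lemma finite_ioc a b : b <= x -> finite_set (Y `&` ioc a b).
Proof.
move=> bx; pose n := Num.bound `|x - a|.
have [_ fY] := locfin n; apply: sub_finite_set fY => y [Yy /andP[h1 h2]].
split => //; apply/andP; split; last exact: le_trans bx.
apply: lt_trans h1; rewrite ltrBlDl -ltrBlDr.
exact: le_lt_trans (ler_norm _) (archi_boundP (normr_ge0 _)).
Qed.

Lemma nu_countE z : z <= x ->
  nu_count Y z = ((ncount Y 0 x)%:R - (ncount Y z x)%:R)%:E.
Proof.
move=> zx; rewrite /nu_count; case: ifPn => [z0|].
  rewrite pcount_ncount; last exact: finite_ioc.
  rewrite (@ncount_add _ Y 0 z x); [|exact: finite_ioc|by rewrite z0].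
  by rewrite natrD addrK.
rewrite -ltNge => z0; rewrite pcount_ncount; last exact: finite_ioc.
rewrite (@ncount_add _ Y z 0 x); [|exact: finite_ioc|by rewrite (ltW z0)].
by rewrite natrD opprD addrCA subrr addr0.
Qed.

Lemma Lpp_le z k : (forall C : {fset R * R}, chain_in X (z, 0) (x, t) [set` C] ->
  (#|` C| <= k)%N) -> (Lpp X (z, 0%R) (x, t) <= k%:R%:E)%E.
Proof.
move=> H; apply: ge_ereal_sup => _ [C ch <-].
have [fC _] := ch; rewrite esum1_finite // lee_fin ler_nat; apply: H.
by rewrite fset_setK.
Qed.

Lemma Lpp_ge z (C : {fset R * R}) : chain_in X (z, 0) (x, t) [set` C] ->
  (#|` C|%:R%:E <= Lpp X (z, 0%R) (x, t))%E.
Proof.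
move=> ch; apply: ereal_sup_ubound; exists [set` C] => //.
by rewrite esum1_finite ?set_fsetK.
Qed.

Variables (m n0 : nat).
Hypothesis fluxm : forall n : nat, (n0 <= n)%N -> is_flux X Y (x - n%:R) x t m.

Lemma flux_global_ub z (C : {fset R * R}) : z <= x ->
  chain_in X (z, 0) (x, t) [set` C] -> (#|` C| <= m + ncount Y z x)%N.
Proof.
move=> zx ch; pose n := maxn n0 (Num.bound `|x - z|).
have [_ ub] := fluxm (leq_maxl n0 (Num.bound `|x - z|)); apply: ub => //.
rewrite zx andbT lerBlDl -lerBlDr.
apply: le_trans (ler_norm _) _; apply: le_trans (ltW (archi_boundP (normr_ge0 _))) _.
by rewrite ler_nat leq_maxr.
Qed.

Lemma Llam_flux : Llam X Y x t = ((ncount Y 0 x)%:R + m%:R)%:E.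
Proof.
apply/eqP; rewrite eq_le; apply/andP; split.
  apply: ge_ereal_sup => _ [z zx <-]; rewrite nu_countE //.
  apply: le_trans (leeD2l _ (Lpp_le (fun C => @flux_global_ub z C zx))) _.
  by rewrite -EFinD lee_fin natrD; lra.
have [[z [C [/andP[_ zx] ch cC]]] _] := fluxm (leqnn n0).
apply: le_trans (ereal_sup_ubound _); last by exists z.
rewrite nu_countE //; apply: le_trans (leeD2l _ (Lpp_ge ch)).
by rewrite -EFinD lee_fin cC natrD; lra.
Qed.

(** The first window with flux [m] already contains an optimal exit point, so those farther left do
    not affect the supremum. *)
Lemma Zplus_exits :
  Zplus X Y x t = Num.max (sup (exits X Y (x - n0%:R) x t m)) 0.
Proof.
rewrite /Zplus /Zlam; congr Num.max.
set G := [set z | _]; set E := exits _ _ _ _ _ _.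
have GE z : G z <-> z <= x /\ exists C : {fset R * R},
    chain_in X (z, 0) (x, t) [set` C] /\ #|` C| = (m + ncount Y z x)%N.
  rewrite /G /= Llam_flux; split => -[zx]; last first.
    move=> [C [ch cC]]; split => //.
    suff -> : Lpp X (z, 0) (x, t) = (m + ncount Y z x)%:R%:E.
      by rewrite nu_countE // -EFinD natrD; congr EFin; ring.
    apply/eqP; rewrite eq_le -{2}cC (Lpp_ge ch) andbT.
    by apply: Lpp_le => C'; exact: flux_global_ub.
  move=> e; split => //; apply: contrapT => nC.
  (* Cardinalities are integers: if no chain attains the bound, the supremum over chains stays below
     it by at least one. *)
  have up C : chain_in X (z, 0) (x, t) [set` C] -> (#|` C| < m + ncount Y z x)%N.
    move=> ch; rewrite ltn_neqAle flux_global_ub // andbT.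
    by apply/eqP => cC; apply: nC; exists C.
  have p0 : (0 < m + ncount Y z x)%N.
    have := up fset0; rewrite cardfs0; apply.
    by split => //; split=> [v|v w] /=; rewrite in_fset0.
  have ub : (Lpp X (z, 0%R) (x, t) <= (m + ncount Y z x).-1%:R%:E)%E.
    by apply: Lpp_le => C /up; case: (m + _)%N p0.
  have := leeD2l (nu_count Y z) ub; rewrite -e nu_countE //.
  rewrite -EFinD lee_fin; case: (m + ncount Y z x)%N p0 (natrD R m (ncount Y z x)) => // k _.
  by rewrite -natr1 /= => H1 H2; lra.
have [hE1 hE2] := exits_sup (fluxm (leqnn n0)).
have EG : E `<=` G by move=> z [/andP[_ zx] hC]; apply/GE.
have hG : has_sup G.
  by split; [case: hE1 => z /EG; exists z|exists x => z /GE[]].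
apply/eqP; rewrite eq_le; apply/andP; split; last first.
  by apply: sup_le_ub => // z /EG; apply: ub_le_sup; exact: hG.2.
apply: sup_le_ub; first exact: hG.1.
move=> z /GE[zx hC]; have [lz|zl] := leP (x - n0%:R) z.
  by apply: ub_le_sup => //; split => //; rewrite lz.
have [w Ew] := hE1; apply: le_trans (ub_le_sup hE2 Ew).
by case: Ew => /andP[lw _] _; apply: le_trans lw; exact: ltW.
Qed.

End finite_configuration.

Lemma is_flux_mono X Y x t a b m m' : a <= b ->
  is_flux X Y (x - a) x t m -> is_flux X Y (x - b) x t m' -> (m <= m')%N.
Proof.
move=> ab [[z [C [/andP[lz zx] ch cC]]] _] [_ ub].
rewrite -(leq_add2r (ncount Y z x)) -cC; apply: ub => //.
by rewrite zx (le_trans _ lz) // lerD2l lerN2.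
Qed.

End last_passage.

(** * Almost sure statements and Poisson moments *)

Section full_measure.
Local Open Scope ereal_scope.
Context d (T : measurableType d) (R : realType) (P : probability T R).

Import HBNNSimple.

(* [f] need not be measurable outside [D]: null sets never contribute. *)
Lemma integral_full (D : set T) (f : T -> \bar R) : measurable D -> P D = 1 ->
  \int[P]_w f w = \int[P]_(w in D) f w.
Proof.
move=> mD PD.
have mND : measurable (~` D) by exact: measurableC.
have PND : P (~` D) = 0 by rewrite probability_setC // PD subee.
suff H (g : T -> \bar R) : (forall w, 0 <= g w) ->
    \int[P]_w g w = \int[P]_(w in D) g w.
  by rewrite integralE [RHS]integralE !H.
move=> {}g0; rewrite !ge0_integralE // patch_setT.
apply/eqP; rewrite eq_le; apply/andP; split; apply: ge_ereal_sup => _ [h hg <-].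
  apply: ereal_sup_ubound; exists (proj_nnsfun h mD).
    move=> w; rewrite -mrestrict /patch; case: ifPn => wD; first exact: hg.
    by rewrite lexx.
  rewrite -mrestrict -integral_nnsfun // -[RHS]integralT_nnsfun.
  rewrite [RHS](@ge0_negligible_integral _ _ _ P setT (~` D)) //.
  - by rewrite setTD setCK.
  - exact/measurable_EFinP.
  - by move=> w _; rewrite lee_fin.
apply: ereal_sup_ubound; exists h => // w.
by apply: le_trans (hg w) _; rewrite /patch; case: ifP.
Qed.

Lemma eq_expectation_full (D : set T) (f g : T -> R) : measurable D -> P D = 1 ->
  (forall w, D w -> f w = g w) -> 'E_P[f] = 'E_P[g].
Proof.
move=> mD PD fg; rewrite unlock (integral_full _ mD PD) [RHS](integral_full _ mD PD).
by apply: eq_integral => w /set_mem Dw; rewrite fg.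
Qed.

Lemma expectation_cvg (D : set T) (f_ : nat -> T -> R) (f g : T -> R) :
  measurable D -> P D = 1 -> (forall n, measurable_fun D (f_ n)) ->
  (forall w, D w -> f_ ^~ w @ \oo --> f w) ->
  P.-integrable D (EFin \o g) ->
  (forall n w, D w -> (`|f_ n w| <= g w)%R) ->
  [/\ measurable_fun D f, P.-integrable D (EFin \o f) &
    'E_P[f_ n] @[n --> \oo] --> 'E_P[f]].
Proof.
move=> mD PD mf_ f_f ig f_g.
have mf : measurable_fun D f by exact: measurable_fun_cvg f_f.
have [] := @dominated_convergence _ _ _ P D mD (fun n => EFin \o f_ n)
  (EFin \o f) (EFin \o g) _ _ _ ig _.
- by move=> n; exact/measurable_EFinP.
- exact/measurable_EFinP.
- by apply: aeW => w Dw; apply: cvg_EFin; [exact: nearW|exact: f_f].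
- by apply: aeW => w n Dw; rewrite /= lee_fin; exact: f_g.
move=> iF _ cF; split => //; rewrite unlock (integral_full _ mD PD).
by under eq_fun do rewrite (integral_full _ mD PD).
Qed.

End full_measure.

Section poisson_moments.
Variable R : realType.
Local Open Scope ereal_scope.
Local Notation pmf := (@Defs.poisson_pmf R).

Lemma poisson_weight_ge0 m k : (0 <= m)%R -> (0 <= pmf m k)%R.
Proof.
by move=> m0; rewrite /Defs.poisson_pmf divr_ge0 // mulr_ge0 ?expR_ge0 // exprn_ge0.
Qed.

Lemma poisson_pmf_sum m : (0 <= m)%R -> \sum_(k <oo) (pmf m k)%:E = 1.
Proof.
move=> m0; rewrite [RHS](_ : _ = (expR (- m))%:E * (expR m)%:E); last first.
  by rewrite -EFinM expRN mulVf ?gt_eqF ?expR_gt0.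
under eq_eseriesr.
  move=> n _; rewrite /Defs.poisson_pmf -mulrA EFinM; over.
rewrite /= nneseriesZl/=; last first.
  by move=> n _; rewrite lee_fin divr_ge0// exprn_ge0.
congr *%E; rewrite expRE -EFin_lim; last first.
  rewrite /pseries/=; under eq_fun do rewrite mulrC.
  exact: is_cvg_series_exp_coeff.
apply/congr_lim/funext => n/=; rewrite /pseries/= /series/= -sumEFin//.
by under eq_bigr do rewrite mulrC.
Qed.

(** The weights satisfy k pmf(k) = m pmf(k-1). The choices g = 1 and g(k) = k yield the first two
    moments. *)
Lemma poisson_pmf_shift (m : R) (g : nat -> R) : (0 <= m)%R ->
  (forall k, (0 <= g k)%R) ->
  \sum_(k <oo) (k%:R * g k * pmf m k)%:E =
  m%:E * \sum_(k <oo) (g k.+1 * pmf m k)%:E.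
Proof.
move=> m0 g0; have f0 k : 0 <= (k%:R * g k * pmf m k)%:E 
  by rewrite lee_fin mulr_ge0 ?poisson_weight_ge0 // mulr_ge0.
rewrite nneseries_recl // mul0r mul0r add0e -nneseries_addn // -nneseriesZl; last first.
  by move=> k _; rewrite lee_fin mulr_ge0 ?poisson_weight_ge0.
apply: eq_eseriesr => k _; rewrite addn1 -EFinM; congr EFin.
rewrite /Defs.poisson_pmf factS natrM exprS.
by field; rewrite nat1r !pnatr_eq0 -lt0n fact_gt0.
Qed.

Lemma poisson_pmf_mean m : (0 <= m)%R ->
  \sum_(k <oo) (k%:R * pmf m k)%:E = m%:E.
Proof.
move=> m0; have := @poisson_pmf_shift m (fun=> 1%R) m0 (fun=> ler01).
under eq_eseriesr do rewrite mulr1.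
move=> ->; under eq_eseriesr do rewrite mul1r.
by rewrite poisson_pmf_sum // mule1.
Qed.

Lemma poisson_pmf_second m : (0 <= m)%R ->
  \sum_(k <oo) (k%:R ^+ 2 * pmf m k)%:E = (m + m ^+ 2)%:E.
Proof.
move=> m0; have := @poisson_pmf_shift m (fun k => k%:R)%R m0 (fun k => ler0n R k).
under eq_eseriesr do rewrite -expr2.
move=> ->; rewrite (_ : \sum_(k <oo) _ = (1 + m)%:E); first by congr EFin; ring.
rewrite EFinD -[in RHS](poisson_pmf_mean m0) -[in X in X + _](poisson_pmf_sum m0).
rewrite -nneseriesD.
- by apply: eq_eseriesr => k _; rewrite -EFinD -nat1r mulrDl mul1r.
- by move=> k _; rewrite lee_fin poisson_weight_ge0.
- by move=> k _; rewrite lee_fin mulr_ge0 // poisson_weight_ge0.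
Qed.

Context d (T : measurableType d) (P : probability T R).
Variables (m : R) (E : nat -> set T) (N : T -> nat).
Hypothesis m0 : (0 <= m)%R.
Hypothesis mE : forall k, measurable (E k).
Hypothesis PE : forall k, P (E k) = (pmf m k)%:E.
Hypothesis NE : forall k w, E k w -> N w = k.

Let D := \bigcup_k E k.

Lemma poisson_trivIset : trivIset setT E.
Proof.
by apply/trivIsetP => i j _ _ ij; apply/seteqP; split => // w [/NE Ni /NE Nj];
  rewrite -Ni Nj eqxx in ij.
Qed.

Lemma poisson_measurable_dom : measurable D.
Proof. exact: bigcup_measurable. Qed.

Lemma poisson_full : P D = 1.
Proof.
rewrite /D measure_bigcup //; last exact: poisson_trivIset.
rewrite -[RHS](poisson_pmf_sum m0) (@eq_eseriesl _ _ xpredT); last first.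
  by move=> k; rewrite in_setT.
by apply: eq_eseriesr => k _; exact: PE.
Qed.

Lemma poisson_measurable (g : nat -> R) : measurable_fun D (g \o N).
Proof.
apply/measurable_fun_bigcup => // k.
by apply: (@eq_measurable_fun _ _ _ _ _ (cst (g k))) => // w /set_mem /NE /= ->.
Qed.

Lemma poisson_integral (g : nat -> R) : (forall k, (0 <= g k)%R) ->
  \int[P]_w (g (N w))%:E = \sum_(k <oo) (g k * pmf m k)%:E.
Proof.
move=> g0; rewrite (integral_full _ poisson_measurable_dom poisson_full).
rewrite ge0_integral_bigcup //; last exact: poisson_trivIset.
  apply: eq_eseriesr => k _; rewrite EFinM -PE -integral_cst //.
  by apply: eq_integral => w /set_mem /NE ->.
  by apply/measurable_EFinP; exact: poisson_measurable.
by move=> w _; rewrite lee_fin.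
Qed.

End poisson_moments.

(** * The law of the grid bits *)

Section point_process.
Variable R : realType.
Local Notation leb := (@lebesgue_measure R).
Local Notation pmf := (@Defs.poisson_pmf R).

Lemma pcount_natP (S : choiceType) (X A : set S) k :
  pcount R X A = k%:R%:E <->
  finite_set (X `&` A) /\ #|` fset_set (X `&` A)| = k.
Proof.
split=> [e|[fA ck]]; last by rewrite /pcount esum1_finite // ck.
suff fA : finite_set (X `&` A).
  split => //; move: e; rewrite /pcount esum1_finite // => -[/eqP].
  by rewrite eqr_nat => /eqP.
apply: contrapT => /(@infinite_set_fset _ _ k.+1) [B BXA kB].
have : ((k.+1)%:R%:E <= pcount R X A)%E.
  apply: esum_ge; exists [set` B]; first by split.
  rewrite fsbig_finite //= set_fsetK sumEFin lee_fin.
  rewrite (_ : \sum_(i <- B) _ = #|` B|%:R) ?ler_nat //.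
  by rewrite -(sum1_size B) natr_sum.
by rewrite e lee_fin ler_nat ltnn.
Qed.

Lemma pcount_eq0 (S : choiceType) (X A : set S) :
  pcount R X A = 0%:R%:E <-> X `&` A = set0.
Proof.
rewrite (pcount_natP X A 0); split=> [[fA /cardfs0_eq e]|->].
  exact/fset_set_set0.
by rewrite fset_set0 cardfs0.
Qed.

Lemma leb2U (A B : set (R * R)) : measurable A -> measurable B ->
  A `&` B = set0 -> (leb2 (A `|` B) = leb2 A + leb2 B)%E.
Proof. by move=> mA mB AB; rewrite /leb2 measureU. Qed.

Context d (T : measurableType d) (P : probability T R).
Variables (pts : T -> set (R * R)) (nu : T -> set R) (lam : R).
Hypothesis model : hammersley_model P pts nu lam.

Definition boundedX (A : set (R * R)) :=
  [/\ measurable A, A `<=` @upper_half R & (leb2 A < +oo)%E].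
Definition boundedY (B : set R) := measurable B /\ (leb B < +oo)%E.

Lemma model_pair A B k j : boundedX A -> boundedY B ->
  let E := [set w | pcount R (pts w) A = k%:R%:E /\ pcount R (nu w) B = j%:R%:E] in
  measurable E /\
  P E = (pmf (fine (leb2 A)) k * pmf (lam * fine (leb B)) j)%:E.
Proof.
move=> [mA uA fA] [mB fB] E.
have [_ /(_ 1%N 1%N (fun=> A) (fun=> B) (fun=> k) (fun=> j))] := model.
rewrite !big_ord1 (_ : [set w | _] = E); first apply => //.
- by move=> i i'; rewrite !ord1.
- by move=> i i'; rewrite !ord1.
apply/seteqP; split=> [w [h1 h2]|w [h1 h2]]; last by split.
by split; [exact: (h1 ord0)|exact: (h2 ord0)].
Qed.

Lemma boundedX0 : boundedX set0.
Proof. by split => //; rewrite /leb2 measure0. Qed.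

Lemma boundedY0 : boundedY set0.
Proof. by split => //; rewrite measure0. Qed.

Lemma pmf00 : pmf 0 0 = 1.
Proof. by rewrite /Defs.poisson_pmf oppr0 expR0 expr0 fact0 mulr1 divr1. Qed.

Lemma points_law A k : boundedX A ->
  measurable [set w | pcount R (pts w) A = k%:R%:E] /\
  P [set w | pcount R (pts w) A = k%:R%:E] = (pmf (fine (leb2 A)) k)%:E.
Proof.
move=> bA; have /= := @model_pair A set0 k 0 bA boundedY0.
rewrite measure0 mulr0 pmf00 mulr1 (_ : [set w | _ /\ _] =
  [set w | pcount R (pts w) A = k%:R%:E]) //.
by apply/seteqP; split => [w []//|w h]; split => //; rewrite pcount_eq0 setI0.
Qed.

Lemma sources_law B j : boundedY B ->
  measurable [set w | pcount R (nu w) B = j%:R%:E] /\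
  P [set w | pcount R (nu w) B = j%:R%:E] = (pmf (lam * fine (leb B)) j)%:E.
Proof.
move=> bB; have /= := @model_pair set0 B 0 j boundedX0 bB.
rewrite (_ : leb2 set0 = 0%E); last by rewrite /leb2 measure0.
rewrite pmf00 mul1r (_ : [set w | _ /\ _] =
  [set w | pcount R (nu w) B = j%:R%:E]) //.
by apply/seteqP; split => [w []//|w h]; split => //; rewrite pcount_eq0 setI0.
Qed.

Definition void (A : set (R * R)) (B : set R) : set T :=
  [set w | pts w `&` A = set0 /\ nu w `&` B = set0].

Lemma void_law A B : boundedX A -> boundedY B -> measurable (void A B) /\
  P (void A B) = (expR (- (fine (leb2 A) + lam * fine (leb B))))%:E.
Proof.
move=> bA bB; have /= := @model_pair A B 0 0 bA bB.
rewrite (_ : [set w | _ /\ _] = void A B); last first.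
  by apply/seteqP; split=> w [/pcount_eq0 h1 /pcount_eq0 h2].
rewrite /Defs.poisson_pmf !expr0 fact0 !mulr1 !divr1 -expRD -opprD; exact.
Qed.

Section bits.
Variables (Af : nat -> set (R * R)) (Bf : nat -> set R) (M : nat).
Hypothesis bAf : forall k, (k < M)%N -> boundedX (Af k).
Hypothesis bBf : forall k, (k < M)%N -> boundedY (Bf k).
Hypothesis dAf : forall k l, (k < M)%N -> (l < M)%N -> k != l -> Af k `&` Af l = set0.
Hypothesis dBf : forall k l, (k < M)%N -> (l < M)%N -> k != l -> Bf k `&` Bf l = set0.

(** Bulk cells and source intervals share one index set, so that a single list of bits covers both;
    in the grid one of the two sets is empty at each index. *)
Definition bit k w : bool :=
  `[< (exists u, pts w u /\ Af k u) \/ (exists y, nu w y /\ Bf k y) >].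

Definition mass k : R := fine (leb2 (Af k)) + lam * fine (leb (Bf k)).

Definition bit_prob k : R := 1 - expR (- mass k).

Lemma bitN k w : ~~ bit k w <-> void (Af k) (Bf k) w.
Proof.
split=> [/asboolPn nb|[h1 h2]].
  split; apply/seteqP; split => // z [z1 z2]; apply: nb; [left|right]; by exists z.
apply/asboolPn => -[[u [u1 u2]]|[y [y1 y2]]].
  by have : (pts w `&` Af k) u by []; rewrite h1.
by have : (nu w `&` Bf k) y by []; rewrite h2.
Qed.

(** Several bits vanish together exactly when the union of their sets is void, and masses add up
    over disjoint unions. *)
Lemma void_bits_law (r : seq nat) : uniq r -> {in r, forall k, (k < M)%N} ->
  measurable [set w | {in r, forall k, ~~ bit k w}] /\
  P [set w | {in r, forall k, ~~ bit k w}] = (\prod_(k <- r) expR (- mass k))%:E.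
Proof.
move=> ur rM.
suff [A [B [[bA bB VE sA] [sB lA lB]]]] : exists A B,
   [/\ boundedX A, boundedY B,
     [set w | {in r, forall k, ~~ bit k w}] = void A B &
     (A `<=` \bigcup_(k in [set` r]) Af k)] /\
   [/\ (B `<=` \bigcup_(k in [set` r]) Bf k),
     fine (leb2 A) = \sum_(k <- r) fine (leb2 (Af k)) &
     fine (leb B) = \sum_(k <- r) fine (leb (Bf k))].
  have [mV PV] := void_law bA bB; rewrite VE; split => //.
  rewrite PV lA lB mulr_sumr -big_split /= -expR_sum.
  by rewrite (big_morph _ (@opprD R) (@oppr0 R)).
elim: r ur rM => [_ _|k r IH /= /andP[kr ur] rM].
  exists set0, set0; split; first split.
  - exact: boundedX0.
  - exact: boundedY0.
  - by apply/seteqP; split => w // _; split; rewrite setI0.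
  - by [].
  by split; rewrite ?big_nil // ?measure0 // /leb2 measure0.
have kM : (k < M)%N by apply: rM; rewrite mem_head.
have rM' : {in r, forall k, (k < M)%N} by move=> l lr; apply: rM; rewrite inE lr orbT.
have [A [B [[bA bB VE sA] [sB lA lB]]]] := IH ur rM'.
have [mA uA fA] := bA; have [mB fB] := bB.
have [mA' uA' fA'] := bAf kM; have [mB' fB'] := bBf kM.
have AA : Af k `&` A = set0.
  apply/seteqP; split => // u [ku /sA[l /= lr lu]].
  have : (Af k `&` Af l) u by [].
  by rewrite dAf // ?rM' //; apply: contraNneq kr => ->.
have BB : Bf k `&` B = set0.
  apply/seteqP; split => // u [ku /sB[l /= lr lu]].
  have : (Bf k `&` Bf l) u by [].
  by rewrite dBf // ?rM' //; apply: contraNneq kr => ->.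
have lAA : (leb2 (Af k `|` A) = leb2 (Af k) + leb2 A)%E by exact: leb2U.
have lBB : (leb (Bf k `|` B) = leb (Bf k) + leb B)%E by rewrite measureU.
have ge2 C : (0 <= leb2 C :> \bar R)%E by rewrite /leb2.
exists (Af k `|` A), (Bf k `|` B); split; first split.
- split; [exact: measurableU|by move=> u [/uA'|/uA]|].
  by rewrite lAA lte_add_pinfty.
- by split; [exact: measurableU|rewrite lBB lte_add_pinfty].
- apply/seteqP; split=> [w /= h|w [h1 h2] /= l].
    have /bitN[k1 k2] : ~~ bit k w by apply: h; rewrite mem_head.
    have [] : void A B w.
      by rewrite -VE => l lr; apply: h; rewrite inE lr orbT.
    by move=> a b; split; rewrite setIUr ?k1 ?k2 ?a ?b setU0.
  have [a1 a2] : pts w `&` Af k = set0 /\ pts w `&` A = set0.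
    by move: h1; rewrite setIUr setU_eq0.
  have [b1 b2] : nu w `&` Bf k = set0 /\ nu w `&` B = set0.
    by move: h2; rewrite setIUr setU_eq0.
  rewrite inE => /orP[/eqP ->|lr]; first exact/bitN.
  have : void A B w by [].
  by rewrite -VE => /(_ _ lr).
- by move=> u [ku|/sA[l lr lu]]; [exists k => //=; rewrite mem_head|
    exists l => //=; rewrite inE lr orbT].
split.
- by move=> u [ku|/sB[l lr lu]]; [exists k => //=; rewrite mem_head|
    exists l => //=; rewrite inE lr orbT].
- by rewrite big_cons -lA lAA fineD // ge0_fin_numE.
- by rewrite big_cons -lB lBB fineD // ge0_fin_numE.
Qed.


(** Induction on the bits required to be set: such an event is the event without the condition on
    [k], minus the event where bit [k] vanishes, and both have fewer set bits. *)
Lemma bits_event_law (r s : seq nat) : uniq (r ++ s) ->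
  {in r ++ s, forall k, (k < M)%N} ->
  measurable [set w | {in r, forall k, ~~ bit k w} /\ {in s, forall k, bit k w}] /\
  P [set w | {in r, forall k, ~~ bit k w} /\ {in s, forall k, bit k w}] =
    (\prod_(k <- r) (1 - bit_prob k) * \prod_(k <- s) bit_prob k)%:E.
Proof.
elim: s r => [|k s IH] r.
  rewrite cats0 => ur rM; have [mV PV] := void_bits_law ur rM.
  rewrite (_ : [set w | _ /\ _] = [set w | {in r, forall k, ~~ bit k w}]).
    split => //; rewrite PV big_nil mulr1; congr EFin.
    by apply: eq_bigr => k _; rewrite /bit_prob subKr.
  by apply/seteqP; split => [w []|w h].
move=> urs rsM.
have p1 : perm_eq (k :: r ++ s) (r ++ k :: s).
  by rewrite perm_sym; exact: permEl (perm_catCA r [:: k] s).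
have urs1 : uniq (k :: r ++ s) by rewrite (perm_uniq p1).
have rsM1 : {in k :: r ++ s, forall l, (l < M)%N}.
  by move=> l; rewrite (perm_mem p1); exact: rsM.
have [m1 P1] : measurable _ /\ _ := IH (k :: r) urs1 rsM1.
have [m2 P2] : measurable _ /\ _ := IH r (proj2 (andP urs1))
  (fun l lr => rsM1 l (mem_behead (s := k :: _) lr)).
have sub12 : [set w | {in k :: r, forall k, ~~ bit k w} /\ {in s, forall k, bit k w}]
    `<=` [set w | {in r, forall k, ~~ bit k w} /\ {in s, forall k, bit k w}].
  by move=> w [h1 h2]; split => // l lr; apply: h1; rewrite inE lr orbT.
rewrite (_ : [set w | _ /\ {in k :: s, _}] =
  [set w | {in r, forall k, ~~ bit k w} /\ {in s, forall k, bit k w}] `\`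
  [set w | {in k :: r, forall k, ~~ bit k w} /\ {in s, forall k, bit k w}]); last first.
  apply/seteqP; split => [w [h1 h2]|w [[h1 h2] h3]].
    split; first by split => // l ls; apply: h2; rewrite inE ls orbT.
    by move=> [/(_ k (mem_head _ _))]; rewrite h2 ?mem_head.
  split => // l; rewrite inE => /orP[/eqP ->|]; last exact: h2.
  apply: contrapT => /negP nk; apply: h3; split => // l'.
  by rewrite inE => /orP[/eqP ->//|]; exact: h1.
split; first exact: measurableD.
rewrite measureD //; last by rewrite ltey_eq fin_num_measure.
rewrite setIidr //.
transitivity ((\prod_(k <- r) (1 - bit_prob k) * \prod_(k <- s) bit_prob k)%:E -
  (\prod_(k <- k :: r) (1 - bit_prob k) * \prod_(k <- s) bit_prob k)%:E)%E.
  by congr (_ - _)%E; [exact: P2|exact: P1].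
by rewrite -EFinB !big_cons; congr EFin; ring.
Qed.

Lemma measurable_bit k : (k < M)%N -> measurable_fun setT (bit k).
Proof.
move=> kM; apply: (@measurable_fun_bool _ _ _ _ false); rewrite setTI.
rewrite (_ : _ @^-1` _ = void (Af k) (Bf k)).
  by have [] := void_law (bAf kM) (bBf kM).
apply/seteqP; split => w /= h; first by apply/bitN; rewrite h.
by apply/negbTE/bitN.
Qed.

Lemma measurable_bits (f : seq bool -> R) q c : {in q, forall k, (k < M)%N} ->
  measurable_fun setT (fun w => f (c ++ [seq bit k w | k <- q])).
Proof.
elim: q c => [|k q IH] c qM.
  by rewrite /= cats0; exact: measurable_cst.
have qM' : {in q, forall k, (k < M)%N} by move=> l lq; apply: qM; rewrite inE lq orbT.
rewrite (_ : (fun w => _) = (fun w => if bit k w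
    then f (rcons c true ++ [seq bit k w | k <- q])
    else f (rcons c false ++ [seq bit k w | k <- q]))); last first.
  by apply/funext => w /=; case: (bit k w); rewrite cat_rcons.
apply: measurable_fun_ifT; [|exact: IH|exact: IH].
by apply: measurable_bit; apply: qM; rewrite mem_head.
Qed.

(** [q] lists the bits still random and the prefix [c] stands for those already revealed. The
    induction splits the event according to the next bit of [q]. *)
Lemma bits_law_cond (f : seq bool -> R) q r s c : (forall l, 0 <= f l) ->
  uniq ((r ++ s) ++ q) -> {in (r ++ s) ++ q, forall k, (k < M)%N} ->
  (\int[P]_(w in [set w | {in r, forall k, ~~ bit k w} /\ {in s, forall k, bit k w}])
    (f (c ++ [seq bit k w | k <- q]))%:E)%E =
  (\prod_(k <- r) (1 - bit_prob k) * \prod_(k <- s) bit_prob k *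
   expect [seq bit_prob k | k <- q] (fun l => f (c ++ l)))%:E.
Proof.
move=> f0; elim: q r s c => [|k q IH] r s c.
  rewrite cats0 => urs rsM; have [mE PE] := bits_event_law urs rsM.
  rewrite /= integral_cst // mulrC EFinM; congr (_ * _)%E; exact: PE.
move=> urs rsM.
have p1 : perm_eq (((k :: r) ++ s) ++ q) ((r ++ s) ++ k :: q).
  by rewrite perm_sym; exact: permEl (perm_catCA (r ++ s) [:: k] q).
have p2 : perm_eq ((r ++ k :: s) ++ q) (((k :: r) ++ s) ++ q).
  by rewrite -!catA; exact: permEl (perm_catCA r [:: k] (s ++ q)).
have u1 : uniq (((k :: r) ++ s) ++ q) by rewrite (perm_uniq p1).
have u2 : uniq ((r ++ k :: s) ++ q) by rewrite (perm_uniq p2).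
have M1 : {in ((k :: r) ++ s) ++ q, forall l, (l < M)%N}.
  by move=> l; rewrite (perm_mem p1); exact: rsM.
have M2 : {in (r ++ k :: s) ++ q, forall l, (l < M)%N}.
  by move=> l; rewrite (perm_mem p2); exact: M1.
have qM : {in k :: q, forall l, (l < M)%N}.
  by move=> l lq; apply: rsM; rewrite mem_cat lq orbT.
have sub (a b : seq nat) : uniq ((a ++ b) ++ q) -> {in (a ++ b) ++ q, forall l, (l < M)%N} ->
    measurable [set w | {in a, forall k, ~~ bit k w} /\ {in b, forall k, bit k w}].
  rewrite cat_uniq => /andP[uab _] abM; apply: (proj1 (bits_event_law uab _)).
  by move=> l lab; apply: abM; rewrite mem_cat lab.
rewrite (_ : [set w | _ /\ _] =
  [set w | {in k :: r, forall k, ~~ bit k w} /\ {in s, forall k, bit k w}] `|`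
  [set w | {in r, forall k, ~~ bit k w} /\ {in k :: s, forall k, bit k w}]); last first.
  apply/seteqP; split => [w [h1 h2]|w [[h1 h2]|[h1 h2]]].
  - case E : (bit k w); [right|left]; split => // l;
      rewrite inE => /orP[/eqP ->|]; rewrite ?E //; [exact: h2|exact: h1].
  - by split => // l lr; apply: h1; rewrite inE lr orbT.
  - by split => // l ls; apply: h2; rewrite inE ls orbT.
rewrite ge0_integral_setU //=; first last.
- apply/disj_set2P/seteqP; split => // w [[h1 _] [_ h2]].
  by have := h1 k (mem_head _ _); rewrite h2 ?mem_head.
- by move=> w _; rewrite lee_fin.
- apply/measurable_EFinP; apply: measurable_funTS.
  exact: (@measurable_bits f (k :: q) c qM).
- exact: sub.
- exact: sub.
have IHt := IH r (k :: s) (rcons c true) u2 M2.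
have IHf := IH (k :: r) s (rcons c false) u1 M1.
rewrite (eq_integral (fun w => (f (rcons c false ++ [seq bit k w | k <- q]))%:E));
  last first.
  by move=> w /set_mem[/(_ k (mem_head _ _)) /negbTE -> _]; rewrite cat_rcons.
rewrite IHf.
rewrite (eq_integral (fun w => (f (rcons c true ++ [seq bit k w | k <- q]))%:E));
  last first.
  by move=> w /set_mem[_ /(_ k (mem_head _ _)) ->]; rewrite cat_rcons.
rewrite IHt -EFinD; congr EFin; rewrite !big_cons /comp /=.
under eq_expect do rewrite cat_rcons.
under [X in _ + _ * X]eq_expect do rewrite cat_rcons.
ring.
Qed.

Lemma bits_law (f : seq bool -> R) : (forall l, 0 <= f l) ->
  (\int[P]_w (f (mkseq (bit^~ w) M))%:E)%E = (expect (mkseq bit_prob M) f)%:E.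
Proof.
move=> f0; have := @bits_law_cond f (iota 0 M) [::] [::] [::] f0.
rewrite /= iota_uniq => /(_ isT) H.
rewrite -[RHS]/((expect (map bit_prob (iota 0 M)) f)%:E).
rewrite !big_nil !mul1r in H; rewrite -H; last by move=> l; rewrite mem_iota.
congr integral; apply/seteqP; split => w // _; split.
Qed.

End bits.
End point_process.

Section box_law.
Variable R : realType.
Local Notation leb := (@lebesgue_measure R).

Lemma mkseq_box_probs n k (u p : R) (pf : nat -> R) :
  (forall i, pf (i * n.+1)%N = u) ->
  (forall i j, (j < n)%N -> pf (i * n.+1 + j.+1)%N = p) ->
  mkseq pf (k * n.+1) = box_probs n k u p.
Proof.
elim: k pf => [//|k IH] pf Hu Hp.
have tl : map pf (iota n.+1 (k * n.+1)) = box_probs n k u p.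
  rewrite -(IH (pf \o addn n.+1)) => [|i|i j jn] /=.
  - by rewrite /mkseq -[X in iota X](addn0 n.+1) iotaDl -map_comp.
  - by rewrite -mulSn Hu.
  - by rewrite addnA -mulSn Hp.
rewrite /mkseq mulSn iotaD map_cat add0n tl.
rewrite [RHS](_ : _ = (u :: nseq n p) ++ box_probs n k u p) //.
congr (_ ++ _); rewrite /= -(Hu 0%N) mul0n; congr (_ :: _).
apply: (@eq_from_nth _ 0); rewrite size_map size_iota ?size_nseq // => j jn.
rewrite (nth_map 0%N) ?size_iota // nth_iota // nth_nseq jn.
by rewrite -(Hp 0%N j jn) mul0n.
Qed.

Lemma iocE (a b : R) : ioc a b = `]a, b]%classic.
Proof. by apply/seteqP; split => y /=; rewrite in_itv. Qed.

Lemma measurable_ioc (a b : R) : measurable (ioc a b).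
Proof. by rewrite iocE. Qed.

Lemma leb_ioc (a b : R) : a <= b -> leb (ioc a b) = (b - a)%:E.
Proof.
move=> ab; rewrite iocE lebesgue_measure_itv /= lte_fin.
case: ltP => [|ba]; first by rewrite EFinB.
by rewrite (_ : b - a = 0) //; apply/eqP; rewrite subr_eq0 eq_le ab ba.
Qed.

Definition cell (a b c e : R) : set (R * R) :=
  [set u | a < u.1 <= b /\ c < u.2 <= e].

Lemma cellE a b c e : cell a b c e = ioc a b `*` ioc c e.
Proof. by []. Qed.

Lemma measurable_cell a b c e : measurable (cell a b c e).
Proof. by rewrite cellE; apply: measurableX; exact: measurable_ioc. Qed.

Lemma leb2_cell a b c e : a <= b -> c <= e ->
  leb2 (cell a b c e) = ((b - a) * (e - c))%:E.
Proof.
move=> ab ce; rewrite /leb2 cellE product_measure1E //; try exact: measurable_ioc.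
by rewrite EFinM; congr (_ * _)%E; exact: leb_ioc.
Qed.

Lemma boundedX_cell a b c e : a <= b -> 0 <= c <= e -> boundedX (cell a b c e).
Proof.
move=> ab /andP[c0 ce]; split; first exact: measurable_cell.
  by move=> u [_ /andP[cu _]]; exact: le_lt_trans cu.
by rewrite leb2_cell // ltry.
Qed.

Lemma boundedY_ioc a b : a <= b -> boundedY (ioc a b : set R).
Proof. by move=> ab; split; [exact: measurable_ioc|rewrite leb_ioc // ltry]. Qed.

Context d (T : measurableType d) (P : probability T R).
Variables (pts : T -> set (R * R)) (nu : T -> set R) (lam : R).
Hypothesis model : hammersley_model P pts nu lam.
Variables (x a t : R) (N : nat).
Hypotheses (a0 : 0 <= a) (t0 : 0 <= t).

Let xs := gridx x a N.
Let ts := gridt t N.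

Definition bulk_index m : set (R * R) :=
  if (m %% N.+1)%N is j.+1 then
    cell (xs (m %/ N.+1)) (xs (m %/ N.+1).+1) (ts j) (ts j.+1)
  else set0.

Definition source_index m : set R :=
  if (m %% N.+1)%N is j.+1 then set0
  else ioc (xs (m %/ N.+1)) (xs (m %/ N.+1).+1).

Lemma bit_config m w :
  bit pts nu bulk_index source_index m w = config_bit (pts w) (nu w) xs ts N m.
Proof.
rewrite /bit /config_bit /bulk_index /source_index.
case: (m %% N.+1)%N => [|j]; apply/asboolP/asboolP.
- by move=> [[u [_ []]]|[y [Yy yi]]]; exists y.
- by move=> [y [Yy yi]]; right; exists y.
- by move=> [[u [Xu [u1 u2]]]|[y [_ []]]]; exists u.
- by move=> [u [Xu u1 u2]]; left; exists u.
Qed.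

Lemma box_bitsE w : box_bits (pts w) (nu w) x a t N =
  mkseq (bit pts nu bulk_index source_index ^~ w) (N * N.+1).
Proof. by apply: eq_mkseq => m; rewrite bit_config. Qed.

Let xsS i : xs i <= xs i.+1. Proof. exact: gridx_homo. Qed.
Let tsS i : ts i <= ts i.+1. Proof. exact: gridt_homo. Qed.
Let ts_ge0 i : 0 <= ts i.
Proof. by rewrite /ts /gridt mulr_ge0 // divr_ge0. Qed.

Lemma boundedX_index m : boundedX (bulk_index m).
Proof.
rewrite /bulk_index; case: (m %% N.+1)%N => [|j]; first exact: boundedX0.
by apply: boundedX_cell; rewrite ?ts_ge0 //=.
Qed.

Lemma boundedY_index m : boundedY (source_index m).
Proof.
rewrite /source_index; case: (m %% N.+1)%N => [|j]; last exact: boundedY0.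
exact: boundedY_ioc.
Qed.

Lemma monotone_ioc_disjoint (G : nat -> R) i j y :
  {homo G : i j / (i <= j)%N >-> i <= j} ->
  G i < y <= G i.+1 -> G j < y <= G j.+1 -> i = j.
Proof.
move=> Gm /andP[h1 h2] /andP[h3 h4].
apply/eqP; rewrite eqn_leq; apply/andP; split; rewrite leqNgt; apply/negP => lt.
  by have := lt_le_trans (lt_le_trans h1 h4) (Gm _ _ lt); rewrite ltxx.
by have := lt_le_trans (lt_le_trans h3 h2) (Gm _ _ lt); rewrite ltxx.
Qed.

Lemma bulk_index_disjoint k l : k != l -> bulk_index k `&` bulk_index l = set0.
Proof.
move=> kl; apply/seteqP; split => // u [].
rewrite /bulk_index; case E1 : (k %% N.+1)%N => [//|i]; case E2 : (l %% N.+1)%N => [//|j].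
move=> [u1 u2] [v1 v2]; move/eqP: kl; apply.
rewrite (divn_eq k N.+1) (divn_eq l N.+1) E1 E2.
rewrite (monotone_ioc_disjoint (gridx_homo x N a0) u1 v1).
by rewrite (monotone_ioc_disjoint (gridt_homo N t0) u2 v2).
Qed.

Lemma source_index_disjoint k l : k != l -> source_index k `&` source_index l = set0.
Proof.
move=> kl; apply/seteqP; split => // y [].
rewrite /source_index; case E1 : (k %% N.+1)%N => [|//]; case E2 : (l %% N.+1)%N => [|//].
move=> y1 y2; move/eqP: kl; apply.
rewrite (divn_eq k N.+1) (divn_eq l N.+1) E1 E2.
by rewrite (monotone_ioc_disjoint (gridx_homo x N a0) y1 y2).
Qed.

Definition source_prob : R := 1 - expR (- (lam * (a / N%:R))).
Definition cell_prob : R := 1 - expR (- (a / N%:R * (t / N%:R))).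

Lemma bit_prob_index :
  mkseq (bit_prob lam bulk_index source_index) (N * N.+1) =
  box_probs N N source_prob cell_prob.
Proof.
apply: mkseq_box_probs => [i|i j jN]; rewrite /bit_prob /mass /bulk_index /source_index.
  rewrite modnMl mulnK // leb_ioc // (_ : leb2 set0 = 0%E); last first.
    by rewrite /leb2 measure0.
  by rewrite /= add0r /xs gridxS addrAC subrr add0r.
rewrite modnMDl modn_small ?ltnS // divnMDl // divn_small ?ltnS // addn0.
rewrite leb2_cell // measure0 /= mulr0 addr0 /xs /ts gridxS gridtS.
have cancel (y e : R) : y + e - y = e by rewrite addrAC subrr add0r.
by rewrite !cancel.
Qed.

Lemma box_law (f : seq bool -> R) : (forall l, 0 <= f l) ->
  (\int[P]_w (f (box_bits (pts w) (nu w) x a t N))%:E)%E =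
  (expect (box_probs N N source_prob cell_prob) f)%:E.
Proof.
move=> f0; rewrite -bit_prob_index.
under eq_integral do rewrite box_bitsE.
apply: (bits_law model) => // [k _|k _|k l _ _|k l _ _].
- exact: boundedX_index.
- exact: boundedY_index.
- exact: bulk_index_disjoint.
- exact: source_index_disjoint.
Qed.

Lemma measurable_box (f : seq bool -> R) :
  measurable_fun setT (fun w => f (box_bits (pts w) (nu w) x a t N)).
Proof.
under eq_fun do rewrite box_bitsE.
apply: (@measurable_bits _ _ _ P pts nu lam model bulk_index source_index
  (N * N.+1) _ _ f (iota 0 (N * N.+1)) [::]) => [k _|k _|k].
- exact: boundedX_index.
- exact: boundedY_index.
- by rewrite mem_iota.
Qed.

End box_law.

(** * Asymptotics of the grid parameters *)

Section box_parameters.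
Variable R : realType.
Implicit Types (lam a t y z : R) (N : nat).

Lemma expRN_ge y : 1 - y <= expR (- y).
Proof. exact: expR_ge1Dx. Qed.

Lemma expRN_le_inv y : 0 <= y -> expR (- y) <= (1 + y)^-1.
Proof.
move=> y0; rewrite expRN lef_pV2 ?posrE ?expR_gt0 ?expR_ge1Dx //.
by rewrite ltr_pwDl.
Qed.

Lemma onemexpRN_ge y : 0 <= y -> y * (1 - y) <= 1 - expR (- y).
Proof.
move=> y0; have := expRN_le_inv y0.
suff : y * (1 - y) <= 1 - (1 + y)^-1 by lra.
have y1 : 0 < 1 + y by rewrite ltr_pwDl.
have -> : 1 - (1 + y)^-1 = y / (1 + y) by field; rewrite gt_eqF.
by rewrite ler_pdivlMr //; nra.
Qed.

Lemma exprn1D_le y N : 0 <= y -> (1 + y) ^+ N <= expR (y *+ N).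
Proof.
by move=> y0; rewrite -mulr_natl expRM_natl lerXn2r ?nnegrE ?expR_ge0 ?addr_ge0 ?expR_ge1Dx.
Qed.

(** The solution v of p (1-u) (1-v) = u v: its odds v/(1-v) are p (1-u)/u, which is [q] because u =
    1 - exp(-lam a/N). *)
Definition sink_prob lam a t N : R :=
  let q := cell_prob a t N / (expR (lam * (a / N%:R)) - 1) in q / (1 + q).

Variables (a t : R) (N : nat).
Hypotheses (a0 : 0 < a) (t0 : 0 <= t) (N0 : (0 < N)%N).

Let N_gt0 : 0 < N%:R :> R. Proof. by rewrite ltr0n. Qed.
Let e_gt0 : 0 < a / N%:R. Proof. exact: divr_gt0. Qed.
Let d_ge0 : 0 <= t / N%:R. Proof. by rewrite divr_ge0. Qed.

Lemma cell_prob01 : 0 <= cell_prob a t N <= 1.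
Proof.
rewrite /cell_prob; apply/andP; split; last by rewrite gerBl expR_ge0.
by rewrite subr_ge0 expR_le1 oppr_le0 mulr_ge0 // ltW.
Qed.

Lemma cell_prob_le : cell_prob a t N <= a / N%:R * (t / N%:R).
Proof. by rewrite /cell_prob; have := expRN_ge (a / N%:R * (t / N%:R)); lra. Qed.

Section rate.
Variable lam : R.
Hypothesis lam0 : 0 < lam.

Let z := lam * (a / N%:R).
Let z_gt0 : 0 < z. Proof. exact: mulr_gt0. Qed.
Let q := cell_prob a t N / (expR z - 1).
Let ez1 : z <= expR z - 1.
Proof. by have := expR_ge1Dx z; lra. Qed.
Let ez_gt0 : 0 < expR z - 1. Proof. exact: lt_le_trans ez1. Qed.
Let q_ge0 : 0 <= q.
Proof. by rewrite /q divr_ge0 ?(ltW ez_gt0) //; have /andP[] := cell_prob01. Qed.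

Lemma source_prob01 : 0 <= source_prob lam a N <= 1.
Proof.
rewrite /source_prob; apply/andP; split; last by rewrite gerBl expR_ge0.
by rewrite subr_ge0 expR_le1 oppr_le0 ltW.
Qed.

Lemma sink_prob_le_q : 0 <= sink_prob lam a t N <= q.
Proof.
rewrite /sink_prob -/z -/q /= divr_ge0 ?addr_ge0 //=.
by rewrite ler_pdivrMr ?ltr_pwDl // mulrDr mulr1 lerDl mulr_ge0.
Qed.

Lemma sink_prob01 : 0 <= sink_prob lam a t N <= 1.
Proof.
have /andP[-> _] /= := sink_prob_le_q.
by rewrite /sink_prob -/z -/q /= ler_pdivrMr ?ltr_pwDl // mul1r lerDr.
Qed.

Lemma stationarity : cell_prob a t N * (1 - source_prob lam a N) *
  (1 - sink_prob lam a t N) = source_prob lam a N * sink_prob lam a t N.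
Proof.
have q1 : 1 + q != 0 by rewrite gt_eqF // ltr_pwDl.
have E0 : expR z != 0 by rewrite gt_eqF ?expR_gt0.
have E1 : expR z - 1 != 0 by rewrite gt_eqF.
have pE : cell_prob a t N = q * (expR z - 1) by rewrite /q divfK.
rewrite /sink_prob -/z -/q /source_prob -/z expRN pE.
clearbody q; field; by rewrite E0 q1.
Qed.

Lemma q_le : q <= t / lam / N%:R.
Proof.
rewrite /q ler_pdivrMr //; apply: le_trans cell_prob_le _.
apply: (@le_trans _ _ (t / lam / N%:R * z)).
  by rewrite /z le_eqVlt; apply/orP; left; apply/eqP; field; rewrite !gt_eqF.
by rewrite ler_wpM2l // !divr_ge0 // ltW.
Qed.

Lemma sink_prob_le : sink_prob lam a t N <= t / lam / N%:R.
Proof. by apply: le_trans q_le; have /andP[] := sink_prob_le_q. Qed.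

Lemma source_prob_le : source_prob lam a N <= lam * a / N%:R.
Proof.
rewrite /source_prob -mulrA; have := expRN_ge (lam * (a / N%:R)); lra.
Qed.

(** Unlike the bound for the sources below, this one is free of [a] as well as of [N]. *)
Lemma sink_power_le c : 0 <= c ->
  (1 + c * sink_prob lam a t N) ^+ N <= expR (c * (t / lam)).
Proof.
move=> c0; have /andP[v0 _] := sink_prob01.
apply: le_trans (exprn1D_le _ (mulr_ge0 c0 v0)) _; rewrite ler_expR.
rewrite -mulr_natr -mulrA ler_wpM2l // -ler_pdivlMr //; exact: sink_prob_le.
Qed.

Lemma source_power_le c : 0 <= c ->
  (1 + c * source_prob lam a N) ^+ N <= expR (c * (lam * a)).
Proof.
move=> c0; have /andP[v0 _] := source_prob01.
apply: le_trans (exprn1D_le _ (mulr_ge0 c0 v0)) _; rewrite ler_expR.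
rewrite -mulr_natr -mulrA ler_wpM2l // -ler_pdivlMr //; exact: source_prob_le.
Qed.

(** The hypothesis makes z = lam a/N at most 1/2, hence the source probability at least z/2; this is
    the origin of the 4 in the exponent. *)
Lemma source_half_power_le : 2 * (lam * a) <= N%:R ->
  (1 - source_prob lam a N / 2) ^+ N <= expR (- (lam * a / 4)).
Proof.
move=> aN; have z2 : z <= 1/2.
  by rewrite /z mulrA ler_pdivrMr //; lra.
have uz : z / 2 <= source_prob lam a N.
  by apply: le_trans (onemexpRN_ge (ltW z_gt0)); rewrite ler_wpM2l ?(ltW z_gt0) //; lra.
have /andP[u0 u1] := source_prob01.
apply: (@le_trans _ _ (expR (- (z / 4)) ^+ N)).
  have u2 : 0 <= 1 - source_prob lam a N / 2 by lra.
  rewrite lerXn2r ?nnegrE ?expR_ge0 //.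
  by apply: le_trans (expRN_ge _); lra.
rewrite -expRM_natl ler_expR mulrN lerN2 /z le_eqVlt; apply/orP; left.
by apply/eqP; field; rewrite gt_eqF.
Qed.

(** Linearising the exponential of z, the cell probability and the passage from odds to probability
    costs the relative errors z, y and b, each at most a constant over N. *)
Lemma sink_mean_ge : lam * a + a * t + t / lam <= N%:R ->
  t / lam - t / lam * (lam * a + a * t + t / lam) / N%:R <=
  N%:R * sink_prob lam a t N.
Proof.
move=> CN; set m := t / lam; have m0 : 0 <= m by rewrite divr_ge0 // ltW.
set y := a / N%:R * (t / N%:R); have y0 : 0 <= y by rewrite mulr_ge0 // ltW.
set b := m / N%:R; have b0 : 0 <= b by rewrite divr_ge0.
have N1 : 1 <= N%:R :> R by rewrite ler1n.
have yle : y <= a * t / N%:R.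
  rewrite /y mulf_div ler_wpM2l ?mulr_ge0 ?(ltW a0) // lef_pV2 ?posrE ?mulr_gt0 //.
  by rewrite ler_peMr // ltW.
have zE : z = lam * a / N%:R by rewrite /z mulrA.
have zyb : z + y + b <= 1.
  have : z + a * t / N%:R + b <= 1.
    by rewrite zE /b -!mulrDl ler_pdivrMr // mul1r.
  by lra.
have ez : expR z - 1 <= z * expR z.
  have := expRN_ge z; rewrite expRN => h.
  have Ez := expR_gt0 z.
  have : (1 - z) * expR z <= 1 by rewrite -ler_pdivlMr // div1r.
  by lra.
have qge : b * (1 - z) * (1 - y) <= q.
  rewrite /q ler_pdivlMr //.
  apply: le_trans (onemexpRN_ge y0).
  have yE : y = b * z by rewrite /y /b /z /m; field; rewrite !gt_eqF.
  have h : (1 - z) * (expR z - 1) <= z.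
    have := expRN_ge z; rewrite expRN => h.
    have Ez := expR_gt0 z.
    have : (1 - z) * expR z <= 1 by rewrite -ler_pdivlMr // div1r.
    by nra.
  have y1 : 0 <= 1 - y by have := z_gt0; lra.
  rewrite [leRHS](_ : _ = b * ((1 - y) * z)); last by rewrite {1}yE; ring.
  rewrite [leLHS](_ : _ = b * ((1 - y) * ((1 - z) * (expR z - 1)))); last by ring.
  by rewrite !ler_wpM2l.
have qb : q <= b by exact: q_le.
have vge : q * (1 - b) <= sink_prob lam a t N.
  rewrite /sink_prob -/z -/q /= ler_pdivlMr ?ltr_pwDl //.
  have : q * ((1 - b) * (1 + q)) <= q * 1.
    have bq : 0 <= b * q by rewrite mulr_ge0.
    by rewrite ler_wpM2l // mulrBl !mulrDr; lra.
  by rewrite mulr1 mulrA.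
have vge2 : b * (1 - (z + y + b)) <= sink_prob lam a t N.
  apply: le_trans vge; apply: (@le_trans _ _ (b * (1 - z) * (1 - y) * (1 - b))).
    rewrite -(mulrA b (1 - z)) -(mulrA b) ler_wpM2l //.
    have z0 := ltW z_gt0; have z1 : z <= 1 by lra.
    have zy0 : 0 <= z * y by rewrite mulr_ge0.
    have h1 : 1 - (z + y) <= (1 - z) * (1 - y) by rewrite mulrBl !mulrBr; lra.
    have h2 : (1 - (z + y)) * (1 - b) <= (1 - z) * (1 - y) * (1 - b).
      by rewrite ler_wpM2r //; lra.
    have h3 : 0 <= (z + y) * b by rewrite mulr_ge0 // addr_ge0.
    have h4 : 1 - (z + y + b) <= (1 - (z + y)) * (1 - b).
      by rewrite mulrBr mulr1 mulrBl mul1r; lra.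
    exact: le_trans h4 h2.
  by rewrite ler_wpM2r //; have := z_gt0; lra.
have := ler_wpM2l (ltW N_gt0) vge2; apply: le_trans.
rewrite [leRHS](_ : _ = m * (1 - (z + y + b))); last first.
  by rewrite /b; field; rewrite gt_eqF.
have : m * (z + y + b) <= m * (lam * a + a * t + m) / N%:R.
  rewrite -mulrA ler_wpM2l // !mulrDl zE; rewrite -/b.
  by have := yle; lra.
by rewrite mulrBr mulr1; lra.
Qed.
End rate.
End box_parameters.

Section flux_asymptotics.
Variable R : realType.
Variables (lam t : R).
Hypotheses (lam0 : 0 < lam) (t0 : 0 <= t).

(** The threshold [A0] depends on neither [N] nor [phi], so N may tend to infinity at fixed [a], and
    one threshold serves both moments. *)
Lemma box_flux_defect (e : R) : 0 < e -> exists A0 : R, forall (a : R) N (phi : nat -> R),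
  0 < a -> A0 <= a -> (0 < N)%N -> 2 * (lam * a) <= N%:R ->
  {homo phi : i j / (i <= j)%N >-> i <= j} -> 0 <= phi 0%N ->
  (forall i, phi i <= i%:R ^+ 2) ->
  expect (box_probs N N (source_prob lam a N) (cell_prob a t N))
      (fun c => phi (flux N N c)) <=
  expect (nseq N (sink_prob lam a t N)) (fun s => phi (count id s)) <=
  expect (box_probs N N (source_prob lam a N) (cell_prob a t N))
      (fun c => phi (flux N N c)) + e.
Proof.
move=> e0.
(* The bulk height is at most the total height of the stationary model of rate
   [mu], which over a wide window is far below the number of sources. *)
pose mu := lam / 24; have mu0 : 0 < mu by rewrite /mu divr_gt0.
(* The term [eta] (1 + 15 v)^N is at most [eta] exp(15 t/lam), so it takes at most half of [e]. *)
pose eta := e / 2 / expR (15 * (t / lam)).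
have eta0 : 0 < eta by rewrite !divr_gt0 // expR_gt0.
pose K := expR (3 * (t / mu)).
pose D := (4 * eta)^-1 * (expR (t / lam) * (1 + K)).
have K0 : 0 < K by exact: expR_gt0.
have D0 : 0 < D.
  apply: mulr_gt0; first by rewrite invr_gt0 mulr_gt0.
  by rewrite mulr_gt0 ?expR_gt0 // addr_gt0.
(* The remaining error is at most D exp(-y) <= D/y with y = lam a/8, and this is at most e/2 from
   the chosen threshold on. *)
exists (16 * D / (lam * e)) => a N phi a0 Aa N0 aN phim phi0 phi2.
have /andP[h1 h2] := expect_flux N N (source_prob01 a0 N0 lam0)
  (sink_prob01 a0 t0 N0 lam0) (source_prob01 a0 N0 mu0) (sink_prob01 a0 t0 N0 mu0)
  (cell_prob01 a0 t0 N0) (stationarity a0 t0 N0 lam0)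
  (stationarity a0 t0 N0 mu0) eta0 phim phi0 phi2.
rewrite h1 /=; apply: le_trans h2 _; rewrite -addrA lerD2l.
have E1 : eta * (1 + 15 * sink_prob lam a t N) ^+ N <= e / 2.
  rewrite /eta mulrAC ler_pdivrMr ?expR_gt0 // ler_wpM2l ?divr_ge0 ?(ltW e0) //.
  exact: sink_power_le.
suff E2 : (4 * eta)^-1 * ((1 + sink_prob lam a t N) ^+ N *
    ((1 - source_prob lam a N / 2) ^+ N * (2^-1 *
    ((1 + 3 * source_prob mu a N) ^+ N + (1 + 3 * sink_prob mu a t N) ^+ N))))
    <= e / 2.
  by move: E1 E2; set X := eta * _; set Y := _ * (_ * _); lra.
have /andP[u0 u1] := source_prob01 a0 N0 lam0.
have /andP[v0 v1] := sink_prob01 a0 t0 N0 lam0.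
have /andP[u0' u1'] := source_prob01 a0 N0 mu0.
have /andP[v0' v1'] := sink_prob01 a0 t0 N0 mu0.
have la0 : 0 < lam * a by exact: mulr_gt0.
apply: (@le_trans _ _ (D * expR (- (lam * a / 8)))).
  rewrite /D -(mulrA (4 * eta)^-1) -(mulrA (expR (t / lam))); apply: ler_wpM2l.
    by rewrite invr_ge0 mulr_ge0 // ltW.
  apply: ler_pM.
  - by apply: exprn_ge0; rewrite addr_ge0.
  - apply: mulr_ge0; first by apply: exprn_ge0; lra.
    by rewrite mulr_ge0 ?invr_ge0 // addr_ge0 // exprn_ge0 // addr_ge0 // mulr_ge0.
  - by have := sink_power_le a0 t0 N0 lam0 ler01; rewrite !mul1r.
  (* With [mu] = [lam]/24 the bulk height costs exp(3 mu a) = exp(lam a/8), which the factor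
     exp(-lam a/4) from the sources outweighs. *)
  apply: (@le_trans _ _ (expR (- (lam * a / 4)) *
    (2^-1 * (expR (lam * a / 8) + K)))).
    apply: ler_pM.
    - by apply: exprn_ge0; lra.
    - by rewrite mulr_ge0 ?invr_ge0 // addr_ge0 // exprn_ge0 // addr_ge0 // mulr_ge0.
    - exact: source_half_power_le.
    rewrite ler_wpM2l ?invr_ge0 //; apply: lerD; last exact: sink_power_le.
    apply: le_trans (source_power_le a0 N0 mu0 _) _ => //.
    rewrite ler_expR /mu le_eqVlt; apply/orP; left; apply/eqP; by field.
  set E := expR (lam * a / 8); set F := expR (- (lam * a / 8)).
  have EF : F * E = 1 by rewrite /F /E -expRD addNr expR0.
  have F1 : F <= 1 by rewrite expR_le1 oppr_le0 divr_ge0 // ltW.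
  have F0 : 0 < F by exact: expR_gt0.
  rewrite (_ : expR (- (lam * a / 4)) = F * F); last first.
    by rewrite /F -expRD; congr expR; field.
  rewrite [leLHS](_ : _ = F * ((F * E + F * K) / 2)); last by field.
  rewrite EF [leRHS]mulrC ler_wpM2l ?(ltW F0) //.
  have : F * K <= 1 * K by rewrite ler_wpM2r // ltW.
  by have := ltW K0; lra.
have y0 : 0 < lam * a / 8 by rewrite divr_gt0.
apply: (@le_trans _ _ (D * (lam * a / 8)^-1)).
  rewrite ler_wpM2l ?(ltW D0) //; apply: le_trans (expRN_le_inv (ltW y0)) _.
  by rewrite lef_pV2 ?posrE ?addr_gt0 // lerDr.
rewrite ler_pdivrMr // -ler_pdivrMl ?divr_gt0 //.
apply: (@le_trans _ _ (lam * (16 * D / (lam * e)) / 8)).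
  by rewrite le_eqVlt; apply/orP; left; apply/eqP; field; rewrite !gt_eqF.
by rewrite ler_pM2r // ler_pM2l.
Qed.

Lemma cvg_sink_prob (a : R) : 0 < a -> N%:R * sink_prob lam a t N @[N --> \oo] --> t / lam.
Proof.
move=> a0; have m0 : 0 <= t / lam by rewrite divr_ge0 // ltW.
apply/cvgrPdist_le => e e0; near=> N.
have N0 : (0 < N)%N by near: N; exact: nbhs_infty_gt.
have NR : 0 < N%:R :> R by rewrite ltr0n.
have lo : t / lam - t / lam * (lam * a + a * t + t / lam) / N%:R <=
    N%:R * sink_prob lam a t N.
  by apply: sink_mean_ge => //; near: N; exact: nbhs_infty_ger.
have up : N%:R * sink_prob lam a t N <= t / lam.
  by rewrite mulrC -ler_pdivlMr //; exact: sink_prob_le.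
have sm : t / lam * (lam * a + a * t + t / lam) / N%:R < e.
  by near: N; exact: near_mesh_lt.
by rewrite ger0_norm ?subr_ge0 //; lra.
Unshelve. all: by end_near. Qed.

Lemma cvg_sink_prob2 (a : R) : 0 < a ->
  N%:R * sink_prob lam a t N * (1 - sink_prob lam a t N) +
    (N%:R * sink_prob lam a t N) ^+ 2 @[N --> \oo] --> t / lam + (t / lam) ^+ 2.
Proof.
move=> a0; have c1 := cvg_sink_prob a0.
suff c0 : sink_prob lam a t N @[N --> \oo] --> (0 : R).
  rewrite (_ : t / lam + _ = t / lam * (1 - 0) + t / lam * (t / lam)); last by ring.
  apply: cvgD; last exact: (cvgM c1 c1).
  by apply: (cvgM c1); apply: cvgB => //; exact: cvg_cst.
apply/cvgrPdist_le => e e0; near=> N.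
have N0 : (0 < N)%N by near: N; exact: nbhs_infty_gt.
rewrite sub0r normrN ger0_norm; last by have /andP[] := sink_prob01 a0 t0 N0 lam0.
apply: le_trans (sink_prob_le a0 t0 N0 lam0) _; apply: ltW.
by near: N; exact: near_mesh_lt.
Unshelve. all: by end_near. Qed.

End flux_asymptotics.

(** * The covariance identity on the grid *)

Section covariance_identity.
Variable R : realType.
Variables (x a : R) (N : nat) (u p : R).
Hypotheses (a0 : 0 < a) (N0 : (0 < N)%N).
Let ps := box_probs N N u p.

Lemma nth_box_probs i : (i < N)%N -> nth 0 ps (i * N.+1) = u.
Proof.
move=> iN; rewrite /ps.
rewrite -(@mkseq_box_probs R N N u p (fun m => if (m %% N.+1)%N is _.+1 then p else u)).
- by rewrite nth_mkseq ?ltn_mul2r // modnMl.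
- by move=> j; rewrite modnMl.
- by move=> j k kN; rewrite modnMDl modn_small.
Qed.

Lemma expect_source i : (i < N)%N ->
  expect ps (fun c => (nth false c (i * N.+1))%:R) = u.
Proof.
move=> iN; have := @expect_flip R ps (i * N.+1) (fun=> 1).
rewrite size_box_probs ltn_mul2r iN nth_box_probs // => /(_ isT).
rewrite expect_cst mulr1 (@eq_expect _ ps (fun c => _ * (1 - 1)) (fun=> 0)); last first.
  by move=> c _; rewrite subrr mulr0.
rewrite expect_cst mulr0 addr0 => <-.
by apply: eq_expect => c _; rewrite mulr1.
Qed.

(** [expect_flip] is applied at the source bit of each column starting at or right of 0 and summed;
    the factor N/a undoes the mesh width inside [gain]. *)
Lemma expect_right_sources_flux :
  expect ps (fun c => (right_sources x a N c)%:R * (flux N N c)%:R) +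
    u * (N%:R / a) * expect ps (gain x a N) =
  expect ps (fun c => (right_sources x a N c)%:R) *
    expect ps (fun c => (flux N N c)%:R).
Proof.
pose I (i : 'I_N) : R := (0 <= gridx x a N i)%R%:R.
have rE c : (right_sources x a N c)%:R =
    \sum_(i < N) I i * (nth false c (i * N.+1))%:R :> R.
  rewrite /right_sources natr_sum; apply: eq_bigr => i _.
  by rewrite /I; case: (0 <= _); rewrite ?mul1r ?mul0r.
have e1 : expect ps (fun c => (right_sources x a N c)%:R) = \sum_(i < N) I i * u.
  rewrite (eq_expect (fun c _ => rE c)) expect_sum; apply: eq_bigr => i _.
  by rewrite expectZ expect_source.
pose f c : R := (flux N N c)%:R.
pose g (i : 'I_N) c : R := (~~ nth false c (i * N.+1))%:R *
  (f c - f (set_nth false c (i * N.+1) true)).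
have e2 : expect ps (fun c => (right_sources x a N c)%:R * f c) =
    \sum_(i < N) I i * (u * expect ps f - u * expect ps (g i)).
  rewrite (@eq_expect _ ps _ (fun c => \sum_(i < N) I i *
    ((nth false c (i * N.+1))%:R * f c))); last first.
    by move=> c _; rewrite rE mulr_suml; apply: eq_bigr => i _; rewrite mulrA.
  rewrite expect_sum; apply: eq_bigr => i _; rewrite expectZ; congr (_ * _).
  rewrite expect_flip ?size_box_probs ?ltn_mul2r ?ltn_ord // nth_box_probs //.
  congr (_ + _); rewrite -mulrN; congr (_ * _); rewrite -mulN1r -expectZ.
  by apply: eq_expect => c _; rewrite /g mulN1r -mulrN opprB.
have e3 : expect ps (gain x a N) = \sum_(i < N) a / N%:R * (I i * expect ps (g i)).
  by rewrite /gain expect_sum; apply: eq_bigr => i _; rewrite !expectZ.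
rewrite e1 e2 e3 mulr_suml mulr_sumr -big_split /=; apply: eq_bigr => i _.
rewrite -/f; set X := expect ps f; set Y := expect ps (g i).
by field; rewrite pnatr_eq0 -lt0n N0 gt_eqF.
Qed.

End covariance_identity.

Section source_ratio.
Variable R : realType.

Lemma cvg_source_ratio (lam a : R) : 0 < lam -> 0 < a ->
  source_prob lam a N * (N%:R / a) @[N --> \oo] --> lam.
Proof.
move=> lam0 a0; apply/cvgrPdist_le => e e0; near=> N.
have N0 : (0 < N)%N by near: N; exact: nbhs_infty_gt.
have NR : 0 < N%:R :> R by rewrite ltr0n.
set z := lam * (a / N%:R); have z0 : 0 <= z by rewrite mulr_ge0 ?divr_ge0 // ltW.
have up : source_prob lam a N <= z.
  by rewrite /z mulrA; exact: source_prob_le.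
have lo : z * (1 - z) <= source_prob lam a N by exact: onemexpRN_ge.
have r0 : 0 <= N%:R / a by rewrite divr_ge0 // ltW.
have zr : z * (N%:R / a) = lam by rewrite /z; field; rewrite !gt_eqF.
have h1 := ler_wpM2r r0 up; have h2 := ler_wpM2r r0 lo.
rewrite zr in h1; rewrite mulrAC zr in h2.
have zs : lam * z <= e.
  apply: ltW; rewrite /z !mulrA; near: N; exact: near_mesh_lt.
by rewrite ger0_norm ?subr_ge0 //; lra.
Unshelve. all: by end_near. Qed.

End source_ratio.

(** * Passage to the limit *)

Section almost_sure.
Local Open Scope ereal_scope.
Context d (T : measurableType d) (R : realType) (P : probability T R).

Lemma probability_setC0 (G : set T) : measurable G -> (P (~` G) = 0) <-> (P G = 1).
Proof.
move=> mG; split=> [h|h]; last by rewrite probability_setC // h subee.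
by rewrite -(setCK G) probability_setC ?h ?sube0 //; exact: measurableC.
Qed.

Lemma probability_bigcap1 (G : (set T)^nat) : (forall n, measurable (G n)) ->
  (forall n, P (G n) = 1) -> measurable (\bigcap_n G n) /\ P (\bigcap_n G n) = 1.
Proof.
move=> mG PG; have mI : measurable (\bigcap_n G n) by exact: bigcapT_measurable.
split => //; apply/probability_setC0 => //; rewrite setC_bigcap.
apply/negligibleP; first by apply: bigcupT_measurable => n; exact: measurableC.
apply: negligible_bigcup => n; apply/negligibleP; first exact: measurableC.
exact/probability_setC0.
Qed.

Lemma probability_setI1 (G H : set T) : measurable G -> measurable H ->
  P G = 1 -> P H = 1 -> P (G `&` H) = 1.
Proof.
move=> mG mH /(probability_setC0 mG) PG /(probability_setC0 mH) PH.
apply/probability_setC0; first exact: measurableI.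
rewrite setCI null_set_setU //; exact: measurableC.
Qed.

(* Junk value: 0 when the expectation is infinite. *)
Definition mean (f : T -> R) : R := fine 'E_P[f].

Lemma meanE (D : set T) f : measurable D -> P D = 1 ->
  P.-integrable D (EFin \o f) -> 'E_P[f] = (mean f)%:E.
Proof.
move=> mD PD fD; rewrite /mean fineK // unlock (integral_full _ mD PD).
exact: integrable_fin_num.
Qed.

Lemma mean_cvg (D : set T) (f_ : nat -> T -> R) (f g : T -> R) :
  measurable D -> P D = 1 -> (forall n, measurable_fun D (f_ n)) ->
  (forall w, D w -> f_ ^~ w @ \oo --> f w) ->
  P.-integrable D (EFin \o g) ->
  (forall n w, D w -> (`|f_ n w| <= g w)%R) ->
  [/\ measurable_fun D f, P.-integrable D (EFin \o f) &
    mean (f_ n) @[n --> \oo] --> mean f].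
Proof.
move=> mD PD mf_ f_f ig f_g.
have [mf iF cF] := expectation_cvg mD PD mf_ f_f ig f_g.
split => //; apply: fine_cvg; rewrite -(meanE mD PD iF); exact: cF.
Qed.

Lemma eq_mean (D : set T) (f g : T -> R) : measurable D -> P D = 1 ->
  (forall w, D w -> f w = g w) -> mean f = mean g.
Proof. by move=> mD PD fg; rewrite /mean (eq_expectation_full mD PD fg). Qed.

Lemma mean_cst (D : set T) c : measurable D -> P D = 1 ->
  P.-integrable D (EFin \o (fun _ => c)) /\ mean (fun _ => c) = c.
Proof.
move=> mD PD; split; first exact: finite_measure_integrable_cst.
by rewrite /mean expectation_cst.
Qed.

Lemma mean_add (D : set T) (f g : T -> R) : measurable D -> P D = 1 ->
  P.-integrable D (EFin \o f) -> P.-integrable D (EFin \o g) ->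
  P.-integrable D (EFin \o (fun w => f w + g w)%R) /\
  mean (fun w => f w + g w)%R = (mean f + mean g)%R.
Proof.
move=> mD PD fD gD; split; first exact: (integrableD mD fD gD).
rewrite /mean unlock !(integral_full _ mD PD).
under eq_integral do rewrite EFinD.
by rewrite integralD_EFin // fineD //; exact: integrable_fin_num.
Qed.

Lemma mean_scale (D : set T) (f : T -> R) c : measurable D -> P D = 1 ->
  P.-integrable D (EFin \o f) ->
  P.-integrable D (EFin \o (fun w => c * f w)%R) /\
  mean (fun w => c * f w)%R = (c * mean f)%R.
Proof.
move=> mD PD fD; split; first exact: (integrableZl mD c fD).
rewrite /mean unlock !(integral_full _ mD PD).
under eq_integral do rewrite EFinM.
by rewrite integralZl // fineM //; exact: integrable_fin_num.
Qed.

Lemma integrable_nonneg (D : set T) (f : T -> R) c : measurable D -> P D = 1 ->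
  measurable_fun D f -> (forall w, (0 <= f w)%R) ->
  \int[P]_w (f w)%:E = c%:E -> P.-integrable D (EFin \o f) /\ mean f = c.
Proof.
move=> mD PD mf f0 fc; split; last by rewrite /mean unlock fc.
apply/integrableP; split; first exact/measurable_EFinP.
rewrite (eq_integral (EFin \o f)); last first.
  by move=> w _ /=; rewrite ger0_norm.
by rewrite -(integral_full _ mD PD) fc ltry.
Qed.

End almost_sure.

Section locally_finite_event.
Variable R : realType.
Context d (T : measurableType d) (P : probability T R).
Variables (pts : T -> set (R * R)) (nu : T -> set R) (lam x t : R).
Hypotheses (lam0 : 0 < lam) (x0 : 0 <= x) (t0 : 0 <= t).
Hypothesis model : hammersley_model P pts nu lam.

Definition good : set T :=
  [set w | forall n : nat, locally_finite (pts w) (nu w) x n%:R t].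

Lemma window_cell n : window x n%:R t = cell (x - n%:R) x 0 t.
Proof. by []. Qed.

Let bX n : boundedX (window x n%:R t).
Proof.
by rewrite window_cell; apply: boundedX_cell; rewrite ?lexx // gerBl.
Qed.

Let bY l : l <= x -> boundedY (ioc l x).
Proof. exact: boundedY_ioc. Qed.

Let ptsE n k := [set w | pcount R (pts w) (window x n%:R t) = k%:R%:E].
Let nuE l k := [set w | pcount R (nu w) (ioc l x) = k%:R%:E].

Let ptsM n := n%:R * t : R.
Let ptsM_ge0 n : 0 <= ptsM n. Proof. exact: mulr_ge0. Qed.
Let nuM l := lam * (x - l).

Let ptsE_meas n k : measurable (ptsE n k).
Proof. exact: (proj1 (points_law model k (bX n))). Qed.

Let ptsE_law n k : P (ptsE n k) = (Defs.poisson_pmf (ptsM n) k)%:E.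
Proof.
have [_ ->] := points_law model k (bX n).
rewrite window_cell leb2_cell ?gerBl //= /ptsM subr0.
by congr (EFin (Defs.poisson_pmf _ k)); ring.
Qed.

Let ptsE_npoints n k w : ptsE n k w -> npoints (pts w) x n%:R t = k.
Proof. by move=> /pcount_natP[]. Qed.

Let nuE_meas l k : l <= x -> measurable (nuE l k).
Proof. by move=> lx; exact: (proj1 (sources_law model k (bY lx))). Qed.

Let nuE_law l k : l <= x -> P (nuE l k) = (Defs.poisson_pmf (nuM l) k)%:E.
Proof.
by move=> lx; have [_ ->] := sources_law model k (bY lx); rewrite leb_ioc.
Qed.

Let nuE_ncount l k w : nuE l k w -> ncount (nu w) l x = k.
Proof. by move=> /pcount_natP[]. Qed.

Lemma good_full : measurable good /\ P good = 1%E.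
Proof.
have -> : good = \bigcap_n ((\bigcup_k ptsE n k) `&` (\bigcup_k nuE (x - n%:R) k)).
  apply/seteqP; split=> [w gw n _|w gw n].
    have [fX fY] := gw n; split.
      by exists #|` fset_set (pts w `&` window x n%:R t)| => //; apply/pcount_natP.
    by exists #|` fset_set (nu w `&` ioc (x - n%:R) x)| => //; apply/pcount_natP.
  by have [[k _ /pcount_natP[fX _]] [j _ /pcount_natP[fY _]]] := gw n I.
apply: probability_bigcap1 => n; first by
  apply: measurableI; apply: bigcup_measurable => k _; 
  [exact: ptsE_meas|apply: nuE_meas; rewrite gerBl].
apply: probability_setI1.
- by apply: bigcup_measurable => k _; exact: ptsE_meas.
- by apply: bigcup_measurable => k _; apply: nuE_meas; rewrite gerBl.
- exact: (poisson_full (ptsM_ge0 n) (ptsE_meas n) (ptsE_law n) (@ptsE_npoints n)).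
- have lx : x - n%:R <= x by rewrite gerBl.
  apply: (@poisson_full _ _ _ P (nuM (x - n%:R)) _ (fun w => ncount (nu w) (x - n%:R) x)).
  + by rewrite /nuM mulr_ge0 ?subr_ge0 // ltW.
  + by move=> k; exact: nuE_meas.
  + by move=> k; exact: nuE_law.
  + by move=> k w; exact: nuE_ncount.
Qed.

Let good_m := proj1 good_full.
Let good_P := proj2 good_full.

Definition points_in n w : R := (npoints (pts w) x n%:R t)%:R.
Definition sources_in w : R := (ncount (nu w) 0 x)%:R.

Lemma points_in_moments n : measurable_fun good (points_in n) /\
  P.-integrable good (EFin \o (fun w => points_in n w ^+ 2)).
Proof.
have sub : good `<=` \bigcup_k ptsE n k.
  move=> w gw; have [fX _] := gw n.
  by exists #|` fset_set (pts w `&` window x n%:R t)| => //; apply/pcount_natP.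
have mf (g : nat -> R) : measurable_fun good (g \o (fun w => npoints (pts w) x n%:R t)).
  apply: measurable_funS sub _; first by apply: bigcup_measurable.
  exact: (poisson_measurable (ptsE_meas n) (@ptsE_npoints n)).
split; first exact: (mf (fun k => k%:R)).
apply: (proj1 (integrable_nonneg (c := ptsM n + ptsM n ^+ 2) good_m good_P _ _ _)).
- exact: (mf (fun k => k%:R ^+ 2)).
- by move=> w; rewrite sqr_ge0.
- rewrite -(poisson_pmf_second (ptsM_ge0 n)).
  exact: (poisson_integral (ptsM_ge0 n) (ptsE_meas n) (ptsE_law n)
    (@ptsE_npoints n) (fun k => sqr_ge0 k%:R)).
Qed.

Lemma sources_in_moments : [/\ measurable_fun good sources_in,
  P.-integrable good (EFin \o sources_in),
  P.-integrable good (EFin \o (fun w => sources_in w ^+ 2)),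
  mean P sources_in = lam * x &
  mean P (fun w => sources_in w ^+ 2) = lam * x + (lam * x) ^+ 2].
Proof.
have m0 : 0 <= lam * x by rewrite mulr_ge0 // ltW.
have mE k : measurable (nuE 0 k) by exact: nuE_meas.
have lE k : P (nuE 0 k) = (Defs.poisson_pmf (lam * x) k)%:E.
  by rewrite nuE_law // /nuM subr0.
have sub : good `<=` \bigcup_k nuE 0 k.
  move=> w gw; have fY := @finite_ioc R (pts w) (nu w) x t gw 0 x (lexx x).
  by exists #|` fset_set (nu w `&` ioc 0 x)| => //; apply/pcount_natP.
have mf (g : nat -> R) : measurable_fun good (g \o (fun w => ncount (nu w) 0 x)).
  apply: measurable_funS sub _; first by apply: bigcup_measurable.
  exact: (poisson_measurable mE (@nuE_ncount 0)).
have mf1 : measurable_fun good sources_in by exact: (mf (fun k => k%:R)).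
have [i1 c1] := integrable_nonneg good_m good_P mf1 (fun w => ler0n _ _)
  (etrans (poisson_integral m0 mE lE (@nuE_ncount 0) (fun k => ler0n R k))
    (poisson_pmf_mean m0)).
have mf2 : measurable_fun good (fun w => sources_in w ^+ 2).
  exact: (mf (fun k => k%:R ^+ 2)).
have [i2 c2] := integrable_nonneg good_m good_P mf2 (fun w => sqr_ge0 _)
  (etrans (poisson_integral m0 mE lE (@nuE_ncount 0) (fun k => sqr_ge0 k%:R))
    (poisson_pmf_second m0)).
by split.
Qed.

End locally_finite_event.

(** * Limit of fine grids in a fixed window *)

Section window_limit.
Variable R : realType.
Context d (T : measurableType d) (P : probability T R).
Variables (pts : T -> set (R * R)) (nu : T -> set R) (lam x t : R).
Hypotheses (lam0 : 0 < lam) (x0 : 0 <= x) (t0 : 0 <= t).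
Hypothesis model : hammersley_model P pts nu lam.

Local Notation good := (good pts nu x t).
Local Notation nux := (sources_in nu x).

(** Outside [good] the relation [is_flux] may have no solution, and the value is then 0 by
    default. *)
Definition window_flux n w : nat :=
  xget 0%N [set m | is_flux (pts w) (nu w) (x - n%:R) x t m].

Definition window_exit n w : R :=
  Num.max (sup (exits (pts w) (nu w) (x - n%:R) x t (window_flux n w))) 0.

(** Fine grids compute the flux exactly, so the discrete fluxes are eventually constant in [N]. The
    successor [N.+1] avoids the empty grid. *)
Lemma window_fluxP n w : good w -> (0 < n)%N ->
  is_flux (pts w) (nu w) (x - n%:R) x t (window_flux n w) /\
  \forall N \near \oo, flux N.+1 N.+1
    (box_bits (pts w) (nu w) x n%:R t N.+1) = window_flux n w.
Proof.
move=> gw n0; have [fX fY] := gw n.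
have [M _ HM] := near_generic (ler0n R n) t0 (gw n).
have box N : (M <= N)%N -> is_flux (pts w) (nu w) (x - n%:R) x t
    (flux N.+1 N.+1 (box_bits (pts w) (nu w) x n%:R t N.+1)).
  move=> MN; have gN : generic (pts w) (nu w) x n%:R t N.+1.
    by apply: HM => /=; exact: leqW.
  by have [] := box_flux (ler0n R n) t0 (ltn0Sn N) fY gN.
have fl : is_flux (pts w) (nu w) (x - n%:R) x t (window_flux n w).
  rewrite /window_flux; case: xgetP => [m -> //|/(_ _ (box M (leqnn M)))//].
split => //; exists M => // N /= MN.
exact: is_flux_inj (box N MN) fl.
Qed.

Lemma window_exit_bounds n w : good w -> (0 < n)%N -> 0 <= x - window_exit n w <= x.
Proof.
move=> gw n0; have [fl _] := window_fluxP gw n0.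
rewrite /window_exit; set Z := sup _.
have Zx : Z <= x.
  by apply: sup_le_ub => [|z [/andP[]]//]; have [] := exits_sup fl.
by rewrite subr_ge0 ge_max Zx x0 /= gerBl le_max lexx orbT.
Qed.

Lemma window_flux_mono n m w : good w -> (0 < n)%N -> (n <= m)%N ->
  (window_flux n w <= window_flux m w)%N.
Proof.
move=> gw n0 nm; have [f1 _] := window_fluxP gw n0.
have [f2 _] := window_fluxP gw (leq_trans n0 nm).
by apply: is_flux_mono f1 f2; rewrite ler_nat.
Qed.

Variable n : nat.
Hypotheses (n0 : (0 < n)%N) (xn : x <= n%:R).

Let a0 : 0 < n%:R :> R. Proof. by rewrite ltr0n. Qed.

Definition bits_of N w := box_bits (pts w) (nu w) x n%:R t N.+1.

Let u N := source_prob lam n%:R N.+1 : R.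
Let ps N := box_probs N.+1 N.+1 (u N) (cell_prob n%:R t N.+1).

Lemma mean_box N (f : seq bool -> R) : (forall l, 0 <= f l) ->
  mean P (fun w => f (bits_of N w)) = expect (ps N) f.
Proof.
move=> f0; rewrite /mean unlock.
by rewrite (box_law model x N.+1 (ler0n R n) t0 f0).
Qed.

Lemma measurable_bits_of N (f : seq bool -> R) D :
  measurable_fun D (fun w => f (bits_of N w)).
Proof.
apply: measurable_funTS.
exact: (measurable_box model x N.+1 (ler0n R n) t0 f).
Qed.

Let fl N w : R := (flux N.+1 N.+1 (bits_of N w))%:R.
Let sr N w : R := (right_sources x n%:R N.+1 (bits_of N w))%:R.
Let Fl w : R := (window_flux n w)%:R.

Let fl_cvg w : good w -> fl ^~ w @ \oo --> Fl w.
Proof.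
move=> gw; apply: cvg_near_cst; have [_] := window_fluxP gw n0.
by apply: filterS => N; rewrite /fl /Fl => ->.
Qed.

Let sr_cvg w : good w -> sr ^~ w @ \oo --> nux w.
Proof.
move=> gw; have xa : 0 <= x <= n%:R by rewrite x0.
have [M _ HM] := near_right_sources xa t0 (gw n).
apply: cvg_near_cst; exists M => // N /= MN.
by rewrite /sr /bits_of /sources_in HM //= leqW.
Qed.

Let fl_le N w : good w -> 0 <= fl N w <= points_in pts x t n w.
Proof.
move=> gw; rewrite ler0n /= ler_nat.
by apply: box_flux_le => //; have [] := gw n.
Qed.

Let sr_le N w : good w -> 0 <= sr N w <= nux w.
Proof.
move=> gw; rewrite ler0n /= ler_nat; apply: right_sources_le => //.
  by rewrite x0.
by have [] := gw n.
Qed.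

Let gm := proj1 (good_full x lam0 t0 model).
Let gP := proj2 (good_full x lam0 t0 model).

Let nat_le_sq (k : nat) : k%:R <= k%:R ^+ 2 :> R.
Proof. by rewrite -natrX ler_nat; case: k => // k; exact: leq_pmulr. Qed.

Let points_sq := proj2 (points_in_moments x lam0 t0 model n).

(** The squared number of points in the window is integrable and dominates both the flux and its
    square. *)
Lemma window_flux_limits :
  [/\ measurable_fun good Fl,
    mean P (fl N) @[N --> \oo] --> mean P Fl,
    mean P (fun w => fl N w ^+ 2) @[N --> \oo] --> mean P (fun w => Fl w ^+ 2),
    P.-integrable good (EFin \o Fl) &
    P.-integrable good (EFin \o (fun w => Fl w ^+ 2))].
Proof.
have [m1 i1 c1] : [/\ measurable_fun good Fl, P.-integrable good (EFin \o Fl) &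
    mean P (fl N) @[N --> \oo] --> mean P Fl].
  apply: (mean_cvg gm gP _ fl_cvg points_sq) => [N|N w gw].
    exact: (@measurable_bits_of N (fun c => (flux N.+1 N.+1 c)%:R)).
  have /andP[f0 f1] := fl_le N gw.
  by rewrite ger0_norm //; apply: le_trans f1 _; exact: nat_le_sq.
have [m2 i2 c2] : [/\ measurable_fun good (fun w => Fl w ^+ 2),
    P.-integrable good (EFin \o (fun w => Fl w ^+ 2)) &
    mean P (fun w => fl N w ^+ 2) @[N --> \oo] --> mean P (fun w => Fl w ^+ 2)].
  apply: (mean_cvg gm gP _ _ points_sq) => [N|w gw|N w gw].
  - exact: (@measurable_bits_of N (fun c => (flux N.+1 N.+1 c)%:R ^+ 2)).
  - by apply: (cvgM (fl_cvg gw) (fl_cvg gw)).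
  - have /andP[f0 f1] := fl_le N gw.
    by rewrite ger0_norm ?sqr_ge0 // lerXn2r // nnegrE // (le_trans f0).
by split.
Qed.

Lemma window_covariance :
  [/\ measurable_fun good (fun w => x - window_exit n w) &
  mean P (fun w => nux w * Fl w) + lam * mean P (fun w => x - window_exit n w) =
  mean P nux * mean P Fl].
Proof.
have [ms is1 is2 _ _] := sources_in_moments lam0 x0 t0 model.
have [_ c1 _ _ _] := window_flux_limits.
(* The product of sources and flux is dominated by a sum of squares of Poisson counts. *)
have idom : P.-integrable good
    (EFin \o (fun w => nux w ^+ 2 + points_in pts x t n w ^+ 2)).
  by apply: (integrableD gm is2 points_sq).
have [_ _ c2] : [/\ measurable_fun good (fun w => nux w * Fl w),
    P.-integrable good (EFin \o (fun w => nux w * Fl w)) &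
    mean P (fun w => sr N w * fl N w) @[N --> \oo] --> mean P (fun w => nux w * Fl w)].
  apply: (mean_cvg gm gP _ _ idom) => [N|w gw|N w gw].
  - exact: (@measurable_bits_of N (fun c =>
      (right_sources x n%:R N.+1 c)%:R * (flux N.+1 N.+1 c)%:R)).
  - by apply: (cvgM (sr_cvg gw) (fl_cvg gw)).
  - have /andP[f0 f1] := fl_le N gw; have /andP[s0 s1] := sr_le N gw.
    rewrite ger0_norm ?mulr_ge0 //.
    apply: (@le_trans _ _ (nux w * points_in pts x t n w)); first exact: ler_pM.
    have nu0 : 0 <= nux w by exact: le_trans s0 s1.
    have pt0 : 0 <= points_in pts x t n w by exact: le_trans f0 f1.
    by nra.
have [_ _ c3] : [/\ measurable_fun good nux, P.-integrable good (EFin \o nux) &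
    mean P (sr N) @[N --> \oo] --> mean P nux].
  apply: (mean_cvg gm gP _ sr_cvg is1) => [N|N w gw].
    exact: (@measurable_bits_of N (fun c => (right_sources x n%:R N.+1 c)%:R)).
  by have /andP[s0 s1] := sr_le N gw; rewrite ger0_norm.
pose gn N w : R := gain x n%:R N.+1 (bits_of N w).
have icst : P.-integrable good (EFin \o (fun _ => n%:R : R)).
  exact: finite_measure_integrable_cst.
have [m4 _ c4] : [/\ measurable_fun good (fun w => x - window_exit n w),
    P.-integrable good (EFin \o (fun w => x - window_exit n w)) &
    mean P (gn N) @[N --> \oo] --> mean P (fun w => x - window_exit n w)].
  apply: (mean_cvg gm gP _ _ icst) => [N|w gw|N w gw].
  - exact: (@measurable_bits_of N (gain x n%:R N.+1)).
  - have [fl1 _] := window_fluxP gw n0.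
    have xa : 0 <= x <= n%:R by rewrite x0.
    have := gain_cvg a0 xa t0 (gw n) fl1.
    by rewrite -cvg_shiftS.
  - have /andP[g0 g1] := gain_bound x N.+1 (bits_of N w) (ltW a0).
    by rewrite ger0_norm.
split => //.
have c5 : u N * (N.+1%:R / n%:R) @[N --> \oo] --> lam.
  by have := cvg_source_ratio lam0 a0; rewrite -cvg_shiftS.
have id N : mean P (fun w => sr N w * fl N w) + u N * (N.+1%:R / n%:R) * mean P (gn N) =
    mean P (sr N) * mean P (fl N).
  rewrite (@mean_box N (fun c => (right_sources x n%:R N.+1 c)%:R * (flux N.+1 N.+1 c)%:R));
    last by move=> c; rewrite mulr_ge0.
  rewrite (@mean_box N (gain x n%:R N.+1)); last first.
    by move=> c; have /andP[] := gain_bound x N.+1 c (ltW a0).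
  rewrite (@mean_box N (fun c => (right_sources x n%:R N.+1 c)%:R)) //.
  rewrite (@mean_box N (fun c => (flux N.+1 N.+1 c)%:R)) //.
  exact: expect_right_sources_flux.
have L := cvgD c2 (cvgM c5 c4); have Rr := cvgM c3 c1.
have L' : mean P (sr N) * mean P (fl N) @[N --> \oo] -->
    mean P (fun w => nux w * Fl w) + lam * mean P (fun w => x - window_exit n w).
  by under eq_fun do rewrite -id; exact: L.
have R' : mean P (sr N) * mean P (fl N) @[N --> \oo] -->
    mean P nux * mean P Fl by exact: Rr.
by rewrite -(cvg_lim _ L') // -(cvg_lim _ R').
Qed.

End window_limit.

(** * Widening the window *)

Section full_limit.
Variable R : realType.

Lemma nat_bounded_stationary (v : nat -> nat) B :
  {homo v : i j / (i <= j)%N} -> (forall k, (v k <= B)%N) ->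
  exists K, forall k, (K <= k)%N -> v k = v K.
Proof.
move=> vm vB; suff H r K : (B - v K <= r)%N ->
    exists K', forall k, (K' <= k)%N -> v k = v K' by exact: (H B 0%N (leq_subr _ _)).
elim: r K => [|r IH] K hK.
  exists K => k Kk; apply/eqP; rewrite eqn_leq [X in _ && X]vm // andbT.
  by apply: leq_trans (vB k) _; rewrite -subn_eq0 -leqn0.
have [h|/existsNP[k /not_implyP[Kk vk]]] :=
  pselect (forall k, (K <= k)%N -> v k = v K); first by exists K.
apply: (IH k); have := vm _ _ Kk; have := vB k.
by move/eqP: vk => vk vkB vKk; lia.
Qed.

Context d (T : measurableType d) (P : probability T R).
Variables (pts : T -> set (R * R)) (nu : T -> set R) (lam x t : R).
Hypotheses (lam0 : 0 < lam) (x0 : 0 <= x) (t0 : 0 <= t).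
Hypothesis model : hammersley_model P pts nu lam.

Local Notation good := (good pts nu x t).
Local Notation nux := (sources_in nu x).
Local Notation wflux := (window_flux pts nu x t).
Local Notation m := (t / lam).

(** [M] is the limiting moment of the binomial flux with sinks. The error [e] is uniform in large
    [N], so it survives the limit. *)
Lemma window_flux_bounds (phi : nat -> R) (M : R) (n : nat) (e : R) : 0 < e ->
  (0 < n)%N -> (forall k, 0 <= phi k) ->
  (forall N, (2 * (lam * n%:R) <= N.+1%:R) ->
    expect (box_probs N.+1 N.+1 (source_prob lam n%:R N.+1) (cell_prob n%:R t N.+1))
        (fun c => phi (flux N.+1 N.+1 c)) <=
    expect (nseq N.+1 (sink_prob lam n%:R t N.+1)) (fun s => phi (count id s)) <=
    expect (box_probs N.+1 N.+1 (source_prob lam n%:R N.+1) (cell_prob n%:R t N.+1))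
        (fun c => phi (flux N.+1 N.+1 c)) + e) ->
  expect (nseq N (sink_prob lam n%:R t N)) (fun s => phi (count id s))
    @[N --> \oo] --> M ->
  mean P (fun w => phi (flux N.+1 N.+1 (bits_of pts nu x t n N w))) @[N --> \oo] -->
    mean P (fun w => phi (wflux n w)) ->
  M - e <= mean P (fun w => phi (wflux n w)) <= M.
Proof.
move=> e0 n0 phi0 H; rewrite -cvg_shiftS => cM cF.
have near2 : \forall N \near \oo, 2 * (lam * n%:R) <= N.+1%:R.
  near=> N; apply: (@le_trans _ _ N%:R); last by rewrite ler_nat.
  by near: N; exact: nbhs_infty_ger.
have bE N : mean P (fun w => phi (flux N.+1 N.+1 (bits_of pts nu x t n N w))) =
    expect (box_probs N.+1 N.+1 (source_prob lam n%:R N.+1) (cell_prob n%:R t N.+1))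
        (fun c => phi (flux N.+1 N.+1 c)).
  exact: (mean_box x t0 model n N (f := fun c => phi (flux N.+1 N.+1 c))).
apply/andP; split; last first.
  apply: (ler_cvg_to cF cM); apply: filterS near2 => N /H /andP[h _].
  by rewrite bE.
have cFe : mean P (fun w => phi (flux N.+1 N.+1 (bits_of pts nu x t n N w))) + e
    @[N --> \oo] --> mean P (fun w => phi (wflux n w)) + e.
  by apply: cvgD => //; exact: cvg_cst.
rewrite lerBlDr; apply: (ler_cvg_to cM cFe).
by apply: filterS near2 => N /H /andP[_ h]; rewrite /= bE.
Unshelve. all: by end_near. Qed.

Lemma window_flux_moments (e : R) : 0 < e -> exists n1 : nat, forall n,
  (n1 <= n)%N ->
  m - e <= mean P (fun w => (wflux n w)%:R) <= m /\
  m + m ^+ 2 - e <= mean P (fun w => (wflux n w)%:R ^+ 2) <= m + m ^+ 2.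
Proof.
move=> e0; have [A0 HA] := box_flux_defect lam0 t0 e0.
exists (maxn 1 (maxn (Num.bound `|x|) (Num.bound `|A0|))) => n.
rewrite !geq_max => /andP[n0 /andP[xn An]].
have big (y : R) : (Num.bound `|y| <= n)%N -> y <= n%:R.
  move=> yn; apply: le_trans (ler_norm y) _.
  by apply: le_trans (ltW (archi_boundP (normr_ge0 y))) _; rewrite ler_nat.
have a0 : 0 < n%:R :> R by rewrite ltr0n.
have [_ c1 c2 _ _] := window_flux_limits x lam0 t0 model n0.
split.
- apply: (@window_flux_bounds (fun k => k%:R) m n e e0 n0 (fun k => ler0n R k) _ _ c1).
    move=> N hN; apply: HA => // [|i j ij|i]; [exact: big|by rewrite ler_nat|].
    by rewrite -natrX ler_nat; case: i => // i; exact: leq_pmulr.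
  by under eq_fun do rewrite expect_count; exact: (cvg_sink_prob lam0 t0 a0).
- apply: (@window_flux_bounds (fun k => k%:R ^+ 2) (m + m ^+ 2) n e e0 n0
    (fun k => sqr_ge0 k%:R) _ _ c2).
    move=> N hN; apply: (HA n%:R N.+1 (fun k => k%:R ^+ 2)) => // [|i j ij].
    - exact: big.
    - by rewrite lerXn2r ?nnegrE ?ler_nat.
  by under eq_fun do rewrite expect_count2; exact: (cvg_sink_prob2 lam0 t0 a0).
Qed.

(** Windows are indexed from [b] on, so that each has positive width and contains [0,x]. *)
Let b := (Num.bound `|x|).+1.
Let idx k := (k + b)%N.
Let idx_gt0 k : (0 < idx k)%N. Proof. by rewrite /idx /b addnS. Qed.
Let x_le_b : x <= b%:R.
Proof.
apply: le_trans (ler_norm x) _.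
apply: le_trans (ltW (archi_boundP (normr_ge0 x))) _.
by rewrite ler_nat leqnSn.
Qed.
Let x_le_idx k : x <= (idx k)%:R.
Proof. by apply: le_trans x_le_b _; rewrite ler_nat leq_addl. Qed.

Let gm := proj1 (good_full x lam0 t0 model).
Let gP := proj2 (good_full x lam0 t0 model).
Let g k w : \bar R := ((wflux (idx k) w)%:R ^+ 2)%:E.
Let G w : \bar R := limn (g ^~ w).

Let g_nd w : good w -> {homo g ^~ w : i j / (i <= j)%N >-> (i <= j)%E}.
Proof.
move=> gw i j ij; rewrite /g lee_fin lerXn2r ?nnegrE // ler_nat.
by apply: window_flux_mono => //; rewrite leq_add2r.
Qed.

Let g_le_G k w : good w -> (g k w <= G w)%E.
Proof.
move=> gw; rewrite /G.
rewrite (cvg_lim _ (ereal_nondecreasing_cvgn (g_nd gw))) //.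
by apply: ereal_sup_ubound; exists k.
Qed.

(** The squared fluxes increase with the window and their means stay below m + m^2. By monotone
    convergence their limit [G] is integrable, hence finite almost surely; there the integer fluxes
    are bounded and eventually constant. *)
Lemma limit_event : exists D : set T, [/\ measurable D, P D = 1%E, D `<=` good,
   P.-integrable D G & forall w, D w -> G w \is a fin_num].
Proof.
have mg k : measurable_fun good (g k).
  have [mF _ _ _ _] := window_flux_limits x lam0 t0 model (idx_gt0 k).
  apply/measurable_EFinP; under eq_fun do rewrite expr2.
  exact: measurable_funM.
have g0 k w : good w -> (0 <= g k w)%E by move=> _; rewrite lee_fin sqr_ge0.
have cv := @cvg_monotone_convergence _ _ _ P good gm g mg g0 g_nd.
have G0 w : good w -> (0 <= G w)%E.
  by move=> gw; exact: le_trans (g0 0%N w gw) (g_le_G 0 gw).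
have mG : measurable_fun good G.
  apply: (emeasurable_fun_cvg _ _ mg) => w gw.
  by apply: ereal_nondecreasing_is_cvgn; exact: g_nd.
have iG : P.-integrable good G.
  apply/integrableP; split => //.
  rewrite (eq_integral G); last by move=> w /set_mem gw; rewrite gee0_abs ?G0.
  apply: (@le_lt_trans _ _ (m + m ^+ 2)%:E); last by rewrite ltry.
  have [n1 Hn] := window_flux_moments ltr01.
  apply: (cvge_to_le cv); exists n1 => // k /= n1k.
  have [_ _ _ _ i2] := window_flux_limits x lam0 t0 model (idx_gt0 k).
  rewrite -(integral_full _ gm gP) /g.
  have := meanE gm gP i2; rewrite unlock => ->.
  by rewrite lee_fin; have [_ /andP[]] := Hn (idx k) (leq_trans n1k (leq_addr _ _)).
have [N [mN PN subN]] := integrable_ae gm iG.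
have mD : measurable (good `&` ~` N) by apply: measurableI => //; exact: measurableC.
exists (good `&` ~` N); split => //.
- apply: probability_setI1 => //; first exact: measurableC.
  by rewrite probability_setC // PN sube0.
- by apply: (integrableS gm mD _ iG) => w [].
- by move=> w [gw nN]; apply: contrapT => h; apply: nN; apply: subN => /(_ gw).
Qed.


Definition limit_flux w : nat :=
  xget 0%N [set k | \forall n \near \oo, wflux n w = k].

Let limit_fluxP w : good w -> G w \is a fin_num -> exists n0, [/\ (0 < n0)%N,
  x <= n0%:R & forall n, (n0 <= n)%N -> wflux n w = limit_flux w].
Proof.
move=> gw Gw; pose v k := wflux (idx k) w.
have [K HK] : exists K, forall k, (K <= k)%N -> v k = v K.
  apply: (@nat_bounded_stationary v (Num.bound `|fine (G w)|)) => [i j ij|k].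
    by apply: window_flux_mono => //; rewrite leq_add2r.
  rewrite -(ler_nat R); apply: le_trans (ltW (archi_boundP (normr_ge0 _))).
  apply: le_trans (ler_norm _); rewrite -lee_fin fineK //.
  apply: le_trans (g_le_G k gw); rewrite /g lee_fin -/(v k) -natrX ler_nat.
  by case: (v k) => // j; exact: leq_pmulr.
have Hn n : (idx K <= n)%N -> wflux n w = v K.
  move=> Kn; have bn : (b <= n)%N by rewrite (leq_trans _ Kn) // leq_addl.
  rewrite -(HK (n - b)%N); first by rewrite /v /idx subnK.
  by rewrite leq_subRL // addnC.
have near_v : \forall n \near \oo, wflux n w = v K by exists (idx K).
exists (idx K); split => // n Kn; rewrite Hn // /limit_flux.
case: xgetP => [k _ hk|/(_ _ near_v)//].
near \oo => j; transitivity (wflux j w); [apply/esym|]; near: j; [exact: near_v|exact: hk].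
Unshelve. all: by end_near. Qed.

Let configuration w : good w -> G w \is a fin_num ->
  [/\ nu_count (nu w) x = (nux w)%:E,
    Llam (pts w) (nu w) x t = (nux w + (limit_flux w)%:R)%:E,
    \forall k \near \oo, wflux (idx k) w = limit_flux w &
    \forall k \near \oo,
      window_exit pts nu x t (idx k) w = Zplus (pts w) (nu w) x t].
Proof.
move=> gw Gw; have [n0 [n00 xn0 Hn]] := limit_fluxP gw Gw.
have fluxm n : (n0 <= n)%N ->
    is_flux (pts w) (nu w) (x - n%:R) x t (limit_flux w).
  by move=> n0n; rewrite -(Hn n n0n);
    have [] := window_fluxP t0 gw (leq_trans n00 n0n).
split.
- rewrite (nu_countE x0 gw (lexx x)) (@ncount_eq0 _ _ x x) ?subr0 //.
  by move=> y _ /andP[h1 h2]; have := lt_le_trans h1 h2; rewrite ltxx.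
- exact: (Llam_flux x0 gw fluxm).
- by exists n0 => // k /= n0k; apply: Hn; rewrite (leq_trans n0k) // leq_addr.
- exists n0 => // k /= n0k.
  have n0i : (n0 <= idx k)%N by rewrite (leq_trans n0k) // leq_addr.
  rewrite /window_exit (Hn _ n0i).
  by rewrite (Zplus_exits x0 gw (fun n h => fluxm n (leq_trans n0i h))).
Qed.

Lemma limit_means : exists D : set T, [/\ measurable D, P D = 1%E,
  (forall w, D w -> nu_count (nu w) x = (nux w)%:E /\
     Llam (pts w) (nu w) x t = (nux w + (limit_flux w)%:R)%:E),
  [/\ P.-integrable D (EFin \o (fun w => (limit_flux w)%:R)),
    P.-integrable D (EFin \o (fun w => (limit_flux w)%:R ^+ 2)),
    P.-integrable D (EFin \o (fun w => nux w * (limit_flux w)%:R)),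
    P.-integrable D (EFin \o nux) &
    P.-integrable D (EFin \o (fun w => nux w ^+ 2))] &
  [/\ P.-integrable D (EFin \o (fun w => Zplus (pts w) (nu w) x t)),
    mean P (fun w => (limit_flux w)%:R) = m,
    mean P (fun w => (limit_flux w)%:R ^+ 2) = m + m ^+ 2 &
    mean P (fun w => nux w * (limit_flux w)%:R) = lam * x * m -
      lam * (x - mean P (fun w => Zplus (pts w) (nu w) x t))]].
Proof.
have [D [mD PD Dg iG Gfin]] := limit_event.
have cfg w : D w -> _ := fun Dw => configuration (Dg w Dw) (Gfin w Dw).
have [ms is1 is2 e1 e2] := sources_in_moments lam0 x0 t0 model.
have onD f : P.-integrable good f -> P.-integrable D f.
  by move=> i; apply: (integrableS gm mD Dg i).
have iGf : P.-integrable D (EFin \o (fun w => fine (G w))).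
  by apply: (eq_integrable mD G _ _ iG) => w /set_mem Dw /=; rewrite fineK ?Gfin.
pose Fk k w : R := (wflux (idx k) w)%:R.
have mFk k : measurable_fun D (Fk k).
  have [h _ _ _ _] := window_flux_limits x lam0 t0 model (idx_gt0 k).
  exact: measurable_funS gm Dg h.
have Fk2 k w : D w -> Fk k w ^+ 2 <= fine (G w).
  by move=> Dw; rewrite -lee_fin fineK ?Gfin //; exact: g_le_G (Dg w Dw).
have Fk1 k w : Fk k w <= Fk k w ^+ 2.
  by rewrite /Fk -natrX ler_nat; case: (wflux _ _) => // j; exact: leq_pmulr.
have Fk0 k w : 0 <= Fk k w by exact: ler0n.
have cFk w : D w -> Fk ^~ w @ \oo --> ((limit_flux w)%:R : R).
  move=> Dw; apply: cvg_near_cst; have [_ _ h _] := cfg w Dw.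
  by apply: filterS h => k; rewrite /Fk => ->.
have near_cvg (u : nat -> R) l : (forall e, 0 < e -> exists n1 : nat,
    forall n, (n1 <= n)%N -> l - e <= u n <= l) -> u (idx k) @[k --> \oo] --> l.
  move=> H; apply/cvgrPdist_le => e /H[n1 Hn]; exists n1 => // k /= n1k.
  have /andP[h1 h2] := Hn (idx k) (leq_trans n1k (leq_addr _ _)).
  by rewrite ger0_norm ?subr_ge0 //; lra.
have [m1 i1 c1] : [/\ measurable_fun D (fun w => (limit_flux w)%:R : R),
    P.-integrable D (EFin \o (fun w => (limit_flux w)%:R)) &
    mean P (Fk k) @[k --> \oo] --> mean P (fun w => (limit_flux w)%:R)].
  apply: (mean_cvg mD PD mFk cFk iGf) => k w Dw.
  by rewrite ger0_norm //; apply: le_trans (Fk1 k w) (Fk2 k w Dw).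
have [m2 i2 c2] : [/\ measurable_fun D (fun w => (limit_flux w)%:R ^+ 2 : R),
    P.-integrable D (EFin \o (fun w => (limit_flux w)%:R ^+ 2)) &
    mean P (fun w => Fk k w ^+ 2) @[k --> \oo] -->
      mean P (fun w => (limit_flux w)%:R ^+ 2)].
  apply: (mean_cvg mD PD _ _ iGf) => [k|w Dw|k w Dw].
  - by under eq_fun do rewrite expr2; exact: measurable_funM.
  - by apply: (cvgM (cFk w Dw) (cFk w Dw)).
  - by rewrite ger0_norm ?sqr_ge0 // Fk2.
have idom : P.-integrable D (EFin \o (fun w => nux w ^+ 2 + fine (G w))).
  by apply: (integrableD mD (onD _ is2) iGf).
have msD : measurable_fun D nux by exact: measurable_funS gm Dg ms.
have [m3 i3 c3] : [/\ measurable_fun D (fun w => nux w * (limit_flux w)%:R),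
    P.-integrable D (EFin \o (fun w => nux w * (limit_flux w)%:R)) &
    mean P (fun w => nux w * Fk k w) @[k --> \oo] -->
      mean P (fun w => nux w * (limit_flux w)%:R)].
  apply: (mean_cvg mD PD _ _ idom) => [k|w Dw|k w Dw].
  - exact: measurable_funM.
  - by apply: cvgM (cFk w Dw); exact: cvg_cst.
  - have nu0 : 0 <= nux w by exact: ler0n.
    rewrite ger0_norm ?mulr_ge0 //.
    have h := Fk2 k w Dw; have h0 := Fk0 k w.
    by nra.
pose Z w := Zplus (pts w) (nu w) x t.
have [icst _] := mean_cst x mD PD.
have wc k := window_covariance lam0 x0 t0 model (idx_gt0 k) (x_le_idx k).
have [m4 i4 c4] : [/\ measurable_fun D (fun w => x - Z w),
    P.-integrable D (EFin \o (fun w => x - Z w)) &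
    mean P (fun w => x - window_exit pts nu x t (idx k) w) @[k --> \oo] -->
      mean P (fun w => x - Z w)].
  apply: (mean_cvg mD PD _ _ icst) => [k|w Dw|k w Dw].
  - by have [h _] := wc k; exact: measurable_funS gm Dg h.
  - apply: cvg_near_cst; have [_ _ _ h] := cfg w Dw.
    by apply: filterS h => k ->.
  - have /andP[h1 h2] := window_exit_bounds x0 t0 (Dg w Dw) (idx_gt0 k).
    by rewrite ger0_norm.
(* The limit was taken for [x - Z], the quantity in the window identity, bounded by [x]; the mean of
   [Z] follows by linearity. *)
have [j4 E4] := mean_scale (-1) mD PD i4.
have [_ Ec] := mean_cst x mD PD.
have [iZ EZ] : P.-integrable D (EFin \o Z) /\
    mean P Z = x + -1 * mean P (fun w => x - Z w).
  have := mean_add mD PD icst j4; rewrite Ec E4.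
  suff -> : (fun w => x + -1 * (x - Z w)) = Z by [].
  by apply/funext => w; rewrite mulN1r subKr.
have E1 : mean P (fun w => (limit_flux w)%:R) = m.
  apply/esym; rewrite -(cvg_lim _ c1) //; apply/esym/cvg_lim => //.
  apply: (near_cvg (fun n => mean P (fun w => (wflux n w)%:R))) => e e0.
  by have [n1 H] := window_flux_moments e0; exists n1 => n /H[].
have E2 : mean P (fun w => (limit_flux w)%:R ^+ 2) = m + m ^+ 2.
  apply/esym; rewrite -(cvg_lim _ c2) //; apply/esym/cvg_lim => //.
  apply: (near_cvg (fun n => mean P (fun w => (wflux n w)%:R ^+ 2))) => e e0.
  by have [n1 H] := window_flux_moments e0; exists n1 => n /H[].
exists D; split => //.
- by move=> w /cfg[].
- by split => //; exact: onD.
split => //; have c5 : mean P (fun w => nux w * Fk k w) +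
    lam * mean P (fun w => x - window_exit pts nu x t (idx k) w) @[k --> \oo] -->
    mean P (fun w => nux w * (limit_flux w)%:R) + lam * mean P (fun w => x - Z w).
  by apply: cvgD => //; apply: cvgM => //; exact: cvg_cst.
have c6 : mean P nux * mean P (Fk k) @[k --> \oo] --> mean P nux * m.
  by rewrite -E1; apply: cvgM => //; exact: cvg_cst.
have c7 : mean P nux * mean P (Fk k) @[k --> \oo] -->
    mean P (fun w => nux w * (limit_flux w)%:R) + lam * mean P (fun w => x - Z w).
  have wk k : mean P nux * mean P (Fk k) = mean P (fun w => nux w * Fk k w) +
      lam * mean P (fun w => x - window_exit pts nu x t (idx k) w).
    by have [_ <-] := wc k.
  by under eq_fun do rewrite wk; exact: c5.
have : mean P (fun w => nux w * (limit_flux w)%:R) + lam * mean P (fun w => x - Z w) =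
    mean P nux * m by rewrite -(cvg_lim _ c7) // (cvg_lim _ c6).
by rewrite EZ -e1 => <-; ring.
Qed.

End full_limit.

(** * Covariance and variance from the joint moments of sources and flux *)

Theorem theorem5p3 (R : realType) (d : measure_display) (T : measurableType d)
    (P : probability T R) (pts : T -> set (R * R)) (nu : T -> set R)
    (lam x t : R) :
  0 < lam -> 0 <= x -> 0 <= t ->
  hammersley_model P pts nu lam ->
  covariance P (fun w => fine (nu_count (nu w) x))
               (fun w => fine (Llam (pts w) (nu w) x t))
    = (lam%:E * 'E_P[fun w => Zplus (pts w) (nu w) x t])%E /\
  variance P (fun w => fine (Llam (pts w) (nu w) x t))
    = ((t / lam - lam * x)%:E
       + (2 * lam)%:E * 'E_P[fun w => Zplus (pts w) (nu w) x t])%E.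
Proof.
move=> lam0 x0 t0 model.
have [D [mD PD cfg [iF iFF isF iS iss] [iZ EF EFF EsF]]] :=
  limit_means lam0 x0 t0 model.
have [_ _ _ Es Ess] := sources_in_moments lam0 x0 t0 model.
pose s := sources_in nu x; pose F w : R := (limit_flux pts nu x t w)%:R.
set X := fun w => fine (nu_count (nu w) x).
set Y := fun w => fine (Llam (pts w) (nu w) x t).
set Z := fun w => Zplus (pts w) (nu w) x t.
have XD w : D w -> X w = s w by move=> /cfg[e _]; rewrite /X e.
have YD w : D w -> Y w = s w + F w by move=> /cfg[_ e]; rewrite /Y e.
have [iL EL] := mean_add mD PD iS iF.
pose c1 := lam * x; pose c2 := lam * x + t / lam.
have EX : fine 'E_P[X] = c1 by rewrite -[LHS]/(mean P X) (eq_mean mD PD XD).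
have EY : fine 'E_P[Y] = c2.
  by rewrite -[LHS]/(mean P Y) (eq_mean mD PD YD) EL Es EF.
rewrite (meanE mD PD iZ) /variance unlock EX EY; split.
  (* The centred product is controlled only on [D], where it equals this polynomial in [s] and [F],
     all of whose terms have known means. *)
  pose g w := (s w ^+ 2 + s w * F w) +
    (- c2 * s w + (- c1 * (s w + F w) + c1 * c2)).
  rewrite (@eq_expectation_full _ _ _ P D _ g mD PD); last first.
    move=> w Dw; rewrite /g -[LHS]/((X w - c1) * (Y w - c2)) XD // YD //.
    by ring.
  have [i1 E1] := mean_add mD PD iss isF.
  have [i2 E2] := mean_scale (- c2) mD PD iS.
  have [i3 E3] := mean_scale (- c1) mD PD iL.
  have [i4 E4] := mean_cst (c1 * c2) mD PD.
  have [i5 E5] := mean_add mD PD i3 i4.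
  have [i6 E6] := mean_add mD PD i2 i5.
  have [i7 E7] := mean_add mD PD i1 i6.
  rewrite (meanE mD PD i7) E7 E6 E5 E4 E3 E2 E1 EL Ess EsF Es EF -EFinM.
  by congr EFin; rewrite /c1 /c2; ring.
pose g w := (s w ^+ 2 + (2 * (s w * F w) + F w ^+ 2)) +
  (- (2 * c2) * (s w + F w) + c2 ^+ 2).
rewrite (@eq_expectation_full _ _ _ P D _ g mD PD); last first.
  move=> w Dw; rewrite /g -[LHS]/((Y w - c2) * (Y w - c2)) YD //.
  by ring.
have [i1 E1] := mean_scale 2 mD PD isF.
have [i2 E2] := mean_add mD PD i1 iFF.
have [i3 E3] := mean_add mD PD iss i2.
have [i4 E4] := mean_scale (- (2 * c2)) mD PD iL.
have [i5 E5] := mean_cst (c2 ^+ 2) mD PD.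
have [i6 E6] := mean_add mD PD i4 i5.
have [i7 E7] := mean_add mD PD i3 i6.
rewrite (meanE mD PD i7) E7 E6 E5 E4 E3 E2 E1 EL Ess EsF Es EF EFF -EFinM -EFinD.
by congr EFin; rewrite /c2; ring.
Qed.
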